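(* Let $P(x),Q(x)$ be rational functions and let $\Gamma$ be a non-closed curve containing no poles of $P(x),Q(x)$ which starts at the point $a$ and ends at the point $b$. Suppose that $$m_{i,j}=\int_\Gamma P^i(x)Q^j(x)p(x)\,dx=0$$ for $0\le i\le\infty$, $1\le j\le d_a+d_b-1$, where $d_a$ (resp. $d_b$) is the multiplicity of the point $a$ (resp. $b$) with respect to $P(x)$. Then there exist rational functions $\tilde P,\tilde Q,W$ such that $P(x)=\tilde P(W(x))$, $Q(x)=\tilde Q(W(x))$, and $W(a)=W(b)$.
   Context: Here $p(x)=P'(x)$ is the derivative of $P$. Curves are oriented and piecewise-smooth in $\mathbb C$; non-closed means $a\neq b$. The multiplicity $d_a$ of $a$ with respect to $P$ is the order of vanishing of $P(x)-P(a)$ at $x=a$ (so $d_a=1$ if $a$ is not a critical point of $P$), and similarly for $d_b$.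
   Formalization: P is assumed nonconstant (needed for the multiplicities d_a, d_b to be defined) and Q not identically zero: for Q = 0, P = x all the moments vanish, but no W with W(a) = W(b) exists. *)

(* Defs.v *)
From HB Require Import structures.
From mathcomp Require Import all_boot all_order all_algebra.
From mathcomp Require Import generic_quotient complex.
From mathcomp Require Import all_classical all_reals all_analysis.

Set Implicit Arguments.
Unset Strict Implicit.
Unset Printing Implicit Defensive.

Import Order.TTheory GRing.Theory Num.Theory.
Import numFieldNormedType.Exports.

Local Open Scope classical_set_scope.
Local Open Scope ring_scope.

Section RationalFunctions.
Variable F : fieldType.

Definition ratfun := {fraction {poly F}}.

Definition rconst (c : F) : ratfun := FracField.tofrac c%:P.

(* [repr] picks an arbitrary representing fraction: dividing out the gcd
   makes zeros of [rden f] exactly the poles of [f]. *)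
Definition rnum (f : ratfun) : {poly F} :=
  (frac (repr f)).1 %/ gcdp (frac (repr f)).1 (frac (repr f)).2.

Definition rden (f : ratfun) : {poly F} :=
  (frac (repr f)).2 %/ gcdp (frac (repr f)).1 (frac (repr f)).2.

Definition pole (f : ratfun) (x : F) : bool := root (rden f) x.

(* The junk value 0 is returned at a pole. *)
Definition reval (f : ratfun) (x : F) : F := (rnum f).[x] / (rden f).[x].

(* Value in the projective line, [None] being the point at infinity. *)
Definition proj_eval (f : ratfun) (x : F) : option F :=
  if pole f x then None else Some (reval f x).

Definition rderiv (f : ratfun) : ratfun :=
  FracField.tofrac ((rnum f)^`() * rden f - rnum f * (rden f)^`())
  / FracField.tofrac (rden f ^+ 2).

(* The composition f(g(x)), computed in the field of rational functions; the
   denominator vanishes only if g is constant and equal to a pole of f, in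
   which case the result is the junk value 0. *)
Definition rcomp (f g : ratfun) : ratfun :=
  (map_poly rconst (rnum f)).[g] / (map_poly rconst (rden f)).[g].

(* Order of vanishing at a of f(x) - f(a); meaningful when f is nonconstant
   and a is not a pole of f. *)
Definition multiplicity (f : ratfun) (a : F) : nat :=
  mup a (rnum (f - rconst (reval f a))).

End RationalFunctions.

Section Curves.
Variable R : realType.

Definition ReC (gamma : R -> R[i]) (t : R) : R := complex.Re (gamma t).
Definition ImC (gamma : R -> R[i]) (t : R) : R := complex.Im (gamma t).

(* f is of class C^1 on [u, v], one-sidedly at the endpoints: f is continuous
   on [u, v] and its derivative on ]u, v[ extends continuously to [u, v]. *)
Definition C1_on (u v : R) (f : R -> R) : Prop :=
  {within `[u, v], continuous f} /\
  exists g : R -> R, {within `[u, v], continuous g} /\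
    forall t : R, t \in `]u, v[ -> is_derive t 1 f (g t).

(* Curves are parametrized by [0, 1]. *)
Definition piecewise_smooth (gamma : R -> R[i]) : Prop :=
  exists s : seq R, itv_partition 0 1 s /\
    forall k : nat, (k < size s)%N ->
      C1_on (nth 0 (0 :: s) k) (nth 0 s k) (ReC gamma) /\
      C1_on (nth 0 (0 :: s) k) (nth 0 s k) (ImC gamma).

(* At the finitely many points where gamma is not differentiable the value
   is irrelevant to the integral below. *)
Definition velocity (gamma : R -> R[i]) (t : R) : R[i] :=
  (derive1 (ReC gamma) t +i* derive1 (ImC gamma) t)%C.

Definition contour_integral (gamma : R -> R[i]) (f : R[i] -> R[i]) : R[i] :=
  ((\int[lebesgue_measure]_(t in `[0, 1])
       complex.Re (f (gamma t) * velocity gamma t)) +i*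
   (\int[lebesgue_measure]_(t in `[0, 1])
       complex.Im (f (gamma t) * velocity gamma t)))%C.

End Curves.

(* Main.v *)
(* Vanishing moments and the fundamental theorem of calculus give S(a) = S(b)
   for every rational S, regular on the curve, with S' = h(P) Q^j P', where h is
   a polynomial and 1 <= j < d_a + d_b. The rest is algebra.

   Let z = P - P(a) if P(a) = P(b), z = (P - P(a)) (P - P(b)) otherwise, and
   theta = z d/dz. Products of factors theta - i/d, with i <> 0 and
   d = (deg z)!, isolate the constant Puiseux coefficients of a function g at
   the points above z = 0. When g = z^i Q^j, the function so obtained has a
   derivative divisible by a high power of z, and a small combination of the
   theta^k Q^j corrects it into a function S as above, so that the constant
   coefficients of g at a and b agree.

   Multiplication by Q on the functions regular at a and b, modulo a power of z,
   satisfies a monic equation of degree d_a + d_b, which extends this to all j.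
   So the elements of C(P, Q) take the same value at a and b; in the case
   P(a) <> P(b) the same argument is absurd. By Lüroth's theorem
   C(P, Q) = C(W). *)

(* The moments speak only of global primitives [S], whereas local information at two points is
   wanted. The operators [theta - i/d] act on all Puiseux branches at once, so one rational function
   carries the chosen coefficient at [a] and at [b]. Its correction must be invisible at both
   points. Hence the coordinates on the iterates [theta^k f] are controlled with a loss [r]
   independent of [M]: an error divisible by [z^M] is repaired by a term divisible by [z^(M - r)],
   up to a fixed pole order, and [M] is free.

   The number of moments is explained by [j = 0]: the functions [z^i] have equal constant
   coefficients at [a] and [b] without any hypothesis. So all [0 <= j < d_a + d_b] are available
   when [P(a) = P(b)], and [d_a + d_b] is then the number of zeros of [z] at the two points, which
   is the degree of the equation for [Q].

   Negative powers of [z] are kept throughout because a denominator in [C(P, Q)] may vanish at [a]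
   or [b]: a suitable power of it times some [z^(-l)] is a unit there. *)
Require Import Defs.
From HB Require Import structures.
From mathcomp Require Import all_boot all_order all_algebra.
From mathcomp Require Import generic_quotient complex.
From mathcomp Require Import all_classical all_reals all_analysis.
From mathcomp Require Import measurable_realfun polyXY.
From mathcomp Require Import ring lra zify.

Import Order.TTheory GRing.Theory Num.Theory.
Import numFieldNormedType.Exports.
Local Open Scope ring_scope.

Set Implicit Arguments.
Unset Strict Implicit.
Unset Printing Implicit Defensive.

(** * Rational functions *)

(* Rational functions, with the construction of the fraction field hidden: it
   makes unification diverge. *)
Record funField (C : fieldType) := FunField {
  ff :> fieldType;
  emb : {rmorphism {poly C} -> ff};
  emb_eq0 : forall p, (emb p == 0) = (p == 0);
  fnum : ff -> {poly C};
  fden : ff -> {poly C};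
  fden_neq0 : forall f, fden f != 0;
  fcoprime : forall f, coprimep (fnum f) (fden f);
  fracE : forall f, f = emb (fnum f) / emb (fden f)
}.

Section FunFieldBasics.
Variables (F : fieldType) (K : funField F).
Local Notation "p %:F" := (emb K p) (format "p %:F").
Implicit Types (f g w : K) (p q : {poly F}) (x c : F).

Definition fconst (c : F) : K := emb K c%:P.
HB.instance Definition _ := GRing.RMorphism.copy fconst (emb K \o polyC).

(** These definitions repeat the bodies of [pole], [reval], [rderiv] and [rcomp], so that at [ratFF]
    each is convertible to its counterpart on [ratfun]. *)
Definition fpole f x : bool := root (fden f) x.
Definition feval f x : F := (fnum f).[x] / (fden f).[x].
Definition fderiv f : K :=
  ((fnum f)^`() * fden f - fnum f * (fden f)^`())%:F / (fden f ^+ 2)%:F.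
Definition fcomp f g : K :=
  (map_poly fconst (fnum f)).[g] / (map_poly fconst (fden f)).[g].

Lemma fun_ind (T : K -> Prop) :
  (forall p q, q != 0 -> coprimep p q -> T (p%:F / q%:F)) -> forall f, T f.
Proof.
by move=> Tfrac f; rewrite (fracE f); apply: Tfrac; rewrite ?fden_neq0 ?fcoprime.
Qed.

Lemma emb_inj : injective (emb K).
Proof. by apply/raddf_inj => p /eqP; rewrite emb_eq0 => /eqP. Qed.

Lemma frac_eq p q p' q' : q != 0 -> q' != 0 ->
  (p%:F / q%:F = p'%:F / q'%:F) <-> (p * q' = p' * q).
Proof.
rewrite -(emb_eq0 K q) -(emb_eq0 K q') => q0 q'0.
split=> [/eqP|/(congr1 (emb K))].
  by rewrite eqr_div // -!rmorphM => /eqP /emb_inj.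
by rewrite !rmorphM => e; apply/eqP; rewrite eqr_div // e.
Qed.

(** By Gauss, after cross-multiplication. This is what allows evaluation at [x] through any fraction
    whose denominator does not vanish there. *)
Lemma fden_dvd p q : q != 0 -> fden (p%:F / q%:F) %| q.
Proof.
move=> q0; set f := _ / _.
have /(frac_eq _ _ q0 (fden_neq0 f)) e : p%:F / q%:F = (fnum f)%:F / (fden f)%:F.
  exact: fracE.
have : fden f %| fnum f * q by rewrite -e dvdp_mull.
by rewrite Gauss_dvdpr // coprimep_sym fcoprime.
Qed.

Lemma fpole_frac p q x : q.[x] != 0 -> fpole (p%:F / q%:F) x = false.
Proof.
move=> qx; have q0 : q != 0 by apply: contraNneq qx => ->; rewrite horner0.
apply: contraNF qx => /rootP px; have /dvdpP [u ->] := fden_dvd p q0.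
by rewrite hornerM px mulr0.
Qed.

Lemma feval_frac p q x : q.[x] != 0 -> feval (p%:F / q%:F) x = p.[x] / q.[x].
Proof.
move=> qx; have q0 : q != 0 by apply: contraNneq qx => ->; rewrite horner0.
set f := p%:F / q%:F.
have np : (fden f).[x] != 0 by have := fpole_frac p qx; rewrite /fpole rootE => ->.
have /(frac_eq _ _ q0 (fden_neq0 f)) e : p%:F / q%:F = (fnum f)%:F / (fden f)%:F.
  exact: fracE.
apply/eqP; rewrite /feval eqr_div //.
by rewrite -!hornerM e.
Qed.

Definition pev (w : K) (p : {poly F}) : K := (map_poly fconst p).[w].

HB.instance Definition _ w :=
  GRing.RMorphism.copy (pev w) (horner_eval w \o map_poly fconst).

Lemma pevC w c : pev w c%:P = fconst c.
Proof. by rewrite /pev map_polyC hornerC. Qed.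

Lemma pevX w : pev w 'X = w.
Proof. by rewrite /pev map_polyX hornerX. Qed.

Lemma pev_id p : pev 'X%:F p = p%:F.
Proof.
elim/poly_ind: p => [|p c IH]; first by rewrite !rmorph0.
by rewrite !rmorphD !rmorphM /= IH pevC pevX.
Qed.

Lemma fcompE f w : fcomp f w = pev w (fnum f) / pev w (fden f).
Proof. by []. Qed.

End FunFieldBasics.

Section Derivation.
Variables (F : fieldType) (K : funField F).
Local Notation "p %:F" := (emb K p) (format "p %:F").
Local Notation fconst := (@fconst F K).
Local Notation fderiv := (@fderiv F K).
Implicit Types (f g w : K) (p q : {poly F}) (x c : F).

(** [fderiv] is defined on the reduced fraction. Differentiating the cross-multiplied identity shows
    that the quotient rule gives the same result on any other fraction. *)
Lemma fderiv_frac p q : q != 0 ->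
  fderiv (p%:F / q%:F) = (p^`() * q - p * q^`())%:F / (q ^+ 2)%:F.
Proof.
move=> q0; set f := p%:F / q%:F.
have d0 := fden_neq0 f; have n0 : p * fden f = fnum f * q.
  by apply/(@frac_eq _ K _ _ _ _ q0 d0); rewrite -fracE.
apply/(@frac_eq _ K _ _ _ _ (expf_neq0 2 d0) (expf_neq0 2 q0)).
have e' := congr1 (@deriv F) n0; rewrite !derivM in e'.
move: (fnum f) (fden f) d0 n0 e' => n d d0 n0 e'.
have E1 : p^`() * d - n * q^`() = n^`() * q - p * d^`().
  by apply/eqP; rewrite subr_eq addrAC eq_sym subr_eq e'.
apply: (mulfI q0); apply: (mulfI d0).
transitivity (d * q ^+ 2 * (q * (n^`() * d - n * d^`()))); first by ring.
transitivity (q * d ^+ 2 * (d * (p^`() * q - p * q^`()))); last by ring.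
have -> : q * (n^`() * d - n * d^`()) = d * (n^`() * q) - n * q * d^`() by ring.
have -> : d * (p^`() * q - p * q^`()) = q * (p^`() * d) - p * d * q^`() by ring.
rewrite -n0.
have -> : n^`() * q = p^`() * d + p * d^`() - n * q^`().
  by rewrite e' addrK.
have -> : d * (p^`() * d + p * d^`() - n * q^`()) - p * d * d^`()
   = d * (p^`() * d) - d * n * q^`() by ring.
transitivity (d * (d * q * (q * (d * p^`()) - (n * q) * q^`()))); first by ring.
by rewrite -n0; ring.
Qed.

Lemma fderiv_poly p : fderiv p%:F = p^`()%:F.
Proof.
rewrite -[p%:F]divr1 -(rmorph1 (emb K)) fderiv_frac ?oner_neq0 //.
by rewrite derivC mulr1 mulr0 subr0 expr1n (rmorph1 (emb K)) divr1.
Qed.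

Lemma fderivC c : fderiv (fconst c) = 0.
Proof. by rewrite fderiv_poly derivC rmorph0. Qed.

Lemma fderivD f g : fderiv (f + g) = fderiv f + fderiv g.
Proof.
elim/fun_ind: f => p q q0 _; elim/fun_ind: g => r s s0 _.
have q0F : q%:F != 0 by rewrite emb_eq0.
have s0F : s%:F != 0 by rewrite emb_eq0.
rewrite (addf_div _ _ q0F s0F) -!rmorphM -rmorphD !fderiv_frac ?mulf_neq0 //.
rewrite !poly.derivE !(rmorphD, rmorphN, rmorphM, rmorphXn).
by field; rewrite q0F s0F.
Qed.

Lemma fderivM f g : fderiv (f * g) = fderiv f * g + f * fderiv g.
Proof.
elim/fun_ind: f => p q q0 _; elim/fun_ind: g => r s s0 _.
have q0F : q%:F != 0 by rewrite emb_eq0.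
have s0F : s%:F != 0 by rewrite emb_eq0.
rewrite mulf_div -!rmorphM !fderiv_frac ?mulf_neq0 //.
rewrite !poly.derivE !(rmorphD, rmorphN, rmorphM, rmorphXn).
by field; rewrite ?q0F ?s0F.
Qed.

Lemma fderiv_is_zmod : zmod_morphism fderiv.
Proof.
have D0 : fderiv 0 = 0 by rewrite -(rmorph0 fconst) fderivC rmorph0.
move=> f g; rewrite fderivD; congr (_ + _).
by apply/eqP; rewrite -subr_eq0 opprK -fderivD addNr D0.
Qed.
HB.instance Definition _ :=
  GRing.isZmodMorphism.Build _ _ fderiv fderiv_is_zmod.

Lemma fderivV f : f != 0 -> fderiv f^-1 = - fderiv f / f ^+ 2.
Proof.
move=> f0; have : fderiv (f * f^-1) = 0 by rewrite divff // -(rmorph1 fconst) fderivC.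
rewrite fderivM => /eqP; rewrite addrC addr_eq0 => /eqP e.
by apply: (mulfI f0); rewrite e; field.
Qed.

Lemma fderivXn f n : fderiv (f ^+ n.+1) = n.+1%:R * f ^+ n * fderiv f.
Proof.
elim: n => [|n IH]; first by rewrite expr1 expr0 mulr1 mul1r.
by rewrite exprS fderivM IH -[in RHS]natr1 !exprS; ring.
Qed.

Lemma fderiv_pev w p : fderiv (pev w p) = pev w p^`() * fderiv w.
Proof.
elim/poly_ind: p => [|p c IH]; first by rewrite !raddf0 mul0r.
rewrite derivMXaddC !rmorphD !rmorphM /= pevC pevX fderivD fderivC addr0 fderivM IH.
by ring.
Qed.

End Derivation.

Section Closed.
Variables (C : closedFieldType) (K : funField C).
Local Notation "p %:F" := (emb K p) (format "p %:F").
Local Notation fconst := (@fconst C K).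
Local Notation fderiv := (@fderiv C K).
Implicit Types (f g w z : K) (p q : {poly C}) (x c : C).

Definition nonconst w := forall c, w <> fconst c.

(** A nonconstant [w] is transcendental over [C]: a polynomial that kills [w] splits, so [w] would
    be one of its roots. *)
Lemma pev_eq0 w p : nonconst w -> (pev w p == 0) = (p == 0).
Proof.
move=> wnc; apply/idP/eqP => [|->]; last by rewrite rmorph0.
move=> pw; apply/eqP/negPn/negP => p0.
have [r pr] := closed_field_poly_normal p.
move: pw; rewrite pr -mul_polyC rmorphM /= pevC rmorph_prod mulf_eq0 fmorph_eq0.
rewrite lead_coef_eq0 (negPf p0) /= prodf_seq_eq0 => /hasP [x _ /=].
rewrite rmorphB /= pevX pevC subr_eq0 => /eqP; exact: wnc.
Qed.

Lemma fcomp_frac w p q : nonconst w -> q != 0 ->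
  fcomp (p%:F / q%:F) w = pev w p / pev w q.
Proof.
move=> wnc q0; rewrite fcompE; set f := p%:F / q%:F.
have d0 := fden_neq0 f; have n0 : p * fden f = fnum f * q.
  by apply/(@frac_eq _ K _ _ _ _ q0 d0); rewrite -fracE.
by apply/eqP; rewrite eqr_div ?pev_eq0 // -!rmorphM /= n0.
Qed.

Lemma fcomp_poly w p : nonconst w -> fcomp p%:F w = pev w p.
Proof.
by move=> wnc; rewrite -[p%:F]divr1 -(rmorph1 (emb K)) fcomp_frac ?oner_neq0 // rmorph1 divr1.
Qed.

(** Composition is a field morphism only for nonconstant [w]; the proof is made an argument so that
    the morphism structure can be attached. *)
Definition compr w (_ : nonconst w) f := fcomp f w.

Section RcompMorphism.
Variables (w : K) (wnc : nonconst w).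

Lemma compr_is_zmod : zmod_morphism (compr wnc).
Proof.
move=> f g; rewrite /compr.
elim/fun_ind: f => p q q0 _; elim/fun_ind: g => r s s0 _.
have q0F : q%:F != 0 by rewrite emb_eq0.
have s0F : s%:F != 0 by rewrite emb_eq0.
rewrite -mulNr (addf_div _ _ q0F s0F) -!rmorphN -!rmorphM -rmorphD.
rewrite !fcomp_frac ?mulf_neq0 // !rmorphD !rmorphM /=.
rewrite rmorphN /=.
by field; rewrite !(pev_eq0 _ wnc) ?q0 ?s0.
Qed.

Lemma compr_is_monoid : monoid_morphism (compr wnc).
Proof.
split; first by rewrite /compr -(rmorph1 (emb K)) fcomp_poly // !rmorph1.
move=> f g; rewrite /compr.
elim/fun_ind: f => p q q0 _; elim/fun_ind: g => r s s0 _.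
rewrite mulf_div -!rmorphM !fcomp_frac ?mulf_neq0 // !rmorphM /=.
by field; rewrite !(pev_eq0 _ wnc) ?q0 ?s0.
Qed.

HB.instance Definition _ :=
  GRing.isZmodMorphism.Build _ _ (compr wnc) compr_is_zmod.
HB.instance Definition _ :=
  GRing.isMonoidMorphism.Build _ _ (compr wnc) compr_is_monoid.

Lemma compr_frac p q : q != 0 -> compr wnc (p%:F / q%:F) = pev w p / pev w q.
Proof. exact: fcomp_frac. Qed.

Lemma compr_poly p : compr wnc p%:F = pev w p.
Proof. exact: fcomp_poly. Qed.

Lemma comprC c : compr wnc (fconst c) = fconst c.
Proof. by rewrite compr_poly pevC. Qed.

Lemma fderiv_compr f : fderiv (compr wnc f) = compr wnc (fderiv f) * fderiv w.
Proof.
elim/fun_ind: f => p q q0 _.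
rewrite compr_frac // fderiv_frac // compr_frac ?expf_neq0 //.
have q1 : pev w q != 0 by rewrite (pev_eq0 _ wnc).
rewrite fderivM fderivV // !fderiv_pev !(rmorphD, rmorphN, rmorphM, rmorphXn) /=.
by field.
Qed.

End RcompMorphism.
End Closed.

(** * Places and Puiseux coefficients *)

Section Theta.
Variables (C : numClosedFieldType) (K : funField C).
Local Notation "p %:F" := (emb K p) (format "p %:F").
Local Notation fconst := (@fconst C K).
Local Notation fderiv := (@fderiv C K).
Implicit Types (f g w z t : K) (p q : {poly C}) (c l : C).

Definition theta z w : K := z * fderiv w / fderiv z.

Lemma theta_is_zmod z : zmod_morphism (theta z).
Proof. by move=> f g; rewrite /theta raddfB /= mulrBr mulrBl. Qed.
HB.instance Definition _ z :=
  GRing.isZmodMorphism.Build _ _ (theta z) (theta_is_zmod z).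

Lemma thetaM z f g : theta z (f * g) = theta z f * g + f * theta z g.
Proof. by rewrite /theta fderivM; ring. Qed.

Lemma thetaC z c : theta z (fconst c) = 0.
Proof. by rewrite /theta fderivC mulr0 mul0r. Qed.

Lemma thetaZ z c f : theta z (fconst c * f) = fconst c * theta z f.
Proof. by rewrite thetaM thetaC mul0r add0r. Qed.

Lemma theta_id z : fderiv z != 0 -> theta z z = z.
Proof. by move=> z'; rewrite /theta mulfK. Qed.

Lemma thetaV z f : f != 0 -> theta z f^-1 = - theta z f / f ^+ 2.
Proof.
by move=> f0; rewrite /theta fderivV //; ring.
Qed.

Lemma thetaXn z f n : theta z (f ^+ n.+1) = n.+1%:R * f ^+ n * theta z f.
Proof. by rewrite /theta fderivXn; ring. Qed.

Lemma thetaXz z (j : int) : fderiv z != 0 -> z != 0 ->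
  theta z (z ^ j) = fconst j%:~R * z ^ j.
Proof.
move=> z' z0; case: j => [[|n]|n].
- by rewrite expr0z mulr1 !rmorph0 -(rmorph1 fconst) thetaC.
- by rewrite -exprnP thetaXn theta_id // -mulrA -exprSr rmorph_int.
rewrite NegzE -exprnN thetaV ?expf_neq0 // thetaXn theta_id //.
rewrite rmorph_int /= mulrNz -mulrA -exprSr.
have zn0 : z ^+ n.+1 != 0 by rewrite expf_neq0.
by rewrite -pmulrn; move: (z ^+ n.+1) zn0 => y y0; field.
Qed.

Definition opl z (s : seq C) w := foldr (fun l v => theta z v - fconst l * v) w s.

Lemma opl_cat z s1 s2 w : opl z (s1 ++ s2) w = opl z s1 (opl z s2 w).
Proof. exact: foldr_cat. Qed.

Lemma opl_is_zmod z s : zmod_morphism (opl z s).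
Proof. by move=> f g; elim: s => //= l s ->; rewrite raddfB /=; ring. Qed.
HB.instance Definition _ z s :=
  GRing.isZmodMorphism.Build _ _ (opl z s) (opl_is_zmod z s).

Lemma oplZ z s c w : opl z s (fconst c * w) = fconst c * opl z s w.
Proof. by elim: s => //= l s ->; rewrite thetaZ; ring. Qed.

Lemma opl_theta z s w : opl z s (theta z w) = theta z (opl z s w).
Proof.
by elim: s => //= l s ->; rewrite raddfB /= thetaZ.
Qed.

Lemma opl_comm z s1 s2 w : opl z s1 (opl z s2 w) = opl z s2 (opl z s1 w).
Proof.
by elim: s1 => //= l s1 ->; rewrite raddfB /= opl_theta oplZ.
Qed.

(** The factors commute, so those that raise a filtration can be brought into the order in which
    they must act. *)
Lemma opl_perm z w s1 s2 : perm_eq s1 s2 -> opl z s1 w = opl z s2 w.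
Proof.
by apply/(catCA_perm_subst (F := opl z ^~ w)): s1 s2 => s1 s2 s3; rewrite !opl_cat opl_comm.
Qed.

End Theta.

(* A discrete valuation of the function field, given by its valuation ring
   and a uniformizer. *)
Record place (C : numClosedFieldType) (K : funField C) := Place {
  vring : K -> Prop;
  unif : K;
  vringC : forall c, vring (fconst K c);
  vringD : forall f g, vring f -> vring g -> vring (f + g);
  vringM : forall f g, vring f -> vring g -> vring (f * g);
  unif_vring : vring unif;
  unif_nunit : ~ vring unif^-1;
  unif_factor : forall f, f != 0 ->
    exists (j : int) u, [/\ vring u, vring u^-1 & f = unif ^ j * u];
  unif_deriv : fderiv unif != 0;
  vring_theta : forall f, vring f -> vring (theta unif f / unif)
}.

Section PlaceTheory.
Variables (C : numClosedFieldType) (K : funField C) (v : place K).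
Local Notation fconst := (@fconst C K).
Local Notation fderiv := (@fderiv C K).
Local Notation pi := (unif v).
Local Notation O := (vring v).
Implicit Types (f g w z u : K) (i j e : int) (c l : C).

Lemma unif_neq0 : pi != 0.
Proof. by apply: contraNneq (unif_deriv v) => ->; rewrite raddf0. Qed.
Hint Resolve unif_neq0 : core.

Lemma vring0 : O 0.
Proof. by rewrite -(rmorph0 fconst); exact: vringC. Qed.

Lemma vring1 : O 1.
Proof. by rewrite -(rmorph1 fconst); exact: vringC. Qed.

Lemma vringN f : O f -> O (- f).
Proof.
by move=> Of; rewrite -mulN1r -(rmorph1 fconst) -rmorphN; apply: vringM => //; apply: vringC.
Qed.

Lemma vringX n f : O f -> O (f ^+ n).
Proof.
move=> Of; elim: n => [|n IH]; first by rewrite expr0; exact: vring1.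
by rewrite exprS; exact: vringM.
Qed.

(** The valuation of [w] is at least [j]. *)
Definition fil j w := O (w / pi ^ j).

Lemma filE j w : fil j w <-> exists2 u, O u & w = pi ^ j * u.
Proof.
have pj : pi ^ j != 0 by rewrite expfz_neq0.
split=> [Ow|[u Ou ->]]; last by rewrite /fil mulrAC divff ?mul1r.
by exists (w / pi ^ j); rewrite // mulrC divfK.
Qed.

Lemma fil0 j : fil j 0.
Proof. by rewrite /fil mul0r; exact: vring0. Qed.

Lemma fil_vring w : fil 0 w <-> O w.
Proof. by rewrite /fil expr0z divr1. Qed.

Lemma filD j f g : fil j f -> fil j g -> fil j (f + g).
Proof. by rewrite /fil mulrDl; exact: vringD. Qed.

Lemma filN j f : fil j f -> fil j (- f).
Proof. by rewrite /fil mulNr; exact: vringN. Qed.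

Lemma filB j f g : fil j f -> fil j g -> fil j (f - g).
Proof. by move=> ff fg; apply: filD => //; exact: filN. Qed.

Lemma filM i j f g : fil i f -> fil j g -> fil (i + j) (f * g).
Proof.
move=> ff fg; rewrite /fil expfzDr // invfM mulrACA; exact: vringM.
Qed.

Lemma fil_unif j : fil j (pi ^ j).
Proof. by rewrite /fil divff ?expfz_neq0 //; exact: vring1. Qed.

Lemma fil_le i j f : i <= j -> fil j f -> fil i f.
Proof.
move=> ij /filE [u Ou ->]; apply/filE.
have [n ->] : exists n : nat, j = i + n by exists (absz (j - i)); lia.
exists (pi ^+ n * u); last by rewrite mulrA expfzDr.
by apply: vringM => //; apply: vringX; exact: unif_vring.
Qed.

Lemma filC j c f : fil j f -> fil j (fconst c * f).
Proof. by move=> ff; rewrite /fil -mulrA; apply: vringM => //; exact: vringC. Qed.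

Lemma fil_sum j (I : Type) (r : seq I) (P : pred I) (f : I -> K) :
  (forall k, P k -> fil j (f k)) -> fil j (\sum_(k <- r | P k) f k).
Proof.
move=> h; elim/big_ind: _ => //; [exact: fil0|exact: filD].
Qed.

Lemma fil_exists f : exists j, fil j f.
Proof.
have [->|f0] := eqVneq f 0; first by exists 0; exact: fil0.
by have [j [u [Ou _ ->]]] := unif_factor v f0; exists j; apply/filE; exists u.
Qed.

Lemma vunit_not_fil1 u : O u^-1 -> u != 0 -> ~ fil 1 u.
Proof.
move=> Ou' u0 /filE [t Ot e]; apply: (@unif_nunit _ _ v).
have t0 : t != 0 by apply: contraNneq u0 => t0; rewrite e t0 mulr0.
suff -> : pi^-1 = t * u^-1 by exact: vringM.
by rewrite e expr1z; field; rewrite t0 unif_neq0.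
Qed.

Lemma fil_separated f : (forall n : nat, fil n f) -> f = 0.
Proof.
move=> h; apply/eqP/negPn/negP => f0.
have [j [u [Ou Ou' e]]] := unif_factor v f0.
have u0 : u != 0 by apply: contraNneq f0 => u0; rewrite e u0 mulr0.
apply: (vunit_not_fil1 Ou' u0).
have [n hn] : exists n : nat, j + 1 <= n%:Z by exists (absz (j + 1)); lia.
have := fil_le hn (h n).
rewrite e /fil expfzDr // -mulf_div divff ?mul1r ?expfz_neq0 //.
Qed.

Lemma vring_inv f : O f -> ~ fil 1 f -> O f^-1.
Proof.
move=> Of nf; have f0 : f != 0 by apply: contra_notN nf => /eqP ->; exact: fil0.
have [j [u [Ou Ou' e]]] := unif_factor v f0.
have u0 : u != 0 by apply: contraNneq f0 => u0; rewrite e u0 mulr0.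
have [j1|j0] : 1 <= j \/ j <= 0 by lia.
  by case: nf; apply: (fil_le j1); apply/filE; exists u.
have -> : f^-1 = pi ^ (- j) * u^-1 by rewrite e invfM -invr_expz.
apply: vringM => //; apply/fil_vring; apply: (@fil_le _ (- j)); first by lia.
exact: fil_unif.
Qed.

(** [pi^j] is an eigenvector of [theta pi] with eigenvalue [j], and [theta pi] sends the valuation
    ring into the multiples of [pi]. *)
Lemma fil_theta_unif j w : fil j w -> fil (j + 1) (theta pi w - fconst j%:~R * w).
Proof.
move=> /filE [u Ou ->].
rewrite thetaM thetaXz ?unif_deriv //.
have -> : fconst j%:~R * pi ^ j * u + pi ^ j * theta pi u - fconst j%:~R * (pi ^ j * u)
  = pi ^ j * theta pi u by ring.
apply: filM; first exact: fil_unif.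
by rewrite /fil expr1z; exact: vring_theta.
Qed.

(** The two bounds together say that [z] has valuation exactly [e], the ramification index at this
    zero of [z]. *)
Definition ramified (e : nat) z :=
  [/\ (0 < e)%N, z != 0, fil e z & fil (- e%:Z) z^-1].

Section Ramified.
Variables (e : nat) (z : K) (ze : ramified e z).

Lemma ramified_neq0 : z != 0. Proof. by case: ze. Qed.
Hint Resolve ramified_neq0 : core.

(** The logarithmic derivative of [z] relative to that of [pi]. It is congruent to [e], hence a
    unit, and it converts [theta pi] into [theta z]. *)
Let kap := theta pi z / z.

Lemma ramified_theta : fil 1 (kap - fconst e%:R).
Proof.
have [_ z0 fz fz'] := ze.
have := filM (fil_theta_unif fz) fz'.
rewrite mulrBl (mulfK z0) -pmulrn => h.
by rewrite addrAC subrr add0r in h.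
Qed.

Lemma natC_neq0 : fconst e%:R != 0.
Proof. by rewrite fmorph_eq0 pnatr_eq0 -lt0n; case: ze. Qed.

Lemma kap_vring : O kap.
Proof.
have -> : kap = (kap - fconst e%:R) + fconst e%:R by ring.
apply: vringD; last exact: vringC.
by apply/fil_vring; apply: (fil_le _ ramified_theta).
Qed.

Lemma kap_not_fil1 : ~ fil 1 kap.
Proof.
move=> h; have := filB h ramified_theta.
rewrite opprB addrC subrK => he.
apply: (@vunit_not_fil1 (fconst e%:R)) he; last exact: natC_neq0.
by rewrite -fmorphV; exact: vringC.
Qed.

Lemma kap_neq0 : kap != 0.
Proof. by apply: contra_notN kap_not_fil1 => /eqP ->; exact: fil0. Qed.

Lemma ramified_deriv : fderiv z != 0.
Proof.
by apply: contraNneq kap_neq0 => z'; rewrite /kap /theta z' mulr0 !mul0r.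
Qed.

Lemma theta_unifE w : theta z w = kap^-1 * theta pi w.
Proof.
rewrite /kap /theta; field.
by rewrite ramified_deriv unif_deriv ramified_neq0 unif_neq0.
Qed.

(** In an expansion in powers of [z^(1/e)], a term of valuation [j] has exponent [j/e], and
    [theta z] multiplies it by this exponent. *)
Lemma fil_theta j w : fil j w -> fil (j + 1) (theta z w - fconst (j%:~R / e%:R) * w).
Proof.
move=> fw; have k0 := kap_neq0.
have ki : O kap^-1 := vring_inv kap_vring kap_not_fil1.
have e0 := natC_neq0.
have -> : theta z w - fconst (j%:~R / e%:R) * w
   = kap^-1 * (theta pi w - fconst j%:~R * w)
     - (kap^-1 * (kap - fconst e%:R)) * (fconst (j%:~R / e%:R) * w).
  rewrite theta_unifE fmorph_div /=; field.
  by rewrite -(rmorph_nat fconst) e0 k0.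
apply: filB.
  by rewrite -[_ + 1]add0r; apply: filM; [exact/fil_vring|exact: fil_theta_unif].
rewrite addrC; apply: filM; last exact: filC.
by rewrite -[1]add0r; apply: filM; [exact/fil_vring|exact: ramified_theta].
Qed.

Lemma fil_theta0 j w : fil j w -> fil j (theta z w).
Proof.
move=> fw; rewrite -[theta z w](subrK (fconst (j%:~R / e%:R) * w)).
apply: filD; last exact: filC.
by apply: fil_le (fil_theta fw); lia.
Qed.

Lemma fil_opl j s w : fil j w -> fil j (opl z s w).
Proof.
move=> fw; elim: s => //= l s IH; apply: filB; [exact: fil_theta0|exact: filC].
Qed.

(* Each factor [theta - i/e] kills the Puiseux coefficient of exponent [i/e]. *)
Lemma fil_opl_lift j (n : nat) s w :
  (forall i : nat, (i < n)%N -> (j + i)%:~R / e%:R \in s) -> uniq s ->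
  fil j w -> fil (j + n) (opl z s w).
Proof.
move=> hs us fw; have [e0 _ _ _] := ze.
(* The list is decreasing because [foldr] applies its last factor first: exponents have to be killed
   from the lowest upwards. *)
pose t := [seq (j + k%:Z)%:~R / e%:R : C | k <- rev (iota 0 n)].
have ut : uniq t.
  have ei : (e%:R : C)^-1 != 0 by rewrite invr_eq0 pnatr_eq0 -lt0n.
  rewrite map_inj_uniq ?rev_uniq ?iota_uniq // => i1 i2 /(mulIf ei) /intr_inj.
  by move=> /addrI [].
have st : {subset t <= s}.
  by move=> _ /mapP [k + ->]; rewrite mem_rev mem_iota add0n => /= /hs.
have /opl_perm -> : perm_eq s (t ++ [seq x <- s | x \notin t]).
  apply: uniq_perm => //.
    rewrite cat_uniq ut filter_uniq // andbT /=.
    by apply/hasPn => x; rewrite mem_filter => /andP [].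
  move=> x; rewrite mem_cat mem_filter; case: (boolP (x \in t)) => //= xt.
  exact: st.
(* The remaining factors act first and merely preserve the filtration. *)
rewrite opl_cat; move: (opl z _ w) (fil_opl [seq x <- s | x \notin t] fw) => u fu.
rewrite /t; elim: n {hs t ut st} => [|n IH]; first by rewrite addr0.
rewrite -addn1 iotaD rev_cat /= add0n.
have -> : j + (n + 1)%N = j + n + 1 by lia.
exact: fil_theta.
Qed.

End Ramified.
End PlaceTheory.

(** * Regularity and values at a finite point *)

Section RegularFunctions.
Variables (C : fieldType) (K : funField C).
Local Notation "p %:F" := (emb K p) (format "p %:F").
Local Notation fconst := (@fconst C K).
Implicit Types (f g w z : K) (p q : {poly C}) (c a : C).

Definition reg a w := ~~ fpole w a.

Lemma regP a w : reg a w <-> exists p q, q.[a] != 0 /\ w = p%:F / q%:F.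
Proof.
split=> [h|[p [q [qa ->]]]]; last by rewrite /reg fpole_frac.
by exists (fnum w), (fden w); split; [rewrite -rootE|exact: fracE].
Qed.

Lemma horner_neq0 q a : q.[a] != 0 -> q != 0.
Proof. by apply: contraNneq => ->; rewrite horner0. Qed.

Lemma reg_ind a (T : K -> Prop) :
  (forall p q, q.[a] != 0 -> T (p%:F / q%:F)) -> forall w, reg a w -> T w.
Proof. by move=> h w /regP [p [q [qa ->]]]; exact: h. Qed.

Lemma reg_frac a p q : q.[a] != 0 -> reg a (p%:F / q%:F).
Proof. by move=> qa; apply/regP; exists p, q. Qed.

Lemma poly_frac p : p%:F = p%:F / 1%:F.
Proof. by rewrite rmorph1 divr1. Qed.

Lemma reg_poly a p : reg a p%:F.
Proof. by rewrite poly_frac; apply: reg_frac; rewrite hornerC oner_neq0. Qed.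

Lemma reg_const a c : reg a (fconst c).
Proof. exact: reg_poly. Qed.

Lemma feval_poly a p : feval p%:F a = p.[a].
Proof. by rewrite poly_frac feval_frac hornerC ?oner_neq0 // divr1. Qed.

Lemma fevalC a c : feval (fconst c) a = c.
Proof. by rewrite feval_poly hornerC. Qed.

Lemma addf_frac p q r s : q != 0 -> s != 0 ->
  p%:F / q%:F + r%:F / s%:F = (p * s + r * q)%:F / (q * s)%:F.
Proof.
move=> q0 s0; rewrite !(rmorphD, rmorphM) /=; field.
by rewrite !emb_eq0 q0 s0.
Qed.

Lemma mulf_frac p q r s :
  (p%:F / q%:F) * (r%:F / s%:F) = (p * r)%:F / (q * s)%:F.
Proof. by rewrite !rmorphM mulf_div. Qed.

Lemma regD a f g : reg a f -> reg a g ->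
  reg a (f + g) /\ feval (f + g) a = feval f a + feval g a.
Proof.
elim/reg_ind=> p q qa; elim/reg_ind=> r s sa.
rewrite addf_frac ?(horner_neq0 qa) ?(horner_neq0 sa) //.
have qsa : (q * s).[a] != 0 by rewrite hornerM mulf_neq0.
split; first exact: reg_frac.
by rewrite !feval_frac // !(hornerD, hornerM); field; rewrite qa sa.
Qed.

Lemma regM a f g : reg a f -> reg a g ->
  reg a (f * g) /\ feval (f * g) a = feval f a * feval g a.
Proof.
elim/reg_ind=> p q qa; elim/reg_ind=> r s sa.
have qsa : (q * s).[a] != 0 by rewrite hornerM mulf_neq0.
rewrite mulf_frac; split; first exact: reg_frac.
by rewrite !feval_frac // !hornerM mulf_div.
Qed.

Lemma regZ a c f : reg a f ->
  reg a (fconst c * f) /\ feval (fconst c * f) a = c * feval f a.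
Proof. by move=> rf; have := regM (reg_const a c) rf; rewrite fevalC. Qed.

Lemma regN a f : reg a f -> reg a (- f) /\ feval (- f) a = - feval f a.
Proof.
by move=> rf; have := regZ (-1) rf; rewrite rmorphN rmorph1 !mulN1r.
Qed.

Lemma regB a f g : reg a f -> reg a g ->
  reg a (f - g) /\ feval (f - g) a = feval f a - feval g a.
Proof. by move=> rf /regN [rg e]; have [r1 e1] := regD rf rg; rewrite e1 e. Qed.

Lemma regX a f n : reg a f -> reg a (f ^+ n) /\ feval (f ^+ n) a = feval f a ^+ n.
Proof.
move=> rf; elim: n => [|n [IH1 IH2]].
  by rewrite !expr0 -(rmorph1 fconst); split; [exact: reg_const|rewrite fevalC].
by rewrite !exprS -IH2; exact: regM.
Qed.

Lemma regV a f : reg a f -> feval f a != 0 ->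
  reg a f^-1 /\ feval f^-1 a = (feval f a)^-1.
Proof.
elim/reg_ind=> p q qa; rewrite feval_frac // mulf_eq0 invr_eq0 negb_or qa andbT => pa.
by rewrite invf_div; split; [exact: reg_frac|rewrite feval_frac // invf_div].
Qed.

Lemma reg_pev a w p : reg a w -> reg a (pev w p) /\ feval (pev w p) a = p.[feval w a].
Proof.
move=> rw; elim/poly_ind: p => [|p c [r e]].
  by rewrite rmorph0 horner0 -(rmorph0 fconst); split; [exact: reg_const|rewrite fevalC].
rewrite rmorphD rmorphM /= pevC pevX hornerMXaddC.
have [r1 e1] := regM r rw; have [r2 e2] := regD r1 (reg_const a c).
by rewrite e2 e1 e fevalC.
Qed.

Lemma reg_deriv a f : reg a f -> reg a (fderiv f).
Proof.
elim/reg_ind=> p q qa; rewrite fderiv_frac ?(horner_neq0 qa) //; apply: reg_frac.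
by rewrite horner_exp expf_neq0.
Qed.

End RegularFunctions.

(** * The places of the projective line *)

Section Places.
Variables (C : numClosedFieldType) (K : funField C).
Local Notation "p %:F" := (emb K p) (format "p %:F").
Local Notation fconst := (@fconst C K).
Implicit Types (f g w z : K) (p q : {poly C}) (c a : C).

Lemma neq0_frac f : f != 0 -> exists p q, [/\ p != 0, q != 0 & f = p%:F / q%:F].
Proof.
move=> f0; exists (fnum f), (fden f); split; [|exact: fden_neq0|exact: fracE].
by apply: contraNneq f0 => n0; rewrite (fracE f) n0 rmorph0 mul0r.
Qed.

Section FinitePlace.
Variable a : C.
Let pi := ('X - a%:P)%:F.

Lemma fin_unif_neq0 : pi != 0.
Proof. by rewrite emb_eq0 polyXsubC_eq0. Qed.

Lemma fin_unif_nunit : ~ reg a pi^-1.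
Proof.
move=> rp; have [_] := regM (reg_poly K a ('X - a%:P)) rp.
rewrite divff ?fin_unif_neq0 // feval_poly hornerXsubC subrr mul0r.
by rewrite -(rmorph1 fconst) fevalC => /eqP; rewrite oner_eq0.
Qed.

Lemma fin_poly_factor p : p != 0 ->
  exists n q, q.[a] != 0 /\ p = ('X - a%:P) ^+ n * q.
Proof.
move=> p0; have [n [q]] := multiplicity_XsubC p a.
by rewrite p0 /= => qa ->; exists n, q; rewrite mulrC -rootE.
Qed.

Lemma fin_factor f : f != 0 ->
  exists (j : int) u, [/\ reg a u, reg a u^-1 & f = pi ^ j * u].
Proof.
move=> /neq0_frac [p [q [p0 q0 ->]]].
have [n [p1 [p1a ->]]] := fin_poly_factor p0.
have [m [q1 [q1a ->]]] := fin_poly_factor q0.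
exists (n%:Z - m%:Z), (p1%:F / q1%:F); split.
- exact: reg_frac.
- by rewrite invf_div; exact: reg_frac.
rewrite expfzDr ?fin_unif_neq0 // -invr_expz !rmorphM !rmorphXn /=.
by rewrite mulf_div.
Qed.

Lemma fin_unif_deriv : fderiv pi != 0.
Proof. by rewrite fderiv_poly derivXsubC rmorph1 oner_neq0. Qed.

Lemma fin_theta f : reg a f -> reg a (theta pi f / pi).
Proof.
move=> rf; rewrite /theta fderiv_poly derivXsubC rmorph1 divr1 mulrAC divff.
  by rewrite mul1r; exact: reg_deriv.
exact: fin_unif_neq0.
Qed.

Definition fplace : place K :=
  @Place C K (fun w => reg a w) pi (reg_const K a) (fun f g rf rg => proj1 (regD rf rg))
    (fun f g rf rg => proj1 (regM rf rg)) (reg_poly K a _) fin_unif_nunit fin_factor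
    fin_unif_deriv fin_theta.

End FinitePlace.

Section InfinitePlace.
Let pi := ('X : {poly C})%:F^-1.

Definition ireg f := exists p q, [/\ q != 0, (size p <= size q)%N & f = p%:F / q%:F].

Lemma iregC c : ireg (fconst c).
Proof.
exists c%:P, 1; split; rewrite ?oner_neq0 // ?rmorph1 ?divr1 //.
by rewrite size_poly1 size_polyC leq_b1.
Qed.

Lemma iregD f g : ireg f -> ireg g -> ireg (f + g).
Proof.
move=> [p [q [q0 pq ->]]] [r [s [s0 rs ->]]].
rewrite addf_frac //; exists (p * s + r * q), (q * s); split; rewrite ?mulf_neq0 //.
apply: leq_trans (size_polyD _ _) _; rewrite [X in (_ <= X)%N]size_mul // geq_max.
apply/andP; split; apply: leq_trans (size_polyMleq _ _) _; rewrite -!subn1 leq_sub2r //.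
  by rewrite leq_add2r.
by rewrite addnC leq_add2l.
Qed.

Lemma iregM f g : ireg f -> ireg g -> ireg (f * g).
Proof.
move=> [p [q [q0 pq ->]]] [r [s [s0 rs ->]]].
rewrite mulf_frac; exists (p * r), (q * s); split; rewrite ?mulf_neq0 //.
apply: leq_trans (size_polyMleq _ _) _; rewrite [X in (_ <= X)%N]size_mul //.
by rewrite -!subn1 leq_sub2r // leq_add.
Qed.

(** The difference of the degrees does not depend on the fraction, so the comparison in [ireg] can
    be read off any of them. *)
Lemma ireg_size p q : q != 0 -> ireg (p%:F / q%:F) -> (size p <= size q)%N.
Proof.
move=> q0 [r [s [s0 rs /(frac_eq _ _ _ q0 s0)]]].
have [->|p0] := eqVneq p 0; first by rewrite size_poly0.
move=> e; have r0 : r != 0.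
  apply: contra_eq_neq e => ->; rewrite mul0r; exact: mulf_neq0.
have key (i j k l : nat) : (i + l).-1 = (k + j).-1 -> (0 < j)%N -> (0 < l)%N ->
  (k <= l)%N -> (i <= j)%N by lia.
have /(congr1 (fun p : {poly C} => size p)) := e; rewrite !size_mul // => /key; apply=> //.
  by rewrite size_poly_gt0.
by rewrite size_poly_gt0.
Qed.

Lemma inf_X_neq0 : ('X : {poly C})%:F != 0 :> K.
Proof. by rewrite emb_eq0 polyX_eq0. Qed.

Lemma inf_unif : ireg pi.
Proof.
exists 1, 'X; split; rewrite ?polyX_eq0 ?rmorph1 ?mul1r //.
by rewrite size_poly1 size_polyX.
Qed.

Lemma inf_unif_nunit : ~ ireg pi^-1.
Proof.
rewrite invrK poly_frac => /ireg_size; rewrite oner_neq0 => /(_ isT).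
by rewrite size_poly1 size_polyX.
Qed.

Lemma inf_factor f : f != 0 ->
  exists (j : int) u, [/\ ireg u, ireg u^-1 & f = pi ^ j * u].
Proof.
move=> /neq0_frac [p [q [p0 q0 ->]]].
have Xn0 n : ('X^n : {poly C}) != 0 by rewrite -size_poly_gt0 size_polyXn.
pose n := size p; pose m := size q.
(* The valuation at infinity is the difference of the degrees; the powers of [X] even out the two
   sizes, which leaves a unit. *)
exists (m%:Z - n%:Z), (('X^m * p)%:F / ('X^n * q)%:F).
have h : size ('X^m * p) = size ('X^n * q).
  by rewrite !size_mul // !size_polyXn -/n -/m addSn addSn addnC.
split.
- by exists ('X^m * p), ('X^n * q); rewrite mulf_neq0 // h.
- by rewrite invf_div; exists ('X^n * q), ('X^m * p); rewrite mulf_neq0 // h.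
rewrite expfzDr ?invr_eq0 ?inf_X_neq0 // -invr_expz !rmorphM !rmorphXn /=.
rewrite /pi -!exprnP !exprVn invrK.
by field; rewrite !(expf_neq0 _ inf_X_neq0) emb_eq0 q0.
Qed.

Lemma inf_fderiv : fderiv pi = - pi ^+ 2.
Proof. by rewrite fderivV ?inf_X_neq0 // fderiv_poly derivX rmorph1 mulN1r exprVn. Qed.

Lemma inf_unif_deriv : fderiv pi != 0.
Proof. by rewrite inf_fderiv oppr_eq0 expf_neq0 // invr_eq0 inf_X_neq0. Qed.

(* With [n = deg q], the leading terms of [n p q - n p q] cancel in the
   numerator of [x (p / q)']. *)
Lemma inf_theta f : ireg f -> ireg (theta pi f / pi).
Proof.
move=> [p [q [q0 pq ->]]]; pose n := (size q).-1.
pose E (r : {poly C}) : {poly C} := 'X * r^`() - n%:R *: r.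
have sE (r : {poly C}) : (size r <= size q)%N -> (size (E r) <= n)%N.
  move=> rq; apply/leq_sizeP => i ni; rewrite /E coefB coefZ coefXM coef_deriv.
  case: i ni => [|i] /= ni; last first.
    have [ei|] := eqVneq n i.+1; first by rewrite ei mulr_natl subrr.
    move=> nei; have -> : r`_i.+1 = 0.
      apply: nth_default; apply: leq_trans rq _; rewrite -(prednK (n := size q)) //.
        by rewrite -/n; lia.
      by rewrite size_poly_gt0.
    by rewrite mul0rn mulr0 subrr.
  have -> : n = 0%N by lia.
  by rewrite mul0r subrr.
have Xn0 := inf_X_neq0.
exists ('X * (p * E q - E p * q)), (q ^+ 2); split; first by rewrite expf_neq0.
  have nq : size q = n.+1 by rewrite /n prednK // size_poly_gt0.
  have b (r s : {poly C}) : (size r <= n.+1)%N -> (size s <= n)%N -> (size (r * s)%R <= n + n)%N.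
    have key (i j : nat) : (i <= n.+1)%N -> (j <= n)%N -> ((i + j).-1 <= n + n)%N by lia.
    by move=> hr hs; apply: leq_trans (size_polyMleq _ _) _; exact: key.
  have -> : size (q ^+ 2) = (n + n).+1 by rewrite expr2 size_mul //
    -?[RHS]/((n.+1 + n.+1).-1) ?nq ?addnS.
  apply: leq_trans (size_polyMleq _ _) _; rewrite size_polyX /= ltnS.
  apply: leq_trans (size_polyD _ _) _; rewrite size_polyN geq_max.
  apply/andP; split; [|rewrite mulrC]; apply: b.
  - exact: (leq_trans pq (eq_leq nq)).
  - exact: sE (leqnn _).
  - exact: (eq_leq nq).
  - exact: sE pq.
rewrite /theta inf_fderiv fderiv_frac // /E -!mul_polyC.
rewrite !(rmorphD, rmorphN, rmorphM, rmorphXn) /= /pi; field.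
by rewrite emb_eq0 q0 Xn0 oppr_eq0 oner_neq0.
Qed.

Definition iplace : place K :=
  @Place C K ireg pi iregC iregD iregM inf_unif inf_unif_nunit inf_factor inf_unif_deriv inf_theta.

End InfinitePlace.
End Places.

(** * Laurent polynomials and denominators prime to [X] *)

Section LaurentPolynomials.
Variables (C : numClosedFieldType) (K : funField C).
Local Notation "p %:F" := (emb K p) (format "p %:F").
Local Notation fconst := (@fconst C K).
Local Notation X := ('X%:F : K).
Local Notation filX := (fil (fplace K 0)).
Implicit Types (f g w z e : K) (p q : {poly C}) (c a : C).

Lemma X_neq0 : X != 0.
Proof. by rewrite emb_eq0 polyX_eq0. Qed.

Lemma fplace_unif a : unif (fplace K a) = ('X - a%:P)%:F.
Proof. by []. Qed.

Lemma unif0 : unif (fplace K 0) = X.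
Proof. by rewrite fplace_unif subr0. Qed.

Lemma fil_fplaceP a (j : int) w :
  fil (fplace K a) j w <->
  exists p q, q.[a] != 0 /\ w = ('X - a%:P)%:F ^ j * (p%:F / q%:F).
Proof.
split=> [/filE [u /regP [p [q [qa ->]]] ->]|[p [q [qa ->]]]].
  by exists p, q; rewrite fplace_unif.
by apply/filE; exists (p%:F / q%:F) => //; exact: reg_frac.
Qed.

Lemma fil_poly a (n : nat) p : fil (fplace K a) n p%:F <-> ('X - a%:P) ^+ n %| p.
Proof.
split=> [/fil_fplaceP [r [q [qa]]]|/dvdpP [u ->]]; last first.
  rewrite mulrC rmorphM rmorphXn; apply/(filE (fplace K a) n); exists u%:F => //; exact: reg_poly.
have q0 := horner_neq0 qa; rewrite -exprnP -rmorphXn mulrA -rmorphM => /esym/eqP.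
rewrite -[p%:F]divr1 -(rmorph1 (emb K)) => /eqP /(frac_eq _ _ _ q0 (oner_neq0 _)).
rewrite mulr1 => e.
have c : coprimep (('X - a%:P) ^+ n) q.
  by rewrite coprimep_expl // coprimep_sym coprimep_XsubC rootE.
by rewrite -(Gauss_dvdpl _ c) -e dvdp_mulr.
Qed.

Definition lau e := exists n p, e = p%:F / X ^+ n.

Lemma lau_poly p : lau p%:F.
Proof. by exists 0%N, p; rewrite expr0 divr1. Qed.

Lemma lauD e f : lau e -> lau f -> lau (e + f).
Proof.
move=> [n [p ->]] [m [q ->]]; exists (n + m)%N, (p * 'X^m + q * 'X^n).
rewrite exprD rmorphD !rmorphM !rmorphXn /=; field.
by rewrite !(expf_neq0 _ X_neq0).
Qed.

Lemma lauM e f : lau e -> lau f -> lau (e * f).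
Proof.
by move=> [n [p ->]] [m [q ->]]; exists (n + m)%N, (p * q); rewrite exprD rmorphM mulf_div.
Qed.

Lemma fderivX : fderiv X = 1.
Proof. by rewrite fderiv_poly derivX rmorph1. Qed.

Lemma thetaX w : theta X w = X * fderiv w.
Proof. by rewrite /theta fderivX divr1. Qed.

Lemma theta_poly p : theta X p%:F = ('X * p^`())%:F.
Proof. by rewrite thetaX fderiv_poly rmorphM. Qed.

(** [x d/dx] multiplies each monomial by its exponent, so it creates no new denominator. *)
Lemma lau_theta e : lau e -> lau (theta X e).
Proof.
move=> [n [p ->]]; rewrite thetaM; apply: lauD; apply: lauM.
- by rewrite theta_poly; exact: lau_poly.
- by exists n, 1; rewrite rmorph1 mul1r.
- exact: lau_poly.
case: n => [|n].
  rewrite expr0 invr1 -(rmorph1 fconst) thetaC -(rmorph0 (emb K)); exact: lau_poly.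
exists n.+1, (- n.+1%:R); rewrite thetaV ?expf_neq0 ?X_neq0 // thetaXn theta_id; last first.
  by rewrite fderivX oner_neq0.
have x0 := X_neq0; rewrite rmorphN rmorph_nat !exprS.
have xn0 : X ^+ n != 0 := expf_neq0 n x0.
by move: (X ^+ n) xn0 => y y0; field; rewrite x0 y0.
Qed.

(** A Laurent polynomial has no finite pole besides 0. This turns a local bound at [z = 0] into the
    polynomial [h] on which the moments can be used. *)
Lemma lau_fil (n : nat) e : lau e -> filX n e -> exists p, e = ('X^n * p)%:F.
Proof.
move=> [m [p e1]] fe; have x0 := X_neq0.
have xm0 : X ^+ m != 0 by rewrite expf_neq0.
have : filX (n + m)%N p%:F.
  have -> : p%:F = e * unif (fplace K 0) ^ (m : int) by rewrite e1 unif0 divfK.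
  by rewrite PoszD; apply: filM => //; exact: fil_unif.
move=> /fil_poly; rewrite subr0 => /dvdpP [q pq]; exists q; rewrite e1 pq exprD.
rewrite !rmorphM !rmorphXn /=; field; exact: xm0.
Qed.

Lemma lau_den e : exists E, E.[0] != 0 /\ lau (E%:F * e).
Proof.
have [n [q [q0 qe]]] := fin_poly_factor 0 (fden_neq0 e).
exists q; split=> //; exists n, (fnum e).
rewrite {1}(fracE e) qe subr0 !rmorphM rmorphXn /=; field.
by rewrite (expf_neq0 _ X_neq0) emb_eq0 (horner_neq0 q0).
Qed.

Lemma lau_dens N (e : nat -> K) :
  exists E, E.[0] != 0 /\ forall k, (k < N)%N -> lau (E%:F * e k).
Proof.
elim: N => [|N [E [E0 IH]]]; first by exists 1; rewrite hornerC oner_neq0.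
have [D [D0 lD]] := lau_den (e N).
exists (E * D); rewrite hornerM mulf_neq0 //; split=> // k; rewrite ltnS leq_eqVlt.
case/orP => [/eqP ->|/IH h]; first by rewrite rmorphM -mulrA; apply: lauM => //; exact: lau_poly.
by rewrite rmorphM mulrAC; apply: lauM => //; exact: lau_poly.
Qed.

(** By Bezout. Multiplication by such a [p] clears the denominator [E] and changes nothing modulo
    [X^M]. *)
Lemma poly_one E M : E.[0] != 0 -> exists p, E %| p /\ 'X^M %| p - 1.
Proof.
move=> E0; have : coprimep E 'X^M.
  by rewrite coprimep_sym coprimep_expl // -['X]subr0 coprimep_sym coprimep_XsubC rootE.
move=> /Bezout_eq1_coprimepP [[u v] /= e].
exists (u * E); rewrite dvdp_mull //; split=> //.
by rewrite -e opprD addrA subrr sub0r dvdpNr dvdp_mull.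
Qed.

Lemma filX_bound m (u : 'rV[K]_m) : exists s : nat, forall i, filX (- s%:Z) (u 0 i).
Proof.
suff : exists s : nat, forall i, (i \in enum 'I_m) -> filX (- s%:Z) (u 0 i).
  by move=> [s h]; exists s => i; apply: h; rewrite mem_enum.
elim: (enum _) => [|i r [s IH]]; first by exists 0%N.
have [j hj] := fil_exists (fplace K 0) (u 0 i).
exists (s + absz j)%N => k; rewrite inE => /orP [/eqP ->|/IH hk].
  by apply: (fil_le _ hj); lia.
by apply: (fil_le _ hk); lia.
Qed.

End LaurentPolynomials.

Lemma poly_nonroot (C : numDomainType) (p : {poly C}) : p != 0 -> exists c, p.[c] != 0.
Proof.
move=> p0; apply/not_existsP => h.
pose s := [seq (i%:R : C) | i <- iota 0 (size p)].
have : (size s < size p)%N.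
  apply: max_poly_roots => //.
    by apply/allP => x _; rewrite rootE; apply/negPn/negP; exact: h.
  by rewrite map_inj_uniq ?iota_uniq // => i j /eqP; rewrite eqr_nat => /eqP.
by rewrite size_map size_iota ltnn.
Qed.

Lemma first_dependent (k : fieldType) n (T : nat -> 'rV[k]_n) :
  exists N, row_free (\matrix_(i < N) T i) /\
    exists c : nat -> k, T N = \sum_(i < N) c i *: T i.
Proof.
pose A N := \matrix_(i < N) T i.
have ex : exists N, ~~ row_free (A N.+1).
  by exists n; rewrite /row_free neq_ltn ltnS rank_leq_col.
case: (ex_minnP ex) => N hN hmin; exists N; split.
  case: N hN hmin => [|N] _ hmin; first by rewrite /row_free eqn_leq rank_leq_row leq0n.
  by apply/negPn/negP => /hmin; rewrite ltnn.
have freeN : row_free (A N).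
  case: N hN hmin => [|N] _ hmin; first by rewrite /row_free eqn_leq rank_leq_row leq0n.
  by apply/negPn/negP => /hmin; rewrite ltnn.
have mulA M (v : 'rV_M) : v *m A M = \sum_(i < M) v 0 i *: T i.
  by rewrite mulmx_sum_row; apply: eq_bigr => i _; rewrite rowK.
have [v [vA v0]] : exists v : 'rV_N.+1, v *m A N.+1 = 0 /\ v != 0.
  apply/not_existsP => h; move/negP: hN; apply; apply: inj_row_free => v vA.
  by apply/eqP/negPn/negP => v0; apply: (h v).
rewrite mulA big_ord_recr /= in vA.
(* A relation without [T N] would contradict the freeness of the first [N] vectors, so the relation
   can be solved for [T N]. *)
have [vN|vN] := eqVneq (v 0 ord_max) 0.
  move: vA; rewrite vN scale0r addr0 => vA.
  have : (\row_i v 0 (widen_ord (leqnSn N) i)) *m A N = 0.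
    by rewrite mulA -[RHS]vA; apply: eq_bigr => i _; rewrite mxE.
  rewrite -[RHS](mul0mx _ (A N)) => /(row_free_inj freeN) /rowP e.
  case/eqP: v0; apply/rowP => i; rewrite mxE.
  have [iN|iN] := ltnP i N; last first.
    by rewrite -vN; congr (v _ _); apply/val_inj/eqP; rewrite eqn_leq iN -ltnS ltn_ord.
  have := e (Ordinal iN); rewrite !mxE => <-; congr (v _ _); exact/val_inj.
exists (fun i => - v 0 (inord i) / v 0 ord_max).
have -> : T N = - (v 0 ord_max)^-1 *: (\sum_(i < N) v 0 (widen_ord (leqnSn N) i) *: T i).
  move/eqP: vA; rewrite addr_eq0 => /eqP ->.
  by rewrite scalerN scaleNr opprK scalerA mulVf ?scale1r.
rewrite scaler_sumr; apply: eq_bigr => i _; rewrite scalerA; congr (_ *: _).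
rewrite mulNr mulrC mulNr; congr (- (v 0 _ * _)).
by apply/val_inj; rewrite /= inordK // ltnS ltnW.
Qed.

(** * Functions regular above z = 0 *)

Section ZeroFibre.
Variables (C : numClosedFieldType) (K : funField C).
Local Notation "p %:F" := (emb K p) (format "p %:F").
Local Notation fconst := (@fconst C K).
Local Notation X := ('X%:F : K).
Local Notation filX := (fil (fplace K 0)).
Variables (z : K) (znc : nonconst z).
Local Notation iota := (compr znc).
Local Notation A := (fnum z).
Local Notation B := (fden z).
Local Notation n := (maxn (size A) (size B)).-1.
Implicit Types (f g w e : K) (p q : {poly C}) (c a : C) (v : place K).

(** On these places, the points of the projective line, zeros and poles can be counted by
    degrees. *)
Definition geometric v := (exists a, v = fplace K a) \/ v = iplace K.

(* [Lam j w] says that [w / z ^ j] is regular at every point above [z = 0],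
   infinity included. *)
Definition Lam (j : int) w :=
  forall v (e : nat), geometric v -> ramified v e z -> fil v (e%:Z * j) w.

Lemma znum_neq0 : A != 0.
Proof.
apply/eqP => A0; apply: (znc (c := 0)); by rewrite (fracE z) A0 !rmorph0 mul0r.
Qed.

Lemma LamD j f g : Lam j f -> Lam j g -> Lam j (f + g).
Proof. by move=> hf hg v e gv ze; apply: filD; [exact: hf|exact: hg]. Qed.

Lemma LamM i j f g : Lam i f -> Lam j g -> Lam (i + j) (f * g).
Proof. by move=> hf hg v e gv ze; rewrite mulrDr; apply: filM; [exact: hf|exact: hg]. Qed.

Lemma LamN j f : Lam j f -> Lam j (- f).
Proof. by move=> hf v e gv ze; apply: filN; exact: hf. Qed.

Lemma Lam0 j : Lam j 0.
Proof. by move=> v e _ _; exact: fil0. Qed.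

Lemma Lam_le i j f : i <= j -> Lam j f -> Lam i f.
Proof.
move=> ij hf v e gv ze; apply: (fil_le _ (hf v e gv ze)).
by rewrite ler_wpM2l // ler0z.
Qed.

Lemma Lam_sum j (I : Type) (r : seq I) (P : pred I) (f : I -> K) :
  (forall k, P k -> Lam j (f k)) -> Lam j (\sum_(k <- r | P k) f k).
Proof. by move=> h; elim/big_ind: _ => //; [exact: Lam0|exact: LamD]. Qed.

Lemma Lam_z (j : int) : Lam j (z ^ j).
Proof.
move=> v e gv [e0 z0 fz fz'].
have pow (m : nat) : fil v (e%:Z * m) (z ^ (m : int)).
  elim: m => [|m IH]; first by rewrite mulr0 expr0z; apply/fil_vring; exact: vring1.
  by rewrite intS mulrDr mulr1 expfzDr //; apply: filM.
case: j => m; first exact: pow.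
rewrite NegzE; elim: m => [|m IH]; first by rewrite mulrN1 -invr_expz expr1z.
rewrite -[m.+2]addn1 PoszD opprD mulrDr mulrN1 expfzDr //.
by apply: filM; rewrite // -invr_expz expr1z.
Qed.

Lemma vring_pev v (e : nat) p : ramified v e z -> vring v (pev z p).
Proof.
move=> [e0 z0 fz _].
have vz : vring v z by apply/fil_vring; apply: (fil_le _ fz); lia.
elim/poly_ind: p => [|p c IH]; first by rewrite rmorph0; exact: vring0.
rewrite rmorphD rmorphM /= pevC pevX.
by apply: vringD; [exact: vringM|exact: vringC].
Qed.

(** At a zero of [z], [q(z)] is congruent to the nonzero constant [q(0)]. *)
Lemma vring_pev_inv v (e : nat) q : ramified v e z -> q.[0] != 0 -> vring v (pev z q)^-1.
Proof.
move=> ze q0; apply: vring_inv; first exact: vring_pev ze.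
have /factor_theorem [r qr] : root (q - q.[0]%:P) 0.
  by rewrite rootE !hornerE subrr.
move/eqP: qr; rewrite subr_eq subr0 => /eqP qr h.
have f1 : fil v 1 (pev z (r * 'X)).
  rewrite rmorphM /= pevX -[1]add0r; apply: filM.
    by apply/fil_vring; exact: vring_pev ze.
  by case: ze => e0 _ fz _; apply: (fil_le _ fz); lia.
have := filB h f1; rewrite {1}qr rmorphD /= addrC addKr pevC.
apply: vunit_not_fil1; rewrite ?fmorph_eq0 //.
by rewrite -fmorphV; exact: vringC.
Qed.

(** An order at 0 in the variable [z] gets multiplied by the ramification index at each point above;
    the factor [e] in [Lam] absorbs this. *)
Lemma Lam_iota j e : filX j e -> Lam j (iota e).
Proof.
move=> /fil_fplaceP [p [q [q0 ->]]]; rewrite subr0 rmorphM fmorphXz /= compr_poly pevX.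
rewrite compr_frac ?(horner_neq0 q0) //.
rewrite -{1}[j]addr0; apply: LamM; first exact: Lam_z.
move=> v e' gv ze; rewrite mulr0; apply/fil_vring; apply: vringM.
  exact: vring_pev ze.
exact: vring_pev_inv ze q0.
Qed.

End ZeroFibre.

(** * Counting the zeros of [z] *)

Section Coordinates.
Variables (C : numClosedFieldType) (K : funField C).
Local Notation "p %:F" := (emb K p) (format "p %:F").
Local Notation fconst := (@fconst C K).
Local Notation X := ('X%:F : K).
Local Notation filX := (fil (fplace K 0)).
Variables (z : K) (znc : nonconst z).
Local Notation iota := (compr znc).
Local Notation A := (fnum z).
Local Notation B := (fden z).
Local Notation Lam := (Lam z).
Implicit Types (f g w : K) (p q : {poly C}) (c a : C) (v : place K).

(** The degree of [z] as a map of the projective line to itself, which is also the degree of [K]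
    over [C(z)]. *)
Definition zdeg := (maxn (size A) (size B)).-1.
Local Notation n := zdeg.

Lemma size_znum : (size A <= n.+1)%N.
Proof. by rewrite /zdeg prednK ?leq_maxl // leq_max !size_poly_gt0 znum_neq0. Qed.

Lemma size_zden : (size B <= n.+1)%N.
Proof. by rewrite /zdeg prednK ?leq_maxr // leq_max !size_poly_gt0 fden_neq0 orbT. Qed.

Lemma zden_root a : root A a -> B.[a] != 0.
Proof. by move=> /(coprimep_root (fcoprime z)). Qed.

Lemma ramified_fin a : root A a -> exists (m : nat) q,
  [/\ ramified (fplace K a) m z, q.[a] != 0 & A = ('X - a%:P) ^+ m * q].
Proof.
move=> Aa; have [m [q [qa Aq]]] := fin_poly_factor a (znum_neq0 znc).
have Ba := zden_root Aa.
have zE : z = ('X - a%:P)%:F ^ (m : int) * (q%:F / B%:F).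
  by rewrite {1}(fracE z) {1}Aq rmorphM rmorphXn /= mulrA.
exists m, q; split=> //; split.
- case: m Aq {zE} => // Aq; move: Aa; rewrite Aq mul1r rootE; by rewrite (negPf qa).
- by apply: contra_notN (@znc 0) => /eqP ->; rewrite rmorph0.
- by apply/fil_fplaceP; exists q, B.
apply/fil_fplaceP; exists B, q; split=> //.
by rewrite {1}zE invfM invr_expz invf_div.
Qed.

Lemma ramified_inf : (size A < size B)%N -> ramified (iplace K) (size B - size A) z.
Proof.
move=> AB; have X0 := X_neq0 K; have A0 := znum_neq0 znc.
pose e := (size B - size A)%N; rewrite -/e.
have Xe0 : ('X^e : {poly C}) != 0 by rewrite -size_poly_gt0 size_polyXn.
have zE : z = X^-1 ^ (e : int) * (('X^e * A)%:F / B%:F).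
  rewrite {1}(fracE z) rmorphM rmorphXn /= -exprnP exprVn; field.
  by rewrite emb_eq0 fden_neq0 expf_neq0.
have s : size ('X^e * A) = size B.
  by rewrite size_mul // size_polyXn addSn /= subnK // ltnW.
split.
- by rewrite subn_gt0.
- by apply: contra_notN (@znc 0) => /eqP ->; rewrite rmorph0.
- apply/(filE (iplace K)); exists (('X^e * A)%:F / B%:F) => //.
  by exists ('X^e * A), B; rewrite s fden_neq0.
apply/(filE (iplace K)); exists (B%:F / ('X^e * A)%:F).
  by exists B, ('X^e * A); rewrite s mulf_neq0.
by rewrite {1}zE invfM invr_expz invf_div.
Qed.

(** This bound makes [n!] a common multiple of all the ramification indices above [z = 0]. *)
Lemma ramified_le v (e : nat) : geometric v -> ramified v e z -> (e <= n)%N.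
Proof.
have A0 := znum_neq0 znc; have B0 := fden_neq0 z.
have AB : A%:F = z * B%:F by rewrite {2}(fracE z) divfK // emb_eq0.
move=> [[a ->]|->] [e0 z0 fz _].
  have : fil (fplace K a) e A%:F.
    rewrite AB -[e%:Z]addr0; apply: filM => //; apply/fil_vring; exact: reg_poly.
  move=> /fil_poly /(dvdp_leq A0); rewrite size_exp_XsubC => h.
  by rewrite -ltnS; apply: leq_trans h size_znum.
have [u [p [q [q0 pq ->]]] zu] := (filE (iplace K) e z).1 fz.
have : A%:F * 'X^e%:F / B%:F = p%:F / q%:F.
  rewrite AB {1}zu -exprnP exprVn rmorphXn /=; field.
  by rewrite !emb_eq0 q0 B0 (expf_neq0 _ (X_neq0 K)).
rewrite -rmorphM => /(frac_eq _ _ _ B0 q0) h.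
have Xe0 : ('X^e : {poly C}) != 0 by rewrite -size_poly_gt0 size_polyXn.
have p0 : p != 0.
  apply: contra_eq_neq h => ->; rewrite mul0r; apply: mulf_neq0 => //; exact: mulf_neq0.
have key (i j k l m : nat) : ((i + m).-1 + l).-1 = (k + j).-1 ->
  (0 < i -> 0 < j -> 0 < l -> m = e.+1 -> k <= l -> j <= n.+1 -> e <= n)%N by lia.
have /(congr1 (fun p : {poly C} => size p)) := h; rewrite !size_mul ?mulf_neq0 //.
move=> /key; apply=> //; rewrite ?size_poly_gt0 ?size_polyXn //; exact: size_zden.
Qed.

(** Pole orders of [p / q] are at most [size q] at finite points and [size p] at infinity, so one
    crude bound serves every place. *)
Lemma Lam_exists w : exists s : nat, Lam (- s%:Z) w.
Proof.
have [->|w0] := eqVneq w 0; first by exists 0%N; exact: Lam0.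
have [p [q [p0 q0 ->]]] := neq0_frac w0.
exists (size p + size q)%N => v e gv ze; have [e0 _ _ _] := ze.
apply: (@fil_le _ _ _ _ (- (size p + size q)%N%:Z)).
  by rewrite mulrN lerN2 ler_peMl // lez_nat.
case: gv {ze} => [[a ->]|->].
  have [m [r [ra qr]]] := fin_poly_factor a q0.
  apply: (@fil_le _ _ _ _ (- m%:Z)).
    rewrite lerN2 lez_nat; apply: leq_trans (leq_addl _ _).
    have r0 := horner_neq0 ra.
    rewrite {}qr size_mul // ?expf_neq0 ?polyXsubC_eq0 // size_exp_XsubC addSn /=.
    exact: leq_addr.
  apply/fil_fplaceP; exists p, r; split=> //.
  rewrite {}qr -invr_expz -exprnP rmorphM rmorphXn /=; field.
  by rewrite emb_eq0 (horner_neq0 ra) expf_neq0 // emb_eq0 polyXsubC_eq0.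
apply: (@fil_le _ _ _ _ (- (size p)%:Z)); first by rewrite lerN2 lez_nat leq_addr.
apply/(filE (iplace K)); exists (p%:F / ('X^(size p) * q)%:F).
  exists p, ('X^(size p) * q); split=> //.
    by rewrite mulf_neq0 // -size_poly_gt0 size_polyXn.
  by rewrite size_mul // -?size_poly_gt0 size_polyXn // addSn leq_addr.
rewrite /= -invr_expz -exprnP exprVn invrK rmorphM rmorphXn /=; field.
by rewrite emb_eq0 q0 expf_neq0 ?X_neq0.
Qed.

Variables (c0 : C) (c0A : A.[c0] != 0).
Local Notation y := (('X - c0%:P)%:F ^+ n.-1).

Lemma y_neq0 : y != 0 :> K.
Proof. by rewrite expf_neq0 // emb_eq0 polyXsubC_eq0. Qed.

(** A nonzero function with at most [n - 1] poles cannot vanish at the [n] zeros of [z], counted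
    with infinity. Division by [y] places the poles at [c0], away from these zeros, and keeps [X^i],
    [i < n], regular at infinity. *)
Lemma basis_indep p : (size p <= n)%N -> Lam 1 (p%:F / y) -> p = 0.
Proof.
move=> sp Lp; have A0 := znum_neq0 znc.
have Ap : A %| p.
  have [g0 [gA gp]] : gcdp A p != 0 /\ gcdp A p %| A /\ gcdp A p %| p.
    by rewrite gcdp_eq0 (negPf A0) dvdp_gcdl dvdp_gcdr.
  have [A1 AE] := dvdpP _ _ gA.
  have A10 : A1 != 0 by apply: contra_neq A0 => A10; rewrite AE A10 mul0r.
  have [s1|s1] := eqVneq (size A1) 1%N.
    by rewrite AE; move/eqP: s1 => /size_poly1P [c cn0 ->]; rewrite mul_polyC dvdpZl.
  have /closed_rootP [a Aa] := s1.
  have rA : root A a by rewrite AE rootM Aa.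
  have [m [q [ze qa Aq]]] := ramified_fin rA.
  have : fil (fplace K a) (m + 0)%N p%:F.
    rewrite -[p%:F](divfK y_neq0) PoszD; apply: filM.
      by rewrite -[m%:Z]mulr1; apply: Lp => //; left; exists a.
    apply/fil_vring; rewrite -rmorphXn; exact: reg_poly.
  rewrite addn0 => /fil_poly pm.
  (* The gcd already contains the full power of [X - a] in [A], so the cofactor [A1] cannot vanish
     at [a]. *)
  have : ('X - a%:P) ^+ m %| gcdp A p by rewrite dvdp_gcd pm Aq dvdp_mulr.
  move=> /dvdpP [u gu]; move: qa; have : q = A1 * u.
    have e1 : (('X - a%:P) ^+ m) != 0 by rewrite expf_neq0 // polyXsubC_eq0.
    by apply: (mulfI e1); rewrite -Aq {1}AE gu; ring.
  by move=> ->; rewrite hornerM (rootP Aa) mul0r eqxx.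
apply/eqP/negPn/negP => p0; have := dvdp_leq p0 Ap.
(* If [deg A = n], then [A] is too large to divide [p]. Otherwise [z] also vanishes at infinity, to
   the order [n - deg A], and this pushes the degree of [p] below [deg A]. *)
have [AB|BA] := ltnP (size A) (size B); last first.
  have : size A = n.+1.
    by rewrite /zdeg (maxn_idPl BA) prednK // size_poly_gt0.
  by move=> ->; rewrite ltnNge sp.
have nB : size B = n.+1.
  by rewrite /zdeg (maxn_idPr (ltnW AB)) prednK // size_poly_gt0 fden_neq0.
have [] := (filE (iplace K) _ _).1 (Lp _ _ (or_intror erefl) (ramified_inf AB)).
move=> _ [r [s [s0 rs ->]]] /=; rewrite mulr1; set e := (size B - size A)%N => h.
have c0n : ('X - c0%:P) ^+ n.-1 != 0 by rewrite expf_neq0 // polyXsubC_eq0.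
have {}h : ('X^e * p)%:F / (('X - c0%:P) ^+ n.-1)%:F = r%:F / s%:F.
  have x0 : X ^+ e != 0 := expf_neq0 e (X_neq0 K).
  rewrite rmorphM /= [(_ ^+ n.-1)%:F]rmorphXn -mulrA h -exprnP exprVn rmorphXn /=.
  by rewrite mulrA divff ?mul1r.
have Xe0 : ('X^e : {poly C}) != 0 by rewrite -size_poly_gt0 size_polyXn.
have : (size ('X^e * p)%R <= size (('X - c0%:P) ^+ n.-1)%R)%N.
  by apply: (ireg_size (K := K) c0n); exists r, s.
have key (i k l : nat) : e = (l - i)%N -> (i < l)%N -> l = n.+1 ->
  ((e.+1 + k).-1 <= n.-1.+1 -> 0 < i -> i <= k -> False)%N by lia.
rewrite size_mul // size_polyXn size_exp_XsubC => h1.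
by apply: (key (size A) (size p) (size B)) => //; rewrite size_poly_gt0.
Qed.

End Coordinates.

(** * A saturated basis of [K] over [C(z)] *)

Section Lattice.
Variables (C : numClosedFieldType) (K : funField C).
Local Notation "p %:F" := (emb K p) (format "p %:F").
Local Notation fconst := (@fconst C K).
Local Notation X := ('X%:F : K).
Local Notation filX := (fil (fplace K 0)).
Variables (z : K) (znc : nonconst z).
Local Notation iota := (compr znc).
Local Notation A := (fnum z).
Local Notation B := (fden z).
Local Notation Lam := (Lam z).
Implicit Types (f g w : K) (p q : {poly C}) (c a : C).
Local Notation n := (zdeg z).
Variables (c0 : C) (c0A : A.[c0] != 0).
Local Notation y := (('X - c0%:P)%:F ^+ n.-1).

Lemma Lam_y_poly p : (size p <= n)%N -> Lam 0 (p%:F / y).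
Proof.
move=> sp v e gv ze; rewrite mulr0; apply/fil_vring.
have A0 := znum_neq0 znc.
have yq : y = (('X - c0%:P) ^+ n.-1)%:F by rewrite rmorphXn.
have q0 : ('X - c0%:P) ^+ n.-1 != 0 by rewrite expf_neq0 // polyXsubC_eq0.
rewrite yq; case: gv ze => [[a ->]|->] ze; last first.
  exists p, (('X - c0%:P) ^+ n.-1); rewrite size_exp_XsubC; split=> //.
  by apply: leq_trans sp _; case: (n).
apply: reg_frac; rewrite horner_exp hornerXsubC expf_neq0 // subr_eq0.
apply: contra_neq c0A => <-; have [e0 _ fz _] := ze.
have : fil (fplace K a) e A%:F.
  have -> : A%:F = z * B%:F by rewrite {2}(fracE z) divfK // emb_eq0 fden_neq0.
  rewrite -[e%:Z]addr0; apply: filM => //; apply/fil_vring; exact: reg_poly.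
move=> /fil_poly h; apply/rootP; rewrite -dvdp_XsubCl; apply: dvdp_trans h.
by case: (e) e0 => // k _; rewrite exprS dvdp_mulr.
Qed.

(** The entries of [u] stand for functions of [z], written in the variable [X] and moved by [iota];
    they are coordinates in the basis [X^i / y]. *)
Definition kappa (u : 'rV[K]_n) := \sum_(i < n) iota (u 0 i) * (X ^+ i / y).

Implicit Type u : 'rV[K]_n.

Lemma kappa_is_zmod : zmod_morphism kappa.
Proof.
move=> u u'; rewrite /kappa -sumrB; apply: eq_bigr => i _.
by rewrite !mxE rmorphB mulrBl.
Qed.
HB.instance Definition _ := GRing.isZmodMorphism.Build _ _ kappa kappa_is_zmod.

Lemma kappaZ e u : kappa (e *: u) = iota e * kappa u.
Proof. by rewrite /kappa mulr_sumr; apply: eq_bigr => i _; rewrite mxE rmorphM mulrA. Qed.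

Lemma Lam_basis (i : 'I_n) : Lam 0 (X ^+ i / y).
Proof. by rewrite -rmorphXn; apply: Lam_y_poly; rewrite size_polyXn. Qed.

(** The coefficients of [X^j] in the entries of [u] form a polynomial [P] of degree below [n] with
    [P / y] vanishing above [z = 0], so [basis_indep] kills them all. *)
Lemma kappa_step (j : int) u :
  (forall i, filX j (u 0 i)) -> Lam (j + 1) (kappa u) -> forall i, filX (j + 1) (u 0 i).
Proof.
move=> h L; have X0 := X_neq0 K.
pose u' : 'rV[K]_n := \row_i (u 0 i / X ^ j).
have ru i : reg 0 (u' 0 i) by rewrite mxE; have := h i; rewrite /fil unif0.
pose c i := feval (u' 0 i) 0.
have dc i : filX 1 (u' 0 i - fconst (c i)).
  have [r e] := regB (ru i) (reg_const K 0 (c i)).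
  move: e; rewrite fevalC subrr; move: (_ - _) r => w.
  elim/reg_ind => p q q0; rewrite feval_frac // => /eqP.
  rewrite mulf_eq0 invr_eq0 (negPf q0) orbF => /eqP p0.
  have /factor_theorem [r pr] : root p 0 by rewrite rootE p0.
  apply/fil_fplaceP; exists r, q; split=> //.
  by rewrite pr expr1z rmorphM mulrAC mulrC.
pose P : {poly C} := \sum_(i < n) (c i)%:P * 'X^i.
have PE : P%:F / y = \sum_(i < n) fconst (c i) * (X ^+ i / y).
  rewrite rmorph_sum mulr_suml; apply: eq_bigr => i _.
  by rewrite rmorphM rmorphXn /= mulrA.
have sP : (size P <= n)%N.
  apply: (leq_trans (size_sum _ _ _)); apply/bigmax_leqP => i _.
  rewrite mul_polyC; apply: leq_trans (size_scale_leq _ _) _.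
  by rewrite size_polyXn.
have P0 : P = 0.
  apply: (basis_indep (z := z) znc c0A sP).
  have -> : P%:F / y = z ^ (- j) * kappa u
      - \sum_(i < n) iota (u' 0 i - fconst (c i)) * (X ^+ i / y).
    rewrite PE; have -> : z ^ (- j) * kappa u = kappa u'.
      rewrite /kappa mulr_sumr; apply: eq_bigr => i _.
      by rewrite mxE rmorphM fmorphV fmorphXz /= compr_poly pevX invr_expz; ring.
    rewrite /kappa -sumrB; apply: eq_bigr => i _.
    by rewrite (rmorphB iota) /= comprC; ring.
  apply: LamD; last apply: LamN.
    have -> : 1 = - j + (j + 1) by ring.
    by apply: LamM => //; exact: Lam_z.
  apply: Lam_sum => i _; rewrite -[1]addr0; apply: LamM; last exact: Lam_basis.
  exact: Lam_iota.
have c_eq0 i : c i = 0.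
  have /(congr1 (fun p : {poly C} => p`_i)) := P0; rewrite coef0 coef_sum => <-.
  rewrite (bigD1 i) //= coefCM coefXn eqxx mulr1 big1 ?addr0 // => k ki.
  by rewrite coefCM coefXn eq_sym (negPf (_ : _ != _)) ?mulr0.
move=> i; have := dc i; rewrite c_eq0 rmorph0 subr0 mxE => hi.
have -> : u 0 i = X ^ j * (u 0 i / X ^ j) by rewrite mulrC divfK // expfz_neq0.
by apply: filM => //; rewrite -unif0; exact: fil_unif.
Qed.

(** The coordinates have no pole at [z = 0] that the function itself does not show. From any common
    lower bound, [kappa_step] climbs up to [j]. *)
Lemma kappa_saturated (j : int) u : Lam j (kappa u) -> forall i, filX j (u 0 i).
Proof.
move=> L; have [s hs] := filX_bound u.
have step (m : nat) : - s%:Z + m <= j -> forall i, filX (- s%:Z + m) (u 0 i).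
  elim: m => [|m IH] hm; first by rewrite addr0.
  have e : - s%:Z + m.+1 = - s%:Z + m + 1 by lia.
  rewrite e; apply: kappa_step; first by apply: IH; lia.
  by apply: Lam_le L; lia.
have [js|sj] := leP j (- s%:Z); first by move=> i; exact: fil_le js (hs i).
move=> i; have e : - s%:Z + absz (j + s%:Z) = j by lia.
by rewrite -e; apply: step; lia.
Qed.

Lemma kappa_inj u : kappa u = 0 -> u = 0.
Proof.
move=> u0; apply/rowP => i; rewrite mxE; apply: (fil_separated (v := fplace K 0)) => m.
by apply: kappa_saturated; rewrite u0; exact: Lam0.
Qed.

Definition img w := exists u, w = kappa u * y.

Lemma imgD f g : img f -> img g -> img (f + g).
Proof. by move=> [u ->] [v ->]; exists (u + v); rewrite (raddfD kappa) mulrDl. Qed.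

Lemma imgZ e f : img f -> img (iota e * f).
Proof. by move=> [u ->]; exists (e *: u); rewrite kappaZ mulrA. Qed.

Lemma img0 : img 0.
Proof. by exists 0; rewrite (raddf0 kappa) mul0r. Qed.

Lemma img_sum (I : Type) (r : seq I) (P : pred I) (f : I -> K) :
  (forall k, P k -> img (f k)) -> img (\sum_(k <- r | P k) f k).
Proof. by move=> h; elim/big_ind: _ => //; [exact: img0|exact: imgD]. Qed.

Lemma img_Xi (i : 'I_n) : img (X ^+ i).
Proof.
exists (delta_mx 0 i); rewrite /kappa (bigD1 i) //= mxE !eqxx rmorph1 mul1r.
rewrite big1 ?addr0 ?divfK ?(y_neq0 z c0) // => k ki.
by rewrite mxE (negPf ki) andbF rmorph0 mul0r.
Qed.

(** The relation [A(x) - z B(x) = 0] has degree [n] in [x] over [C(z)]; its leading coefficient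
    [A_n - z B_n] is nonzero because [A] or [B] has degree [n]. *)
Lemma img_Xn : img (X ^+ n).
Proof.
pose al i : K := fconst A`_i - X * fconst B`_i.
have rel : \sum_(i < n.+1) iota (al i) * X ^+ i = 0.
  have : A%:F - z * B%:F = 0.
    by rewrite {2}(fracE z) divfK ?subrr // emb_eq0 fden_neq0.
  have pE p : (size p <= n.+1)%N -> p%:F = \sum_(i < n.+1) fconst p`_i * X ^+ i.
    move=> sp; have {1}-> : p = \poly_(i < n.+1) p`_i.
      apply/polyP => k; rewrite coef_poly; case: ltnP => // kn.
      by rewrite nth_default // (leq_trans sp).
    rewrite poly_def rmorph_sum; apply: eq_bigr => i _ /=.
    by rewrite -mul_polyC rmorphM rmorphXn.
  move=> e; rewrite -[RHS]e (pE A) ?(size_znum znc) // (pE B) ?size_zden // mulr_sumr -sumrB.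
  apply: eq_bigr => i _; rewrite rmorphB rmorphM /= !comprC compr_poly pevX; ring.
have al0 : al n != 0.
  rewrite subr_eq0; apply/negP => /eqP e.
  have : (A`_n)%:P = 'X * (B`_n)%:P by apply: (@emb_inj _ K); rewrite rmorphM.
  move=> /polyP h; have := h 0%N; rewrite coefC coefXM /= => An.
  have := h 1%N; rewrite coefC coefXM coefC /= => Bn.
  move: An Bn; rewrite /zdeg => An /esym Bn.
  have A0 := znum_neq0 znc; have B0 := fden_neq0 z.
  have [AB|BA] := leqP (size A) (size B).
    by move: Bn; rewrite (maxn_idPr AB) => /eqP; rewrite lead_coef_eq0 (negPf B0).
  by move: An; rewrite (maxn_idPl (ltnW BA)) => /eqP; rewrite lead_coef_eq0 (negPf A0).
rewrite big_ord_recr /= in rel.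
have -> : X ^+ n = \sum_(i < n) iota (- (al n)^-1 * al i) * X ^+ i.
  move/eqP: rel; rewrite addr_eq0 => /eqP rel.
  have i0 : iota (al n) != 0 by rewrite fmorph_eq0.
  apply: (mulfI i0); rewrite -[LHS]opprK -rel mulr_sumr -sumrN.
  apply: eq_bigr => i _; rewrite rmorphM rmorphN fmorphV /=; field; exact: i0.
by apply: img_sum => i _; apply: imgZ; exact: img_Xi.
Qed.

Lemma img_mulX f : img f -> img (X * f).
Proof.
move=> [u ->]; rewrite /kappa mulr_suml mulr_sumr; apply: img_sum => i _.
have -> : X * (iota (u 0 i) * (X ^+ i / y) * y) = iota (u 0 i) * X ^+ i.+1.
  by rewrite exprS; field; exact: (y_neq0 z c0).
apply: imgZ; have := ltn_ord i; rewrite leq_eqVlt => /orP [/eqP ->|h].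
  exact: img_Xn.
exact: (img_Xi (Ordinal h)).
Qed.

Lemma img_mulp p f : img f -> img (p%:F * f).
Proof.
move=> hf; elim/poly_ind: p => [|p c IH]; first by rewrite rmorph0 mul0r; exact: img0.
rewrite rmorphD rmorphM mulrDl /= -[_%:P%:F]/(fconst c); apply: imgD.
  by rewrite mulrAC mulrC; apply: img_mulX.
by rewrite -(comprC znc); exact: imgZ.
Qed.

Lemma zdeg_gt0 : (0 < n)%N.
Proof.
rewrite lt0n; apply/eqP => n0; have A0 := znum_neq0 znc.
have := size_znum znc; have := size_zden z; rewrite n0 => /size1_polyC bE /size1_polyC aE.
have b0 : B`_0 != 0 by rewrite -polyC_eq0 -bE fden_neq0.
apply: (@znc (A`_0 / B`_0)); rewrite {1}(fracE z) {1}aE {1}bE.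
by rewrite fmorph_div.
Qed.

Lemma img_poly p : img p%:F.
Proof.
rewrite -[p%:F]mulr1; apply: img_mulp; have := img_Xi (Ordinal zdeg_gt0).
by rewrite expr0.
Qed.

(** The span of the powers of [X] contains all polynomials. Multiplication by [q] acts on it
    injectively, hence by an invertible matrix, so that it contains all quotients. *)
Lemma kappa_surj w : exists u, w = kappa u.
Proof.
have iy := y_neq0 z c0.
suff [u e] : img (w * y) by exists u; apply: (mulIf iy).
have [p [q [q0 ->]]] : exists p q, q != 0 /\ w * y = p%:F / q%:F.
  by exists (fnum (w * y)), (fden (w * y)); rewrite fden_neq0 -fracE.
have /(_ _)/cid-/all_sig [M hM] : forall i : 'I_n, exists u, q%:F * X ^+ i = kappa u * y.
  by move=> i; apply: img_mulp; exact: img_Xi.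
pose Mq := \matrix_i M i.
have MqE u : kappa (u *m Mq) = q%:F * kappa u.
  have -> : kappa (u *m Mq) = \sum_(i < n) iota (u 0 i) * kappa (M i).
    rewrite mulmx_sum_row (raddf_sum kappa); apply: eq_bigr => i _.
    by rewrite rowK /= kappaZ.
  rewrite [in RHS]/kappa mulr_sumr; apply: eq_bigr => i _.
  by apply: (mulIf iy); rewrite -mulrA -hM; field.
have Mfree : row_free Mq.
  apply: inj_row_free => v vM; apply: kappa_inj; apply/eqP.
  have := MqE v; rewrite vM (raddf0 kappa) => /esym/eqP; rewrite mulf_eq0 emb_eq0 (negPf q0).
  by [].
have [u0 pu] := img_poly p.
exists (u0 *m invmx Mq); apply: (mulIf (_ : q%:F != 0)); first by rewrite emb_eq0.
rewrite divfK ?emb_eq0 // mulrAC [_ * q%:F]mulrC -MqE mulmxKV //.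
by rewrite -row_free_unit.
Qed.

End Lattice.

Local Notation theta_of := theta.

(** The exponent 0 is left out: it is the one to be kept. *)
Definition fracs (C : numClosedFieldType) (d N : nat) : seq C :=
  [seq i.+1%:R / d%:R | i <- iota 0 N] ++ [seq - (i.+1%:R / d%:R) | i <- iota 0 N].

Lemma mem_fracs (C : numClosedFieldType) (d N : nat) (i : int) :
  i != 0 -> (absz i <= N)%N -> i%:~R / d%:R \in fracs C d N.
Proof.
case: i => [[|i]|i] // _ iN; rewrite mem_cat; apply/orP; [left|right];
  apply/mapP; exists i; rewrite ?mem_iota ?add0n //.
by rewrite NegzE mulrNz mulNr.
Qed.

Lemma uniq_fracs (C : numClosedFieldType) (d N : nat) :
  (0 < d)%N -> uniq (0 :: fracs C d N).
Proof.
move=> d0; have di : 0 < (d%:R : C)^-1 by rewrite invr_gt0 ltr0n.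
have inj : injective (fun i : nat => i.+1%:R / d%:R : C).
  by move=> i j /(mulIf (lt0r_neq0 di)) /eqP; rewrite eqr_nat => /eqP [].
have pos (i : nat) : 0 < i.+1%:R / d%:R :> C by rewrite mulr_gt0 // ltr0n.
rewrite /= cat_uniq !map_inj_uniq ?iota_uniq //=; last first.
  by move=> i j /oppr_inj /inj.
rewrite mem_cat negb_or -andbA; apply/and3P; split.
- by apply/mapP => -[i _ e]; have := pos i; rewrite -e ltxx.
- by apply/mapP => -[i _ /esym/eqP]; rewrite oppr_eq0 gt_eqF.
rewrite andbT; apply/hasPn => _ /mapP [i _ ->]; apply/mapP => -[j _ e].
have := pos j; rewrite -e oppr_gt0 => h; have := lt_trans (pos i) h; by rewrite ltxx.
Qed.

(** * Constant Puiseux coefficients and integration by parts *)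

Section Balance.
Variables (C : numClosedFieldType) (K : funField C).
Local Notation "p %:F" := (emb K p) (format "p %:F").
Local Notation fconst := (@fconst C K).
Local Notation fderiv := (@fderiv C K).
Local Notation X := ('X%:F : K).
Local Notation filX := (fil (fplace K 0)).
Variables (z : K) (znc : nonconst z).
Local Notation iota := (compr znc).
Local Notation Lam := (Lam z).
Local Notation theta := (theta z).
Local Notation n := (zdeg z).
Implicit Types (f g w S : K) (p q h : {poly C}) (c a b : C).

Local Notation d := (n`!).

(* On the Puiseux expansions above [z = 0], [tau M] kills the terms whose
   exponent is nonzero and at most [M] in absolute value. *)
Definition tau M w := opl z (fracs C d (d * M)) w.

(** Since [e] divides [d], valuations at a place of index [e] can be rescaled to numerators over
    [d]. The range from [- e N1] to [e N2] becomes the exponents from [- N1] to [N2], the same at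
    every place. *)
Lemma fil_fracs v (e N1 N2 M : nat) (s : seq C) w :
  geometric v -> ramified v e z -> uniq s ->
  (forall i : int, (absz i <= d * M)%N -> - (N1%:Z * d) <= i < N2%:Z * d ->
    i%:~R / d%:R \in s) -> (N1 <= M)%N -> (N2 <= M)%N ->
  fil v (- (e%:Z * N1)) w -> fil v (e%:Z * N2) (opl z s w).
Proof.
move=> gv ze us hs N1M N2M fw; have [e0 _ _ _] := ze.
have ed : (e %| d)%N by apply: dvdn_fact; rewrite e0 (ramified_le znc gv ze).
have -> : e%:Z * N2 = - (e%:Z * N1) + (e * (N1 + N2))%N by lia.
apply: (fil_opl_lift ze) => // i hi.
have dE : d = (e * (d %/ e))%N by rewrite mulnC divnK.
have k0 : (0 < d %/ e)%N by rewrite divn_gt0 // dvdn_leq ?fact_gt0.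
set k := (d %/ e)%N in dE k0.
have -> : (- (e%:Z * N1) + i)%:~R / e%:R = ((- (e%:Z * N1) + i) * k)%:~R / d%:R :> C.
  rewrite dE natrM rmorphM /= -pmulrn; field.
  by rewrite !pnatr_eq0 -!lt0n e0 k0.
have e1 : e%:Z * N1 * k = N1%:Z * d by rewrite dE PoszM; ring.
have e2 : i%:Z * k < e%:Z * (N1 + N2)%N * k by rewrite ltr_pM2r // ?ltz_nat // -PoszM ltz_nat.
have e3 : e%:Z * (N1 + N2)%N * k = N1%:Z * d + N2%:Z * d by rewrite dE PoszD !PoszM; ring.
have e4 : 0 <= i%:Z * k by rewrite mulr_ge0.
have e5 : N1%:Z * d <= d%:Z * M by rewrite mulrC ler_wpM2l // lez_nat.
have e6 : N2%:Z * d <= d%:Z * M by rewrite mulrC ler_wpM2l // lez_nat.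
have e7 : (d * M)%N = d%:Z * M :> int by rewrite PoszM.
have e8 : (- (e%:Z * N1) + i) * k = i%:Z * k - N1%:Z * d by rewrite -e1; ring.
rewrite e8; apply: hs.
  by rewrite -lez_nat e7; move: e2 e3 e4 e5 e6; lia.
by apply/andP; split; move: e2 e3 e4; lia.
Qed.

(** [tau M] removes the negative exponents of [w], which gives regularity. The extra [theta] is the
    factor for the exponent 0, after which no exponent below [M] survives. *)
Lemma Lam_tau (s M : nat) w : (s <= M)%N -> Lam (- s%:Z) w ->
  Lam 0 (tau M w) /\ Lam M (theta (tau M w)).
Proof.
move=> sM Lw; have us := @uniq_fracs C d (d * M) (fact_gt0 _).
split=> v e gv ze; have fw := Lw v e gv ze; rewrite mulrN in fw.
  apply: (@fil_fracs v e s 0 M _ w) => //; first by case/andP: us.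
  move=> i iM; rewrite mul0r => /andP [_ i0]; apply: mem_fracs => //.
  by apply: contraTneq i0 => ->.
have -> : theta (tau M w) = opl z (0 :: fracs C d (d * M)) w.
  by rewrite /= rmorph0 mul0r subr0.
apply: (@fil_fracs v e s M M _ w) => // i iM _; rewrite inE.
have [->|i0] := eqVneq i 0; first by rewrite mul0r eqxx.
by rewrite mem_fracs ?orbT.
Qed.

(** The relation is a linear differential equation for [f] over [C(z)]. The point of the second part
    is that [r] depends on [f] alone. *)
Lemma krylov f : exists N (c : nat -> K) (r : nat),
  iter N theta f = \sum_(k < N) iota (c k) * iter k theta f /\
  forall (j : int) (u : nat -> K), Lam j (\sum_(k < N) iota (u k) * iter k theta f) ->
    forall k, (k < N)%N -> filX (j - r%:Z) (u k).
Proof.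
have [c0 c0A] := poly_nonroot (znum_neq0 znc).
have /(_ _)/cid-/all_sig [T hT] : forall k : nat, exists u, iter k theta f = kappa znc c0 u.
  by move=> k; exact: kappa_surj.
have [N [freeT [c cE]]] := first_dependent T.
have sumE (u : nat -> K) :
    \sum_(k < N) iota (u k) * iter k theta f = kappa znc c0 (\sum_(k < N) u k *: T k).
  rewrite (raddf_sum (kappa znc c0)); apply: eq_bigr => k _ /=.
  by rewrite kappaZ hT.
pose A := \matrix_(i < N) T i.
(* The pseudo-inverse recovers the [u k] from the coordinates of the sum, so its pole order at 0 is
   the loss. *)
have [r hr] := filX_bound (mxvec (pinvmx A)).
exists N, c, r; split; first by rewrite sumE hT cE.
move=> j u; rewrite sumE => Lu k kN.
pose U : 'rV[K]_N := \row_i u i.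
have UA : \sum_(k < N) u k *: T k = U *m A.
  by rewrite mulmx_sum_row; apply: eq_bigr => i _; rewrite mxE rowK.
have -> : u k = (U *m A *m pinvmx A) 0 (Ordinal kN) by rewrite mulmxKp // mxE.
rewrite mxE; apply: fil_sum => i _; apply: filM.
  by rewrite -UA; exact: (kappa_saturated c0A Lu).
by rewrite -mxvecE.
Qed.

Lemma iota_theta (e : K) : fderiv z != 0 -> theta (iota e) = iota (theta_of X e).
Proof.
move=> z'0; rewrite thetaX (rmorphM iota) /= compr_poly pevX.
by rewrite /theta_of fderiv_compr mulrA mulfK.
Qed.

(** Coordinates of the [theta]-derivative of a combination: the derived coefficients, the shift of
    the iterates, and the top iterate rewritten by the relation [c]. *)
Definition dcoord N (c u : nat -> K) (k : nat) :=
  theta_of X (u k) + (if k is k'.+1 then u k' else 0) + u N.-1 * c k.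

Section Span.
Variables (f : K) (N : nat) (c : nat -> K) (r : nat) (z'0 : fderiv z != 0).
Local Notation v k := (iter k theta f).
Hypothesis vN : v N = \sum_(k < N) iota (c k) * v k.
Hypothesis bound : forall (j : int) (u : nat -> K),
  Lam j (\sum_(k < N) iota (u k) * v k) -> forall k, (k < N)%N -> filX (j - r%:Z) (u k).

Definition comb (u : nat -> K) := \sum_(k < N) iota (u k) * v k.
Definition inspan w := exists u, w = comb u.

Lemma theta_comb u : theta (comb u) = comb (dcoord N c u).
Proof.
rewrite /comb; case: N vN => [|m] vm; first by rewrite !big_ord0 raddf0.
rewrite raddf_sum /=.
have -> : \sum_(k < m.+1) theta (iota (u k) * v k)
  = \sum_(k < m.+1) iota (theta_of X (u k)) * v k + \sum_(k < m.+1) iota (u k) * v k.+1.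
  by rewrite -big_split; apply: eq_bigr => k _; rewrite thetaM iota_theta.
rewrite [X in _ + X = _]big_ord_recr /= -[theta_of _ (v m)]/(v m.+1) vm mulr_sumr.
rewrite [RHS](eq_bigr (fun k : 'I_m.+1 => (iota (theta_of X (u k)) * v k +
   iota (if k : nat is k'.+1 then u k' else 0) * v k) + iota (u m) * (iota (c k) * v k))).
  rewrite !big_split /= addrA; congr (_ + _ + _).
  by rewrite [RHS]big_ord_recl /= rmorph0 mul0r add0r.
by move=> k _; rewrite /dcoord !(rmorphD iota) (rmorphM iota (u m)) /=; ring.
Qed.

Lemma inspan_iter k : (k <= N)%N -> inspan (v k).
Proof.
rewrite leq_eqVlt => /orP [/eqP ->|kN]; first by exists c.
exists (fun i => (i == k)%:R); rewrite /comb (bigD1 (Ordinal kN)) //= eqxx rmorph1 mul1r.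
by rewrite big1 ?addr0 // => i ik; rewrite (negPf (_ : nat_of_ord i != k)) ?rmorph0 ?mul0r.
Qed.

Lemma inspanZ e w : inspan w -> inspan (iota e * w).
Proof.
move=> [u ->]; exists (fun k => e * u k); rewrite /comb mulr_sumr.
by apply: eq_bigr => k _; rewrite rmorphM mulrA.
Qed.

Lemma inspanB w w' : inspan w -> inspan w' -> inspan (w - w').
Proof.
move=> [u ->] [u' ->]; exists (fun k => u k - u' k); rewrite /comb -sumrB.
by apply: eq_bigr => k _; rewrite (rmorphB iota) mulrBl.
Qed.

Lemma inspan_opl s w : inspan w -> inspan (opl z s w).
Proof.
move=> hw; elim: s => //= l s IH; apply: inspanB.
  by case: IH => u ->; rewrite theta_comb; eexists.
by rewrite -(comprC znc); exact: inspanZ.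
Qed.

Lemma pev_iota p : pev z p = iota p%:F.
Proof. by rewrite compr_poly. Qed.

(** Integration by parts: up to a [theta]-derivative, [u_k theta^k f] can be replaced by
    [- theta(u_k) theta^(k-1) f]. Done from the top index down, this leaves a multiple of [f];
    divisibility by [X^j] survives because [theta] preserves it. *)
Lemma correction (j : nat) (u : nat -> K) :
  (forall k, (k < N)%N -> exists p, u k = ('X^j * p)%:F) ->
  exists h (e : nat -> K), (forall k, filX j (e k)) /\
    comb u - theta (comb e) = pev z ('X^j * h) * f.
Proof.
move=> hu.
have xj : 'X * ('X^j)^`() = j%:R * 'X^j :> {poly C}.
  rewrite derivXn; case: (j) => [|k]; first by rewrite mulr0n mulr0 mul0r.
  by rewrite mulrnAr -exprS mulr_natl.
(* [D i] is the coefficient of [theta^(N - i) f] once all higher indices have been eliminated; [D N]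
   is the coefficient of [f] that remains. *)
pose D := fix D i : K := if i is i'.+1 then u (N - i)%N - theta_of X (D i') else 0.
have hD i : (i <= N)%N -> exists p, D i = ('X^j * p)%:F.
  elim: i => [|i IH] iN; first by exists 0; rewrite mulr0 rmorph0.
  have [p up] : exists p, u (N - i.+1)%N = ('X^j * p)%:F.
    by apply: hu; rewrite -subSn // subSS leq_subr.
  have [q Dq] := IH (ltnW iN).
  exists (p - (j%:R * q + 'X * q^`())); rewrite /= up -/D Dq theta_poly -rmorphB; congr (emb K _).
  by rewrite derivM mulrDr mulrA xj; ring.
have [h Dh] := hD N (leqnn _).
exists h, (fun k => if (k < N)%N then D (N - k.+1)%N else 0); split.
  move=> k; case: ifP => kN; last exact: fil0.
  have [p ->] := hD (N - k.+1)%N (leq_subr _ _).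
  have : fil (fplace K 0) j ('X^j * p)%:F by apply/fil_poly; rewrite subr0 dvdp_mulr.
  by [].
rewrite pev_iota -Dh.
have -> : theta (comb (fun k => if (k < N)%N then D (N - k.+1)%N else 0))
  = \sum_(k < N) (iota (theta_of X (D (N - k.+1)%N)) * v k + iota (D (N - k.+1)%N) * v k.+1).
  rewrite /comb raddf_sum; apply: eq_bigr => k _.
  by rewrite /= ltn_ord thetaM iota_theta.
rewrite /comb -sumrB.
(* The sum telescopes from [D N] at index 0 to [D 0 = 0]. *)
rewrite (eq_bigr (fun k : 'I_N => iota (D (N - k)%N) * v k - iota (D (N - k.+1)%N) * v k.+1)).
  rewrite -(big_mkord predT (fun k => iota (D (N - k)%N) * v k - iota (D (N - k.+1)%N) * v k.+1)).
  have := telescope_sumr (fun k => - (iota (D (N - k)%N) * v k)) (leq0n N).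
  rewrite subnn subn0 /= rmorph0 mul0r oppr0 sub0r opprK => <-.
  by apply: eq_bigr => k _; rewrite opprK addrC.
move=> k _; have -> : D (N - k)%N = u k - theta_of X (D (N - k.+1)%N).
  have -> : (N - k = (N - k.+1).+1)%N by rewrite -subSn.
  by rewrite /= -/D; congr (u _ - _); have := ltn_ord k; lia.
by rewrite (rmorphB iota); ring.
Qed.

End Span.

End Balance.

Section BalanceTheorem.
Variables (C : numClosedFieldType) (K : funField C).
Local Notation "p %:F" := (emb K p) (format "p %:F").
Local Notation fconst := (@fconst C K).
Local Notation fderiv := (@fderiv C K).
Local Notation X := ('X%:F : K).
Local Notation filX := (fil (fplace K 0)).
Implicit Types (f g w S : K) (p q h : {poly C}) (c a b : C).

Lemma fil0_reg a w : fil (fplace K a) 0 w -> reg a w.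
Proof. by move=> /fil_vring. Qed.

Lemma fil1_feval a w : fil (fplace K a) 1 w <-> reg a w /\ feval w a = 0.
Proof.
split=> [/fil_fplaceP [p [q [qa ->]]]|[]].
  rewrite expr1z; have [r e] := regM (reg_poly K a ('X - a%:P)) (reg_frac K p qa).
  by rewrite r e feval_poly hornerXsubC subrr mul0r.
elim/reg_ind => p q qa; rewrite feval_frac // => /eqP.
rewrite mulf_eq0 invr_eq0 (negPf qa) orbF => /factor_theorem [r ->].
by apply/fil_fplaceP; exists r, q; rewrite expr1z rmorphM mulrAC mulrC.
Qed.

Variables (z : K) (znc : nonconst z).
Local Notation iota := (compr znc).
Local Notation Lam := (Lam z).

Lemma Lam_family N (v : nat -> K) : exists s : nat, forall k, (k < N)%N -> Lam (- s%:Z) (v k).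
Proof.
elim: N => [|N [s IH]]; first by exists 0%N.
have [t ht] := Lam_exists z (v N).
exists (s + t)%N => k; rewrite ltnS leq_eqVlt => /orP [/eqP ->|/IH h].
  by apply: Lam_le ht; lia.
by apply: Lam_le h; lia.
Qed.

Lemma Lam_comb f N (e : nat -> K) (j r : int) :
  (forall k, (k < N)%N -> Lam r (iter k (theta z) f)) -> (forall k, filX j (e k)) ->
  Lam (j + r) (comb znc f N e).
Proof.
move=> hv he; apply: Lam_sum => k _; apply: LamM; first exact: Lam_iota.
exact: hv.
Qed.

Lemma Lam_reg a (e : nat) w : ramified (fplace K a) e z -> Lam 0 w -> reg a w.
Proof. by move=> ze /(_ _ _ (or_introl (ex_intro _ a erefl)) ze); rewrite mulr0 => /fil0_reg. Qed.

Lemma Lam_feval0 a (e : nat) w : ramified (fplace K a) e z -> Lam 1 w ->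
  reg a w /\ feval w a = 0.
Proof.
move=> ze Lw; apply/fil1_feval; have [e0 _ _ _] := ze.
by apply: fil_le (Lw _ e (or_introl (ex_intro _ a erefl)) ze); rewrite mulr1.
Qed.

(** The primitive [S] differs from [tau z M (f / z^m)] by a factor [p(z)], equal to 1 at [z = 0],
    and by a correction that vanishes above [z = 0]; neither is seen at [a] or [b]. *)
Theorem balance f (m : nat) a b (ea eb : nat) :
  ramified (fplace K a) ea z -> ramified (fplace K b) eb z ->
  (forall h S, fderiv S = pev z h * f * fderiv z -> reg a S -> reg b S ->
    feval S a = feval S b) ->
  exists M0, forall M, (M0 <= M)%N ->
    [/\ reg a (tau z M (f / z ^+ m)), reg b (tau z M (f / z ^+ m)) &
        feval (tau z M (f / z ^+ m)) a = feval (tau z M (f / z ^+ m)) b].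
Proof.
move=> za zb H; set w := f / z ^+ m.
have z'0 := ramified_deriv za; have z0 := ramified_neq0 za.
have [N [c [r [vN bound]]]] := krylov znc f.
have [r' hr'] := Lam_family N (fun k => iter k (theta z) f).
have [s Lw] := Lam_exists z w.
(* [s] bounds the poles of [w], [r] is the loss of [krylov], [r'] bounds the poles of the iterates,
   and the last 1 makes the correction vanish at the endpoints. *)
exists (s + r + r' + 1)%N => M hM.
have [L0 LM] : Lam 0 (tau z M w) /\ Lam M (theta z (tau z M w)).
  by apply: (Lam_tau znc _ Lw); lia.
have inw : inspan znc f N w.
  have -> : w = iota (X ^+ m)^-1 * f.
    by rewrite fmorphV rmorphXn /= compr_poly pevX mulrC.
  by apply: inspanZ; exact: (@inspan_iter _ _ _ _ _ _ c vN 0%N).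
have [e eE] : inspan znc f N (tau z M w) by exact: (inspan_opl z'0 vN).
(* [E1] clears the coordinates of [tau z M w]; differentiation brings in only the further products
   [e_(N-1) c_k], cleared by [E2]. *)
have [E1 [E10 l1]] := lau_dens N e.
have [E2 [E20 l2]] := lau_dens N (fun k => e N.-1 * c k).
have [p [Ep Mp]] : exists p, E1 * E2 %| p /\ 'X^M %| p - 1.
  by apply: poly_one; rewrite hornerM mulf_neq0.
have [E3 pE] := dvdpP _ _ Ep.
pose u1 k := p%:F * e k.
pose S0 := pev z p * tau z M w.
have S0E : S0 = comb znc f N u1.
  rewrite /S0 eE (pev_iota znc) /comb mulr_sumr; apply: eq_bigr => k _.
  by rewrite (rmorphM iota) mulrA.
pose u k := dcoord N c u1 k.
have tS0 : theta z S0 = comb znc f N u by rewrite S0E; exact: theta_comb.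
have lu1 k : (k < N)%N -> lau (u1 k).
  move=> kN; rewrite /u1 pE; have -> : (E3 * (E1 * E2))%:F * e k
    = (E3 * E2)%:F * (E1%:F * e k) by rewrite !rmorphM; ring.
  by apply: lauM; [exact: lau_poly|exact: l1].
have lu k : (k < N)%N -> lau (u k).
  move=> kN; rewrite /u /dcoord; apply: lauD; first apply: lauD.
  - by apply: lau_theta; exact: lu1.
  - case: k kN => [|k] kN; last by apply: lu1; exact: ltnW.
    by rewrite -(rmorph0 (emb K)); exact: lau_poly.
  rewrite /u1 pE; have -> : (E3 * (E1 * E2))%:F * e N.-1 * c k
    = (E3 * E1)%:F * (E2%:F * (e N.-1 * c k)) by rewrite !rmorphM; ring.
  by apply: lauM; [exact: lau_poly|exact: l2].
have [q pq] := dvdpP _ _ Mp.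
have {}pq : p = 1 + q * 'X^M by rewrite -pq addrC subrK.
have p0 : p.[0] = 1.
  rewrite pq !hornerE expr0n (_ : (M == 0%N) = false) ?mulr0 ?addr0 //.
  by apply: gtn_eqF; move: hM; clear; lia.
have Lp : Lam 0 (pev z p).
  rewrite (pev_iota znc); apply: Lam_iota; apply/fil_vring; exact: reg_poly.
have LtS0 : Lam M (theta z S0).
  rewrite thetaM; apply: LamD; last by rewrite -[M%:Z]add0r; exact: LamM.
  rewrite -[M%:Z]addr0; apply: LamM => //.
  (* [p - 1] is divisible by [X^M], hence so is [X p']. *)
  rewrite (pev_iota znc) iota_theta // theta_poly; apply: Lam_iota; apply/fil_poly.
  rewrite subr0 pq derivD derivC add0r derivM derivXn mulrDr.
  have -> : 'X * (q * ('X^(M.-1) *+ M)) = (q *+ M) * 'X^M :> {poly C}.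
    by case: (M) => [|k]; rewrite ?mulr0n ?mulr0 ?mul0r //= exprS; ring.
  by rewrite mulrA -mulrDl dvdp_mull.
have hu k : (k < N)%N -> exists h, u k = ('X^(M - r) * h)%:F.
  move=> kN; apply: lau_fil; first exact: lu.
  have -> : (M - r)%N = M%:Z - r%:Z :> int by lia.
  by apply: bound => //; rewrite -/(comb znc f N u) -tS0.
have [h0 [e' [fe' hS]]] := correction znc f z'0 hu.
pose S := S0 - comb znc f N e'.
have Le' : Lam 1 (comb znc f N e').
  by apply: (Lam_le _ (Lam_comb hr' fe')); lia.
have tS : theta z S = pev z ('X^(M - r) * h0) * f by rewrite raddfB /= tS0.
(* Passing from [theta] to the derivative costs one factor [z], available because [r < M]. *)
have dS : fderiv S = pev z ('X^((M - r).-1) * h0) * f * fderiv z.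
  have -> : fderiv S = theta z S * fderiv z / z by rewrite /theta; field; rewrite z'0 z0.
  have [k Mk] : exists k, (M - r)%N = k.+1 by exists (M - r).-1; lia.
  rewrite tS Mk exprS /=.
  have -> : pev z ('X * 'X^k * h0) = z * pev z ('X^k * h0).
    by rewrite -mulrA (rmorphM (pev z)) /= pevX.
  by field.
have value x (ex : nat) : ramified (fplace K x) ex z ->
    [/\ reg x (tau z M w), reg x S & feval S x = feval (tau z M w) x].
  move=> zx; have rt := Lam_reg zx L0.
  have [re e0] := Lam_feval0 zx Le'.
  have [rz ze0] : reg x z /\ feval z x = 0.
    by apply: (Lam_feval0 zx); rewrite -[z]expr1z; exact: Lam_z.
  have [rp pe] := reg_pev p rz.
  have [r1 e1] := regM rp rt; have [r2 e2] := regB r1 re.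
  by split=> //; rewrite [LHS]e2 e0 e1 pe ze0 p0 mul1r subr0.
have [ra raS ea'] := value _ _ za; have [rb rbS eb'] := value _ _ zb.
by split=> //; rewrite -ea' -eb'; exact: H dS raS rbS.
Qed.

End BalanceTheorem.

(** * Separation of the endpoints *)

Section CayleyHamilton.
Variables (C : numClosedFieldType) (K : funField C).
Local Notation "p %:F" := (emb K p) (format "p %:F").
Local Notation fconst := (@fconst C K).
Local Notation X := ('X%:F : K).
Implicit Types (f g w : K) (p q r s : {poly C}) (c a b : C).
Variables (A : {poly C}) (z : K).

(* The semi-local ring of functions regular at the roots of [A]. *)
Definition sloc w := exists p q, coprimep q A /\ w = p%:F / q%:F.

Hypothesis A_size : (1 < size A)%N.
Hypothesis zA : exists r s, [/\ coprimep r A, coprimep s A & z = (A * r)%:F / s%:F].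

Lemma coprime_A_neq0 q : coprimep q A -> q != 0.
Proof.
by apply: contraTneq => ->; rewrite coprime0p -size_poly_eq1; apply: contraTN A_size => /eqP ->.
Qed.

Lemma sloc_poly p : sloc p%:F.
Proof. by exists p, 1; rewrite coprime1p rmorph1 divr1. Qed.

Lemma slocD f g : sloc f -> sloc g -> sloc (f + g).
Proof.
move=> [p [q [qA ->]]] [r [s [sA ->]]]; rewrite addf_frac ?coprime_A_neq0 //.
by exists (p * s + r * q), (q * s); rewrite coprimepMl qA.
Qed.

Lemma slocM f g : sloc f -> sloc g -> sloc (f * g).
Proof.
move=> [p [q [qA ->]]] [r [s [sA ->]]]; rewrite mulf_frac.
by exists (p * r), (q * s); rewrite coprimepMl qA.
Qed.

Lemma sloc_z : sloc z.
Proof. by have [r [s [_ sA ->]]] := zA; exists (A * r), s. Qed.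

Lemma sloc_pev p : sloc (pev z p).
Proof.
elim/poly_ind: p => [|p c IH]; first by rewrite rmorph0 -(rmorph0 (emb K)); exact: sloc_poly.
rewrite rmorphD rmorphM /= pevC pevX; apply: slocD; last exact: sloc_poly.
by apply: slocM => //; exact: sloc_z.
Qed.

Definition small M w := exists2 u, sloc u & w = z ^+ M * u.

Lemma smallD M f g : small M f -> small M g -> small M (f + g).
Proof. by move=> [u su ->] [v sv ->]; exists (u + v); [exact: slocD|rewrite mulrDr]. Qed.

Lemma small_mul M f g : sloc f -> small M g -> small M (f * g).
Proof. by move=> sf [u su ->]; exists (f * u); [exact: slocM|rewrite mulrCA]. Qed.

Lemma small0 M : small M 0.
Proof.
by exists 0; [rewrite -(rmorph0 (emb K)); exact: sloc_poly|rewrite mulr0].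
Qed.

Lemma small_sum M (I : Type) (r : seq I) (P : pred I) (f : I -> K) :
  (forall k, P k -> small M (f k)) -> small M (\sum_(k <- r | P k) f k).
Proof. by move=> h; elim/big_ind: _ => //; [exact: small0|exact: smallD]. Qed.

Local Notation D := (size A).-1.

(** [z] and [A] differ by a unit of the semi-local ring, so repeated division by [A] gives an
    expansion in powers of [z] whose digits have degree below [D]. *)
Lemma expand M w : sloc w ->
  exists c : 'I_D -> {poly C}, small M (w - \sum_(i < D) pev z (c i) * X ^+ i).
Proof.
move=> sw; elim: M => [|M [c [_ [p [q [qA ->]]] e]]].
  exists (fun=> 0); exists w; rewrite // expr0 mul1r big1 ?subr0 // => i _.
  by rewrite rmorph0 mul0r.
(* [u] inverts [q] modulo [A], so the next digit of [p / q] is the remainder of [p u]. *)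
have [[u v] /= uv] := Bezout_eq1_coprimepP _ _ qA.
have A0 : A != 0 by rewrite -size_poly_gt0; exact: ltnW.
have [r [s [rA sA zE]]] := zA.
have q0 := coprime_A_neq0 qA; have r0 := coprime_A_neq0 rA; have s0 := coprime_A_neq0 sA.
pose t := (p * u) %% A; pose m := (p * u) %/ A.
have st : (size t <= D)%N by rewrite -ltnS prednK ?ltn_modpN0 // ltnW.
have tE : t%:F = \sum_(i < D) fconst t`_i * X ^+ i.
  have {1}-> : t = \poly_(i < D) t`_i.
    apply/polyP => k; rewrite coef_poly; case: ltnP => // kD.
    by rewrite nth_default // (leq_trans st).
  rewrite poly_def rmorph_sum; apply: eq_bigr => i _ /=.
  by rewrite -mul_polyC rmorphM rmorphXn.
exists (fun i => c i + 'X^M * (t`_i)%:P).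
have -> : \sum_(i < D) pev z (c i + 'X^M * (t`_i)%:P) * X ^+ i
   = \sum_(i < D) pev z (c i) * X ^+ i + z ^+ M * t%:F.
  rewrite tE mulr_sumr -big_split; apply: eq_bigr => i _ /=.
  by rewrite rmorphD rmorphM rmorphXn /= pevX pevC mulrDl mulrA.
rewrite opprD addrA e; exists (((m * q + p * v) * s)%:F / (q * r)%:F).
  exists ((m * q + p * v) * s), (q * r); by rewrite coprimepMl qA.
have pu : (p * u)%:F = m%:F * A%:F + t%:F :> K by rewrite -rmorphM -rmorphD -divp_eq.
have pE : p%:F = (p * u)%:F * q%:F + p%:F * v%:F * A%:F :> K.
  by rewrite -!rmorphM -rmorphD -!mulrA -mulrDr uv mulr1.
rewrite -mulrBr exprSr -mulrA; congr (_ * _).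
rewrite pE pu zE !(rmorphM, rmorphD) /=; field.
by rewrite !emb_eq0 q0 r0 s0.
Qed.

(** On the generators [1, X, ..., X^(D-1)], multiplication by [Q] is given modulo [z^M] by a matrix
    of polynomials in [z]; its characteristic polynomial is the equation. *)
Lemma cayley_hamilton M Q : sloc Q ->
  exists chi : {poly {poly C}}, [/\ chi \is monic, size chi = size A &
    small M (\sum_(j < size chi) pev z chi`_j * Q ^+ j)].
Proof.
move=> sQ; have [D1 hD] : exists D1, D = D1.+1.
  by exists D.-1; rewrite prednK // -subn1 subn_gt0.
have /(_ _)/cid-/all_sig [c hc] : forall i : 'I_D, exists c : 'I_D -> {poly C},
    small M (Q * X ^+ i - \sum_(k < D) pev z (c k) * X ^+ k).
  by move=> i; apply: expand; apply: slocM => //; rewrite -rmorphXn; exact: sloc_poly.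
rewrite hD in c hc.
pose N := \matrix_(i < D1.+1, k < D1.+1) c i k.
(* [act G i] is the function that row [i] of [G] represents. *)
pose act (G : 'M[{poly C}]_D1.+1) i := \sum_(k < D1.+1) pev z (G i k) * X ^+ k.
have pow j (i : 'I_D1.+1) : small M (Q ^+ j * X ^+ i - act (N ^+ j) i).
  elim: j => [|j IH] in i *.
    rewrite /act (bigD1 i) //= mxE eqxx rmorph1 mul1r big1 => [|k ki].
      by rewrite addr0 subrr; exact: small0.
    by rewrite expr0 mxE eq_sym (negPf ki) rmorph0 mul0r.
  have -> : Q ^+ j.+1 * X ^+ i - act (N ^+ j.+1) i =
     Q * (Q ^+ j * X ^+ i - act (N ^+ j) i) +
     \sum_(k < D1.+1) pev z ((N ^+ j) i k) * (Q * X ^+ k - act N k).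
    have -> : act (N ^+ j.+1) i = \sum_(k < D1.+1) pev z ((N ^+ j) i k) * act N k.
      rewrite /act; under [RHS]eq_bigr do rewrite mulr_sumr.
      rewrite exchange_big; apply: eq_bigr => l _; rewrite exprSr mxE rmorph_sum mulr_suml.
      by apply: eq_bigr => k _; rewrite rmorphM mulrA.
    rewrite mulrBr exprS mulrA; under [X in _ = _ + X]eq_bigr do rewrite mulrBr.
    rewrite sumrB [act (N ^+ j) i]/act mulr_sumr addrA; congr (_ - _).
    rewrite -[LHS]addr0 -[RHS]addrA; congr (_ + _); rewrite -sumrN -big_split big1 // => k _.
    by rewrite /= mulrCA addNr.
  apply: smallD; first exact: small_mul.
  apply: small_sum => k _; apply: small_mul; first exact: sloc_pev.
  have := hc k; rewrite /act.
  by under [X in _ -> small _ (_ - X)]eq_bigr do rewrite mxE.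
exists (char_poly N); split; first exact: char_poly_monic.
  by rewrite size_char_poly -hD prednK // ltnW.
have CH := Cayley_Hamilton N.
have {}CH : \sum_(j < size (char_poly N)) (char_poly N)`_j *: N ^+ j = 0.
  rewrite -[RHS]CH -[in RHS](coefK (char_poly N)) poly_def rmorph_sum.
  by apply: eq_bigr => j _; rewrite /= linearZ /= rmorphXn /= horner_mx_X.
(* Row 0 belongs to the generator 1, on which [Q^j] acts as itself. *)
have := congr1 (fun G => act G ord0) CH => act0.
have {}act0 : \sum_(j < size (char_poly N)) pev z (char_poly N)`_j * act (N ^+ j) ord0 = 0.
  transitivity (act 0 ord0); last by rewrite /act big1 // => k _; rewrite mxE rmorph0 mul0r.
  rewrite -[RHS]act0 /act; under eq_bigr do rewrite mulr_sumr.
  rewrite exchange_big; apply: eq_bigr => k _; rewrite summxE rmorph_sum mulr_suml.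
  by apply: eq_bigr => j _; rewrite mxE rmorphM mulrA.
suff : small M (\sum_(j < size (char_poly N)) pev z (char_poly N)`_j * Q ^+ j -
    \sum_(j < size (char_poly N)) pev z (char_poly N)`_j * act (N ^+ j) ord0).
  by rewrite act0 subr0.
rewrite -sumrB; apply: small_sum => j _; rewrite -mulrBr.
apply: small_mul; first exact: sloc_pev.
by have := pow j ord0; rewrite expr0 mulr1.
Qed.

(* By Cayley-Hamilton for the multiplication by [Q] on the functions regular at
   the roots of [A], modulo a power of [z]. *)
Lemma cayley_propagate (S : K -> Prop) (rho Q : K) (L j0 : nat) :
  (forall f g, S f -> S g -> S (f + g)) -> (forall c f, S f -> S (fconst c * f)) ->
  (forall f, small 1 f -> S f) -> sloc rho -> sloc Q -> z != 0 ->
  (forall (i : int) j, - L%:Z <= i -> (j0 <= j < j0 + D)%N -> S (z ^ i * rho * Q ^+ j)) ->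
  forall (i : int) j, - L%:Z <= i -> (j0 <= j)%N -> S (z ^ i * rho * Q ^+ j).
Proof.
move=> SD SZ Ssmall srho sQ z0 S0 i j Li; elim/ltn_ind: j => j IH in i Li *.
move=> j0j; have [jD|Dj] := ltnP j (j0 + D); first by apply: S0; rewrite // j0j.
have S_0 : S 0 by apply: Ssmall; exact: small0.
have D0 : (0 < D)%N by rewrite -subn1 subn_gt0.
(* The modulus is [z^(L+1)] so that a factor [z] is left after multiplication by [z^i] with
   [i >= -L]. *)
have [chi [chi_monic chi_size [u su chiQ]]] := cayley_hamilton L.+1 sQ.
have chiA : size chi = D.+1 by rewrite chi_size prednK // ltnW.
rewrite chiA big_ord_recr /= in chiQ.
have lc : chi`_D = 1 by move/monicP: chi_monic; rewrite lead_coefE chiA.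
rewrite lc rmorph1 mul1r in chiQ.
have -> : Q ^+ j = z ^+ L.+1 * (u * Q ^+ (j - D)) +
    \sum_(k < D) fconst (-1) * (pev z chi`_k * Q ^+ (j - D + k)).
  have jE : (D + (j - D))%N = j by rewrite subnKC // (leq_trans (leq_addl _ _) Dj).
  rewrite mulrA -chiQ mulrDl -exprD jE mulr_suml addrAC -big_split big1 ?add0r // => k _.
  by rewrite /= rmorphN1 exprD; ring.
rewrite mulrDr; apply: (SD).
  apply: Ssmall; have [n ->] : exists n : nat, i = n%:Z - L%:Z by exists (absz (i + L%:Z)); lia.
  exists (z ^+ n * (rho * (u * Q ^+ (j - D)))).
    have slocX f m : sloc f -> sloc (f ^+ m).
      move=> sf; elim: m => [|m IHm]; first by rewrite expr0 -(rmorph1 (emb K)); exact: sloc_poly.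
      by rewrite exprS; exact: slocM.
    by do !apply: slocM => //; apply: slocX => //; exact: sloc_z.
  have zL : z ^+ L != 0 := expf_neq0 L z0.
  rewrite expfzDr // -invr_expz -!exprnP exprS expr1; field; exact: zL.
rewrite mulr_sumr; apply: (big_ind S S_0 SD) => k _; rewrite mulrCA; apply: (SZ).
have jk : (j0 <= j - D + k)%N by rewrite (leq_trans _ (leq_addr _ _)) // leq_subRL //; lia.
have kj : (j - D + k < j)%N.
  have := ltn_ord k; have : (D <= j)%N by apply: leq_trans Dj; exact: leq_addl.
  by move: (nat_of_ord k) => k'; move: (D) => D'; lia.
(* The coefficients of [chi] are polynomials in [z], which only raise [i]; this is why the induction
   hypothesis is general in [i], with a lower bound. *)
rewrite -[chi`_k]coefK poly_def rmorph_sum mulr_suml mulr_sumr.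
apply: (big_ind S S_0 SD) => l _; rewrite -mul_polyC rmorphM rmorphXn /= pevC pevX.
rewrite -mulrA mulrCA; apply: SZ.
have -> : z ^ i * rho * (z ^+ l * Q ^+ (j - D + k)) = z ^ (i + l%:Z) * rho * Q ^+ (j - D + k).
  by rewrite expfzDr // -exprnP; ring.
by apply: IH => //; lia.
Qed.

End CayleyHamilton.

(** * Comparison of constant coefficients with values *)

Section LocalValues.
Variables (C : numClosedFieldType) (K : funField C).
Local Notation "p %:F" := (emb K p) (format "p %:F").
Local Notation fconst := (@fconst C K).
Local Notation fderiv := (@fderiv C K).
Implicit Types (f g w S z : K) (p q h : {poly C}) (c a b : C).

Lemma ramified_mul v (e : nat) z u :
  ramified v e z -> vring v u -> vring v u^-1 -> u != 0 -> ramified v e (z * u).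
Proof.
move=> [e0 z0 fz fz'] vu vu' u0; split=> //; first by rewrite mulf_neq0.
  by rewrite -[e%:Z]addr0; apply: filM => //; apply/fil_vring.
by rewrite invfM -[- _]addr0; apply: filM => //; apply/fil_vring.
Qed.

Definition order a w := mup a (fnum w).

Lemma fnum_root a w : reg a w -> feval w a = 0 -> root (fnum w) a.
Proof.
rewrite /reg /fpole /feval => rw /eqP; rewrite mulf_eq0 invr_eq0.
by rewrite -[(fden w).[a] == 0]/(root (fden w) a) (negPf rw) orbF.
Qed.

Lemma order_factor a w : w != 0 ->
  exists q, q.[a] != 0 /\ fnum w = ('X - a%:P) ^+ order a w * q.
Proof.
move=> w0; have n0 : fnum w != 0.
  by apply: contraNneq w0 => n0; rewrite (fracE w) n0 rmorph0 mul0r.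
have [m [q [qa wq]]] := fin_poly_factor a n0; exists q; split=> //.
by rewrite /order {2}wq mupMl ?rootE // mup_XsubCX eqxx.
Qed.

Lemma nonconst_neq0 w : nonconst w -> w != 0.
Proof. by move=> wn; apply: contra_notN (wn 0) => /eqP ->; rewrite rmorph0. Qed.

Lemma ramified_order a w : nonconst w -> reg a w -> feval w a = 0 ->
  ramified (fplace K a) (order a w) w.
Proof.
move=> wn rw w0; have [m [q [wm qa wq]]] := ramified_fin wn (fnum_root rw w0).
by rewrite /order wq mupMl ?rootE // mup_XsubCX eqxx.
Qed.

(** [theta z w] vanishes at a zero of [z] where [w] is regular, so a factor [theta - l] multiplies
    the value by [-l]. *)
Lemma reg_opl a (e : nat) z s w : ramified (fplace K a) e z -> reg a w ->
  reg a (opl z s w) /\ feval (opl z s w) a = \prod_(l <- s) (- l) * feval w a.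
Proof.
move=> ze rw; elim: s => [|l s [IH1 IH2]] /=; first by rewrite big_nil mul1r.
have fo : fil (fplace K a) 0 (opl z s w) by apply/fil_vring.
have := fil_theta ze fo; rewrite mul0r rmorph0 mul0r subr0 add0r => /fil1_feval [r1 e1].
have [r2 e2] := regZ l IH1; have [r3 e3] := regB r1 r2.
by rewrite e3 e1 e2 IH2 big_cons; split=> //; ring.
Qed.

Lemma opl_exprz z s (i : int) : fderiv z != 0 -> z != 0 ->
  opl z s (z ^ i) = \prod_(l <- s) fconst (i%:~R - l) * z ^ i.
Proof.
move=> z' z0; elim: s => [|l s IH] /=; first by rewrite big_nil mul1r.
rewrite IH big_cons -rmorph_prod thetaZ thetaXz // (rmorphB fconst); ring.
Qed.

Variables (z : K).

Definition fracs_prod M : C := \prod_(l <- fracs C (zdeg z)`! ((zdeg z)`! * M)) (- l).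

Lemma fracs_prod_neq0 M : fracs_prod M != 0.
Proof.
have /= /andP [n0 _] := @uniq_fracs C (zdeg z)`! ((zdeg z)`! * M) (fact_gt0 _).
by rewrite prodf_seq_neq0; apply/allP => l ls; rewrite /= oppr_eq0; apply: contraNneq n0 => <-.
Qed.

Lemma tau_reg a (e M : nat) w : ramified (fplace K a) e z -> reg a w ->
  reg a (tau z M w) /\ feval (tau z M w) a = fracs_prod M * feval w a.
Proof. by move=> ze rw; exact: (reg_opl _ ze rw). Qed.

Lemma tauD M f g : tau z M (f + g) = tau z M f + tau z M g.
Proof. exact: raddfD. Qed.

Lemma tauZ M c f : tau z M (fconst c * f) = fconst c * tau z M f.
Proof. exact: oplZ. Qed.

(** [z^i] is an eigenvector of [theta z] with eigenvalue [i], which is the exponent [i d / d] of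
    [fracs]. *)
Lemma tau_exprz M (i : int) : fderiv z != 0 -> z != 0 ->
  i != 0 -> (absz i <= M)%N -> tau z M (z ^ i) = 0.
Proof.
move=> z' z0 i0 iM; have d0 : (0 < (zdeg z)`!)%N := fact_gt0 _.
rewrite /tau opl_exprz //; apply/eqP; rewrite mulf_eq0 prodf_seq_eq0.
apply/orP; left; apply/hasP; exists i%:~R; last by rewrite subrr rmorph0 eqxx.
have -> : i%:~R = (i * (zdeg z)`!)%:~R / (zdeg z)`!%:R :> C.
  by rewrite rmorphM /= -pmulrn mulfK // pnatr_eq0 -lt0n.
apply: mem_fracs; last by rewrite abszM mulnC leq_mul2l iM orbT.
by rewrite mulf_neq0 // eqz_nat -lt0n.
Qed.

(* Equality of the constant Puiseux coefficients at [a] and [b]. *)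
Definition balanced a b g := exists M0, forall M, (M0 <= M)%N ->
  [/\ reg a (tau z M g), reg b (tau z M g) & feval (tau z M g) a = feval (tau z M g) b].

(** The constant Puiseux coefficient at [a] is zero. *)
Definition null a g := exists M0, forall M, (M0 <= M)%N ->
  reg a (tau z M g) /\ feval (tau z M g) a = 0.

Lemma balancedD a b f g : balanced a b f -> balanced a b g -> balanced a b (f + g).
Proof.
move=> [M hf] [N hg]; exists (M + N)%N => L hL.
have [|ra rb e] := hf L; first by apply: leq_trans hL; exact: leq_addr.
have [|ra' rb' e'] := hg L; first by apply: leq_trans hL; exact: leq_addl.
rewrite tauD; have [r1 e1] := regD ra ra'; have [r2 e2] := regD rb rb'.
by rewrite e1 e2 e e'.
Qed.

Lemma balancedZ a b c f : balanced a b f -> balanced a b (fconst c * f).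
Proof.
move=> [M hf]; exists M => L /hf [ra rb e].
rewrite tauZ; have [r1 e1] := regZ c ra; have [r2 e2] := regZ c rb.
by rewrite e1 e2 e.
Qed.

Lemma nullD a f g : null a f -> null a g -> null a (f + g).
Proof.
move=> [M hf] [N hg]; exists (M + N)%N => L hL.
have [|ra e] := hf L; first by apply: leq_trans hL; exact: leq_addr.
have [|ra' e'] := hg L; first by apply: leq_trans hL; exact: leq_addl.
by rewrite tauD; have [r1 e1] := regD ra ra'; rewrite e1 e e' addr0.
Qed.

Lemma nullZ a c f : null a f -> null a (fconst c * f).
Proof.
move=> [M hf]; exists M => L /hf [ra e].
by rewrite tauZ; have [r1 e1] := regZ c ra; rewrite e1 e mulr0.
Qed.

Section AtPoints.
Variables (a b : C) (ea eb : nat).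
Hypotheses (za : ramified (fplace K a) ea z) (zb : ramified (fplace K b) eb z).

(** On functions regular at the endpoints, [tau] multiplies both values by the same nonzero
    constant. *)
Lemma balanced_reg g : reg a g -> reg b g -> balanced a b g <-> feval g a = feval g b.
Proof.
move=> ra rb; split=> [[M /(_ _ (leqnn _)) [_ _]]|e].
  have [_ ->] := tau_reg M za ra; have [_ ->] := tau_reg M zb rb.
  by move/(mulfI (fracs_prod_neq0 M)).
exists 0%N => M _; have [r1 ->] := tau_reg M za ra; have [r2 ->] := tau_reg M zb rb.
by rewrite e.
Qed.

Lemma null_reg g : reg a g -> null a g <-> feval g a = 0.
Proof.
move=> ra; split=> [[M /(_ _ (leqnn _)) [_]]|e].
  have [_ ->] := tau_reg M za ra => /eqP; rewrite mulf_eq0 (negPf (fracs_prod_neq0 M)).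
  by move/eqP.
by exists 0%N => M _; have [r1 ->] := tau_reg M za ra; rewrite e mulr0.
Qed.

Lemma balanced_null g : balanced a b g -> reg b g -> feval g b = 0 -> null a g.
Proof.
move=> [M h] rb gb; exists M => L /h [ra _ ->]; split=> //.
by have [_ ->] := tau_reg L zb rb; rewrite gb mulr0.
Qed.

Lemma balanced_exprz (i : int) : balanced a b (z ^ i).
Proof.
have z' := ramified_deriv za; have z0 := ramified_neq0 za.
have [->|i0] := eqVneq i 0.
  rewrite expr0z -(rmorph1 fconst); apply/balanced_reg; rewrite ?fevalC //; exact: reg_const.
exists (absz i) => M iM; rewrite tau_exprz // -(rmorph0 fconst) !fevalC.
by split=> //; exact: reg_const.
Qed.

End AtPoints.
End LocalValues.

(** * Equal values of the elements of [C(P, Q)] *)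

Section Separation.
Variables (C : numClosedFieldType) (K : funField C).
Local Notation "p %:F" := (emb K p) (format "p %:F").
Local Notation fconst := (@fconst C K).
Local Notation fderiv := (@fderiv C K).
Implicit Types (f g w S z : K) (p q h : {poly C}).

Lemma pev_comp w p q : pev w (p \Po q) = pev (pev w q) p.
Proof.
elim/poly_ind: p => [|p c IH]; first by rewrite comp_poly0 !rmorph0.
by rewrite comp_poly_MXaddC !rmorphD !rmorphM /= IH !pevC !pevX.
Qed.

Lemma nonconst_pev w p : nonconst w -> (1 < size p)%N -> nonconst (pev w p).
Proof.
move=> wn sp c e; have : pev w (p - c%:P) == 0 by rewrite rmorphB /= pevC e subrr.
rewrite (pev_eq0 _ wn) subr_eq0 => /eqP pc; move: sp; rewrite pc size_polyC.
by case: (c != 0).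
Qed.

(** The outer variable stands for [Q] and the inner one for [P]. *)
Definition ev2 (P Q : K) (G : {poly {poly C}}) : K := (map_poly (pev P) G).[Q].
HB.instance Definition _ P Q :=
  GRing.RMorphism.copy (ev2 P Q) (horner_eval Q \o map_poly (pev P)).

Lemma ev2M P Q G H : ev2 P Q (G * H) = ev2 P Q G * ev2 P Q H.
Proof. exact: (rmorphM (ev2 P Q)). Qed.

Lemma ev2B P Q G H : ev2 P Q (G - H) = ev2 P Q G - ev2 P Q H.
Proof. exact: (rmorphB (ev2 P Q)). Qed.

Lemma ev2_sum P Q G : ev2 P Q G = \sum_(j < size G) pev P G`_j * Q ^+ j.
Proof.
rewrite /ev2 (horner_coef_wide _ (size_poly _ _)).
by apply: eq_bigr => j _; rewrite coef_map.
Qed.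

Variables (P Q : K) (a b : C).
Hypotheses (Pnc : nonconst P) (ab : a != b) (Q0 : Q != 0).
Hypotheses (Pa : reg a P) (Pb : reg b P) (Qa : reg a Q) (Qb : reg b Q).

Let Pa0 := P - fconst (feval P a).
Let Pb0 := P - fconst (feval P b).
Let da := order a Pa0.
Let db := order b Pb0.

Hypothesis moments : forall j h S, (1 <= j <= da + db - 1)%N ->
  fderiv S = pev P h * Q ^+ j * fderiv P -> reg a S -> reg b S -> feval S a = feval S b.

Lemma shift_pev c : P - fconst c = pev P ('X - c%:P).
Proof. by rewrite rmorphB /= pevX pevC. Qed.

Lemma shift_nonconst c : nonconst (P - fconst c).
Proof. by rewrite shift_pev; apply: nonconst_pev; rewrite ?size_XsubC. Qed.

(** With [z = pi(P)], the chain rule turns [h(z) p(P) z'] into a polynomial in [P] times [P'], to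
    which the moments apply. *)
Lemma balanced_moments (pi p : {poly C}) (ea eb j m : nat) :
  (1 < size pi)%N -> (1 <= j <= da + db - 1)%N ->
  ramified (fplace K a) ea (pev P pi) -> ramified (fplace K b) eb (pev P pi) ->
  balanced (pev P pi) a b (pev P p * Q ^+ j / pev P pi ^+ m).
Proof.
move=> spi hj za zb; apply: (balance (nonconst_pev Pnc spi) m za zb) => h S dS.
apply: (@moments j ((h \Po pi) * p * pi^`())) => //.
by rewrite dS fderiv_pev !(rmorphM (pev P)) /= pev_comp; ring.
Qed.

Lemma ramified_a : ramified (fplace K a) da Pa0.
Proof.
have [r e] := regB Pa (reg_const K a (feval P a)); apply: ramified_order => //.
  exact: shift_nonconst.
by rewrite e fevalC subrr.
Qed.

Lemma ramified_b : ramified (fplace K b) db Pb0.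
Proof.
have [r e] := regB Pb (reg_const K b (feval P b)); apply: ramified_order => //.
  exact: shift_nonconst.
by rewrite e fevalC subrr.
Qed.

Lemma unit_order w (x : C) : w != 0 -> exists (l : int) u,
  [/\ reg x u, feval u x != 0 & w = ('X - x%:P)%:F ^ l * u].
Proof.
move=> w0; have [l [u [ru ru' e]]] := fin_factor x w0; exists l, u; split=> //.
have u0 : u != 0 by apply: contra_neq w0 => u0; rewrite e u0 mulr0.
have [_ h] := regM ru ru'; apply/negP => /eqP ux; move: h.
by rewrite divff // ux mul0r -(rmorph1 fconst) fevalC => /eqP; rewrite oner_eq0.
Qed.

Lemma ramified_unit_order z (x : C) (e : nat) : ramified (fplace K x) e z -> exists u,
  [/\ reg x u, feval u x != 0 & z = ('X - x%:P)%:F ^ (e : int) * u].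
Proof.
move=> [e0 z0 fz fz']; have pi0 := fin_unif_neq0 K x.
have pe0 : ('X - x%:P)%:F ^ (e : int) != 0 :> K by rewrite expfz_neq0.
have ru : reg x (z / ('X - x%:P)%:F ^ (e : int)) by exact: fz.
exists (z / ('X - x%:P)%:F ^ (e : int)); split=> //; last by rewrite mulrC divfK.
have ru' : reg x (z / ('X - x%:P)%:F ^ (e : int))^-1.
  by have := fz'; rewrite /fil fplace_unif -invr_expz invrK invf_div mulrC.
have [_ h] := regM ru ru'; apply/negP => /eqP ux; move: h.
rewrite divff ?mulf_neq0 ?invr_eq0 // ux mul0r -(rmorph1 fconst) fevalC => /eqP.
by rewrite oner_eq0.
Qed.

Implicit Types (t u : K) (x : C).

Definition vunit x u := reg x u /\ feval u x != 0.

Lemma vunitM x u w : vunit x u -> vunit x w -> vunit x (u * w).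
Proof. by move=> [ru u0] [rw w0]; have [r e] := regM ru rw; split; rewrite // e mulf_neq0. Qed.

Lemma vunitX x u n : vunit x u -> vunit x (u ^+ n).
Proof. by move=> [ru u0]; have [r e] := regX n ru; split; rewrite // e expf_neq0. Qed.

Lemma vunitV x u : vunit x u -> vunit x u^-1.
Proof. by move=> [ru u0]; have [r e] := regV ru u0; split; rewrite // e invr_eq0. Qed.

Lemma vunitXz x u (i : int) : vunit x u -> vunit x (u ^ i).
Proof.
by case: i => n vu; [exact: vunitX|rewrite NegzE -exprnN; apply: vunitV; exact: vunitX].
Qed.

(** With [n = e] and [k = l] the exponent is 0, so a power of [g] is balanced by a power of [z] into
    a unit. *)
Lemma quot_order x z g t u (e : nat) (l k : int) (n : nat) :
  vunit x t -> vunit x u -> z = ('X - x%:P)%:F ^ (e : int) * t ->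
  g = ('X - x%:P)%:F ^ l * u -> exists w, vunit x w /\
  g ^+ n * z ^ (- k) = ('X - x%:P)%:F ^ (l * n - e%:Z * k) * w.
Proof.
move=> vt vu -> ->; exists (u ^+ n * t ^ (- k)); split.
  by apply: vunitM; [exact: vunitX|exact: vunitXz].
have p0 := fin_unif_neq0 K x.
rewrite exprMn expfzMl exprz_exp [(_ ^ l) ^+ n]exprnP exprz_exp expfzDr // -mulrN.
by ring.
Qed.

Section SameValue.
Hypothesis PaPb : feval P a = feval P b.
Let z := Pa0.

Let za : ramified (fplace K a) da z. Proof. exact: ramified_a. Qed.
Let zb : ramified (fplace K b) db z.
Proof. by rewrite /z /Pa0 PaPb; exact: ramified_b. Qed.

Let A := ('X - a%:P) ^+ da * ('X - b%:P) ^+ db.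

Lemma A_size : size A = (da + db).+1.
Proof.
by rewrite size_mul ?expf_neq0 ?polyXsubC_eq0 // !size_exp_XsubC addSn addnS.
Qed.

Lemma coprime_A q : q.[a] != 0 -> q.[b] != 0 -> coprimep q A.
Proof.
move=> qa qb; rewrite coprimepMr; apply/andP.
by split; apply: coprimep_expr; rewrite coprimep_XsubC rootE.
Qed.

Lemma z_factor : exists r s, [/\ coprimep r A, coprimep s A & z = (A * r)%:F / s%:F].
Proof.
have z0 : z != 0 := nonconst_neq0 (@shift_nonconst _).
have [r1 [r1a e1]] := order_factor a z0.
have zE : z = Pb0 by rewrite /z /Pa0 PaPb.
have [r2 [r2b e2]] := order_factor b z0.
rewrite -/da in e1; have {}e2 : fnum z = ('X - b%:P) ^+ db * r2 by rewrite e2 /db -zE.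
have : ('X - b%:P) ^+ db %| r1.
  have := dvdp_mulr r2 (dvdpp (('X - b%:P) ^+ db)); rewrite -e2 e1 Gauss_dvdpr //.
  by rewrite coprimep_expl // coprimep_expr // coprimep_XsubC2 // subr_eq0.
move=> /dvdpP [r r1E]; exists r, (fden z).
have ra : r.[a] != 0 by apply: contraNneq r1a; rewrite r1E hornerM => ->; rewrite mul0r.
have rb : r.[b] != 0.
  have er : r2 = ('X - a%:P) ^+ da * r.
    apply: (mulfI (_ : ('X - b%:P) ^+ db != 0)); first by rewrite expf_neq0 // polyXsubC_eq0.
    by rewrite -e2 e1 r1E mulrA mulrC.
  by apply: contraNneq r2b; rewrite er hornerM => ->; rewrite mulr0.
have nE : fnum z = A * r by rewrite e1 r1E /A -mulrA [r * _]mulrC.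
split; first exact: coprime_A; last by rewrite -nE -fracE.
by have := fcoprime z; rewrite nE coprimepMl coprimep_sym => /andP [].
Qed.

Lemma sloc_regs u : sloc A u -> reg a u /\ reg b u.
Proof.
move=> [p [q [qA ->]]]; have [da0 _ _ _] := za; have [db0 _ _ _] := zb.
move: qA; rewrite coprimepMr => /andP []; rewrite coprimep_pexpr // coprimep_pexpr //.
by rewrite !coprimep_XsubC => qa qb; split; apply: reg_frac.
Qed.

Lemma small_fil1 w : small A z 1 w -> [/\ reg a w, reg b w, feval w a = 0 & feval w b = 0].
Proof.
move=> [u /sloc_regs [ua ub] ->]; rewrite expr1.
have z1 x (e : nat) : ramified (fplace K x) e z -> fil (fplace K x) 1 z.
  by move=> [e0 _ fz _]; apply: fil_le fz; lia.
have [ra ea] := (fil1_feval a z).1 (z1 _ _ za).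
have [rb eb] := (fil1_feval b z).1 (z1 _ _ zb).
have [r1 e1] := regM ra ua; have [r2 e2] := regM rb ub.
by rewrite e1 e2 ea eb !mul0r.
Qed.

Lemma reg_sloc u : reg a u -> reg b u -> sloc A u.
Proof.
rewrite /reg /fpole !rootE => ua ub.
by exists (fnum u), (fden u); split; [exact: coprime_A|exact: fracE].
Qed.

(** The moments give [1 <= j < da + db], and [balanced_exprz] gives [j = 0]: together these are the
    [size A - 1] consecutive powers from which [cayley_propagate] starts. *)
Lemma balanced_pow (i : int) j : balanced z a b (z ^ i * Q ^+ j).
Proof.
have z0 := ramified_neq0 za.
have D0 : (1 < size A)%N.
  by rewrite A_size; have [] := za; case: (da).
have small_bal f : small A z 1 f -> balanced z a b f.
  by move=> /small_fil1 [ra rb ea eb]; apply/(balanced_reg za zb ra rb); rewrite ea eb.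
suff : balanced z a b (z ^ i * 1 * Q ^+ j) by rewrite mulr1.
apply: (cayley_propagate D0 z_factor (L := absz i) (j0 := 0)) => //.
- exact: balancedD.
- exact: balancedZ.
- by rewrite -(rmorph1 (emb K)); exact: sloc_poly.
- exact: reg_sloc.
- move=> {}i {}j _; rewrite add0n A_size /= mulr1 => jD.
  case: j jD => [|j] jD; first by rewrite expr0 mulr1; exact: (balanced_exprz za zb).
  have hj : (1 <= j.+1 <= da + db - 1)%N by lia.
  have spi : (1 < size ('X - (feval P a)%:P)%R)%N by rewrite size_XsubC.
  have zE : z = pev P ('X - (feval P a)%:P) by rewrite -shift_pev.
  have h m : balanced z a b (Q ^+ j.+1 / z ^+ m).
    have := @balanced_moments _ 1 da db j.+1 m spi hj; rewrite -zE rmorph1 mul1r; exact.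
  case: i => [[|n]|n].
  + by have := h 0%N; rewrite expr0z mul1r expr0 divr1.
  (* A positive power of [z] makes both values zero. *)
  + apply: small_bal; exists (z ^+ n * Q ^+ j.+1).
      apply: reg_sloc.
        by apply: (proj1 (regM _ _)); apply: (proj1 (regX _ _)) => //;
           case: (sloc_regs (sloc_z z_factor)).
      by apply: (proj1 (regM _ _)); apply: (proj1 (regX _ _)) => //;
           case: (sloc_regs (sloc_z z_factor)).
    by rewrite expr1 mulrA -exprS.
  by have := h n.+1; rewrite NegzE -exprnN mulrC.
- lia.
Qed.

Lemma balanced_ev2 (i : int) G : balanced z a b (z ^ i * ev2 P Q G).
Proof.
have bal0 : balanced z a b 0.
  by apply/(balanced_reg za zb); rewrite -?(rmorph0 fconst) ?fevalC //; exact: reg_const.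
have PE : P = z + fconst (feval P a) by rewrite /z /Pa0 subrK.
have balP k : forall (i' : int) j, balanced z a b (z ^ i' * P ^+ k * Q ^+ j).
  elim: k => [|k IH] i' j; first by rewrite expr0 mulr1; exact: balanced_pow.
  have -> : z ^ i' * P ^+ k.+1 * Q ^+ j = z ^ (i' + 1) * P ^+ k * Q ^+ j
      + fconst (feval P a) * (z ^ i' * P ^+ k * Q ^+ j).
    by rewrite exprS {1}PE expfzDr ?(ramified_neq0 za) // expr1z; ring.
  by apply: balancedD => //; exact: balancedZ.
rewrite ev2_sum mulr_sumr; apply: big_ind => //; first exact: balancedD.
move=> j _; rewrite -[G`_j]coefK poly_def rmorph_sum mulr_suml mulr_sumr.
apply: big_ind => //; first exact: balancedD.
move=> k _; rewrite -mul_polyC (rmorphM (pev P)) (rmorphXn (pev P)) /= pevC pevX.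
rewrite -mulrA mulrCA mulrA.
have -> : fconst G`_j`_k * z ^ i * (P ^+ k * Q ^+ j) =
  fconst G`_j`_k * (z ^ i * P ^+ k * Q ^+ j) by ring.
exact: balancedZ.
Qed.

(** The denominator [g2] may vanish at an endpoint. It is traded for [g2^da z^(-l)], a unit at [a]
    which, being balanced, takes the same nonzero value at [b]. *)
Theorem separation_same G1 G2 : ev2 P Q G2 != 0 ->
  reg a (ev2 P Q G1 / ev2 P Q G2) -> reg b (ev2 P Q G1 / ev2 P Q G2) ->
  feval (ev2 P Q G1 / ev2 P Q G2) a = feval (ev2 P Q G1 / ev2 P Q G2) b.
Proof.
set g2 := ev2 P Q G2; set U := _ / g2 => g20 rUa rUb.
have bal (k : int) n G : balanced z a b (ev2 P Q G * g2 ^+ n * z ^ (- k)).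
  by rewrite mulrC /g2 -rmorphXn -rmorphM; exact: balanced_ev2.
have bal1 k n : balanced z a b (g2 ^+ n * z ^ (- k)).
  by have := bal k n 1; rewrite rmorph1 mul1r.
have [da0 _ _ _] := za.
have [l [u [ru u0 e]]] := unit_order a g20.
have [l' [u' [ru' u0' e']]] := unit_order b g20.
have [t [rt t0 zt]] := ramified_unit_order za.
have [t' [rt' t0' zt']] := ramified_unit_order zb.
have qa k n := quot_order k n (conj rt t0) (conj ru u0) zt e.
have qb k n := quot_order k n (conj rt' t0') (conj ru' u0') zt' e'.
(* The orders [l] and [l'] are compared relative to those of [z]. If [g2] vanished more at [a], then
   [g2^db z^(- l')] would be balanced, zero at [a] and nonzero at [b]. *)
have [d0|d0] := leP 0 (l' * da - db%:Z * l); last first.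
  have [w [[rw w0] ew]] := qb l' db; have [x [[rx x0] ex]] := qa l' db.
  rewrite [l' * _]mulrC subrr expr0z mul1r in ew.
  have [r0 v0] : reg a (g2 ^+ db * z ^ (- l')) /\ feval (g2 ^+ db * z ^ (- l')) a = 0.
    apply/fil1_feval; apply: (@fil_le _ _ _ _ (l * db - da%:Z * l')).
      have -> : l * db - da%:Z * l' = - (l' * da - db%:Z * l) by ring.
      by rewrite -gtz0_ge1 oppr_gt0.
    by apply/filE; exists x.
  have rb : reg b (g2 ^+ db * z ^ (- l')) by rewrite ew.
  have h := (balanced_reg za zb r0 rb).1 (bal1 _ _).
  by case/eqP: w0; rewrite -ew -h v0.
have [w [[rw w0] ew]] := qa l da; have [x [[rx x0] ex]] := qb l da.
rewrite [l * _]mulrC subrr expr0z mul1r in ew.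
have ra : reg a (g2 ^+ da * z ^ (- l)) by rewrite ew.
have rb : reg b (g2 ^+ da * z ^ (- l)).
  by apply: fil0_reg; apply: (fil_le d0); apply/filE; exists x.
have v2 := (balanced_reg za zb ra rb).1 (bal1 _ _).
have [r1 e1] := regM rUa ra; have [r2 e2] := regM rUb rb.
have : feval (U * (g2 ^+ da * z ^ (- l))) a = feval (U * (g2 ^+ da * z ^ (- l))) b.
  apply/(balanced_reg za zb r1 r2).
  (* Since [da > 0], one factor [g2] cancels the denominator of [U], and a polynomial in [P], [Q]
     times [z^(-l)] remains. *)
  have -> : U * (g2 ^+ da * z ^ (- l)) = ev2 P Q G1 * g2 ^+ da.-1 * z ^ (- l).
    by rewrite -{1}(prednK da0) exprS !mulrA /U (divfK g20).
  exact: bal.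
rewrite e1 e2 v2; apply: mulIf; by rewrite -v2 ew.
Qed.

End SameValue.

Section DistinctValues.
Hypothesis PaPb : feval P a != feval P b.
Let pia := 'X - (feval P a)%:P.
Let pib := 'X - (feval P b)%:P.
Let z := pev P (pia * pib).

Let zE : z = Pa0 * Pb0. Proof. by rewrite /Pa0 /Pb0 !shift_pev -(rmorphM (pev P)). Qed.

Lemma other_unit x (c : C) : reg x P -> feval P x != c -> vunit x (P - fconst c).
Proof.
move=> rP Px; have [r e] := regB rP (reg_const K x c).
by split=> //; rewrite e fevalC subr_eq0.
Qed.

Lemma ramified_vunit x (e : nat) y u : ramified (fplace K x) e y -> vunit x u ->
  ramified (fplace K x) e (y * u).
Proof.
move=> ye vu; have [rv _] := vunitV vu; have [ru u0] := vu.
apply: ramified_mul => //; apply: contraNneq u0 => ->.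
by rewrite -(rmorph0 fconst) fevalC.
Qed.

Let za : ramified (fplace K a) da z.
Proof. by rewrite zE; apply: ramified_vunit ramified_a (other_unit Pa PaPb). Qed.

Let zb : ramified (fplace K b) db z.
Proof.
by rewrite zE mulrC; apply: ramified_vunit ramified_b (other_unit Pb _); rewrite eq_sym.
Qed.

Let A := ('X - a%:P) ^+ da.

Lemma z_factor_a : exists r s, [/\ coprimep r A, coprimep s A & z = (A * r)%:F / s%:F].
Proof.
have [r1 [r1a e1]] := order_factor a (nonconst_neq0 (@shift_nonconst (feval P a))).
have [rb vb] := other_unit Pa PaPb.
have coA q : q.[a] != 0 -> coprimep q A.
  by move=> qa; rewrite coprimep_expr // coprimep_XsubC rootE.
have ra : reg a Pa0 by have [] := regB Pa (reg_const K a (feval P a)).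
have sa : (fden Pa0).[a] != 0 by move: ra; rewrite /reg /fpole rootE.
have sb : (fden Pb0).[a] != 0 by move: rb; rewrite /reg /fpole rootE.
have nb : (fnum Pb0).[a] != 0.
  by apply: contraNneq vb => h; rewrite /feval h mul0r.
exists (r1 * fnum Pb0), (fden Pa0 * fden Pb0); split; try by apply: coA; rewrite hornerM mulf_neq0.
rewrite zE {1}(fracE Pa0) {1}(fracE Pb0) mulf_frac mulrA.
by rewrite -[fnum _]/(fnum (P - fconst (feval P a))) e1.
Qed.

(** The functions [z^i rho Q^j] vanish at [b], so balance forces their constant coefficient at [a]
    to be zero. With [l] the order of [Q] at [a], however, [z^(-l) rho Q^da] is a unit at [a]. *)
Theorem separation_distinct : False.
Proof.
have z0 := ramified_neq0 za; have [da0 _ _ _] := za; have [db0 _ _ _] := zb.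
have [l [u [ru u0 e]]] := unit_order a Q0.
have [t [rt t0 zt]] := ramified_unit_order za.
have hL : l <= (absz l)%:Z by clear; lia.
pose L := absz l; pose rho := Pb0 ^+ L.+1.
have [w [[rw w0] ew]] := quot_order l da (conj rt t0) (conj ru u0) zt e.
rewrite [l * _]mulrC subrr expr0z mul1r in ew.
have vb := other_unit Pa PaPb.
have [rrho rho0] : vunit a rho by exact: vunitX.
have sA : size A = da.+1 by rewrite size_exp_XsubC.
have D0 : (1 < size A)%N by rewrite sA.
have slocP y : sloc A y <-> reg a y.
  split=> [[p [q [qA ->]]]|].
    by move: qA; rewrite coprimep_pexpr // coprimep_XsubC => qa; apply: reg_frac.
  rewrite /reg /fpole => ry; exists (fnum y), (fden y); split; last exact: fracE.
  by rewrite coprimep_expr // coprimep_XsubC.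
have rbP : reg b Pb0 by have [] := regB Pb (reg_const K b (feval P b)).
have h : null z a (z ^ (- l) * rho * Q ^+ da).
  apply: (cayley_propagate D0 z_factor_a (L := L) (j0 := 1)) => //.
  - exact: nullD.
  - exact: nullZ.
  - move=> f [y /slocP ry ->]; rewrite expr1.
    have [rz ez] : reg a z /\ feval z a = 0.
      by apply/fil1_feval; have [_ _ fz _] := za; apply: fil_le fz; rewrite lez_nat.
    by have [r1 e1] := regM rz ry; apply/(null_reg za r1); rewrite e1 ez mul0r.
  - exact/slocP.
  - exact/slocP.
  - move=> i j Li; rewrite sA /= => hj.
    have fb : fil (fplace K b) 1 (z ^ i * rho * Q ^+ j).
      apply: (@fil_le _ _ _ _ (1 + 0)) => //; apply: filM;
        last by apply/fil_vring; apply: (proj1 (regX j Qb)).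
      have fz : fil (fplace K b) (db%:Z * i) (z ^ i).
        have [t' [rt' t0' zt']] := ramified_unit_order zb.
        have [rti _] := vunitXz i (conj rt' t0').
        by apply/filE; exists (t' ^ i) => //; rewrite {1}zt' expfzMl exprz_exp.
      have fr k : fil (fplace K b) (db%:Z * k%:Z) (Pb0 ^+ k).
        elim: k => [|k IH]; first by rewrite expr0 mulr0; apply/fil_vring; exact: vring1.
        by have [_ _ fP _] := ramified_b; rewrite exprS intS mulrDr mulr1; apply: filM.
      apply: fil_le (filM fz (fr L.+1)); rewrite -mulrDr.
      have iL : 1 <= i + L.+1%:Z by move: Li; clear; lia.
      have db1 : 1 <= db%:Z by rewrite lez_nat.
      by rewrite -[X in X <= _]mulr1; apply: ler_pM.
    have [rb0 vb0] := (fil1_feval b _).1 fb.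
    apply: (balanced_null zb _ rb0 vb0).
    have spi : (1 < size (pia * pib)%R)%N by rewrite size_mul ?polyXsubC_eq0 // !size_XsubC.
    have hj' : (1 <= j <= da + db - 1)%N by move: hj db0; clear; lia.
    have bm p m := @balanced_moments (pia * pib) p da db j m spi hj' za zb.
    have [n [iE|iE]] : exists n : nat, i = n \/ i = - n%:Z.
      by exists (absz i); clear; lia.
    + have := bm (pib ^+ L.+1 * (pia * pib) ^+ n) 0%N.
      rewrite -/z expr0 divr1 (rmorphM (pev P)) !(rmorphXn (pev P)) /= -/z -/pib -shift_pev.
      by rewrite -/Pb0 -/rho [rho * _]mulrC iE exprnP.
    have := bm (pib ^+ L.+1) n.
    rewrite (rmorphXn (pev P)) /= -/z -shift_pev -/Pb0 -/rho iE -invr_expz -exprnP.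
    by rewrite mulrAC [rho / _]mulrC.
  by rewrite lerN2; exact: hL.
have e1 : z ^ (- l) * rho * Q ^+ da = w * rho by rewrite -ew mulrAC [z ^ _ * _]mulrC.
have [r1 v1] := regM rw rrho.
move: h; rewrite e1 => /(null_reg za r1)/eqP; rewrite v1 mulf_eq0 (negPf w0) (negPf rho0).
by [].
Qed.

End DistinctValues.
End Separation.

(** * Lüroth's theorem *)

Section SubfieldPolynomials.
Variables (K : fieldType) (S : K -> Prop).
Hypotheses (S1 : S 1) (SB : forall x y, S x -> S y -> S (x - y)).
Hypotheses (SM : forall x y, S x -> S y -> S (x * y)) (SV : forall x, S x -> S x^-1).
Implicit Types (p q r : {poly K}).

Definition over p := forall i, S p`_i.

Lemma S0 : S 0. Proof. by rewrite -(subrr 1); exact: SB. Qed.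

Lemma SD x y : S x -> S y -> S (x + y).
Proof. by move=> Sx Sy; rewrite -[y]opprK -[- y]sub0r; do !apply: SB => //; exact: S0. Qed.

Lemma over_divides p q : q \is monic -> over p -> over q ->
  exists u r, [/\ p = u * q + r, over r & (size r < size q)%N].
Proof.
move=> qm; have q0 : q != 0 by exact: monic_neq0.
elim: (size p) {-2}p (leqnn (size p)) => [|n IH] {}p sp op oq.
  exists 0, p; split; rewrite ?mul0r ?add0r //.
  by apply: leq_ltn_trans sp _; rewrite size_poly_gt0.
have [pq|qp] := ltnP (size p) (size q).
  by exists 0, p; rewrite mul0r add0r.
pose k := (size p - size q)%N; pose p' := p - lead_coef p *: ('X^k * q).
have p0 : p != 0 by rewrite -size_poly_gt0; apply: leq_trans qp; rewrite size_poly_gt0.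
have q1 : (0 < size q)%N by rewrite size_poly_gt0.
have kE : (k + size q = size p)%N by rewrite subnK.
have sp' : (size p' <= n)%N.
  apply/leq_sizeP => i ni; rewrite /p' coefB coefZ coefXnM.
  have -> : (i < k)%N = false.
    apply/negbTE; rewrite -leqNgt -ltnS; apply: leq_trans (_ : n.+1 <= _)%N; last by rewrite ltnS.
    by apply: leq_trans sp; rewrite -kE -addn1 leq_add2l.
  have [ip|ip] := ltnP (size p).-1 i.
    have iq : (size q <= i - k)%N.
      rewrite leq_subRL; first by rewrite kE -(prednK (n := size p)) // size_poly_gt0.
      by apply: leq_trans (ltnW ip); rewrite -kE -(prednK q1) addnS leq_addr.
    rewrite (nth_default _ iq) nth_default ?mulr0 ?subr0 //.
    by rewrite -(prednK (n := size p)) // size_poly_gt0.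
  have -> : i = (size p).-1.
    apply/eqP; rewrite eqn_leq ip andTb; apply: leq_trans ni.
    by rewrite -ltnS prednK ?size_poly_gt0.
  have -> : ((size p).-1 - k)%N = (size q).-1.
    by rewrite -kE -(prednK q1) addnS /= addnC addnK.
  by rewrite -!lead_coefE (monicP qm) mulr1 subrr.
have op' : over p'.
  move=> i; rewrite /p' coefB coefZ coefXnM; apply: SB => //; apply: SM; first exact: op.
  by case: ifP => _ //; exact: S0.
have [u [r [e or sr]]] := IH p' sp' op' oq.
exists (u + lead_coef p *: 'X^k), r; split=> //.
by rewrite mulrDl -scalerAl addrAC -e subrK.
Qed.

Lemma over_minimal x p : p != 0 -> over p -> p.[x] = 0 ->
  exists q, [/\ q \is monic, over q, q.[x] = 0 &
    forall r, over r -> r.[x] = 0 -> exists u, r = u * q].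
Proof.
move=> p0 op px.
pose T n := `[< exists q, [/\ q != 0, over q, q.[x] = 0 & size q = n] >].
have exT : exists n, T n by exists (size p); apply/asboolP; exists p.
case: (ex_minnP exT) => n /asboolP [q0 [q00 oq0 q0x sq0]] nmin.
have l0 : lead_coef q0 != 0 by rewrite lead_coef_eq0.
pose q := (lead_coef q0)^-1 *: q0.
have qm : q \is monic by rewrite monicE lead_coefZ mulVf.
have oq : over q by move=> i; rewrite coefZ; apply: SM => //; apply: SV; exact: oq0.
have qx : q.[x] = 0 by rewrite hornerZ q0x mulr0.
exists q; split=> // r or rx.
have [u [t [e ot st]]] := over_divides qm or oq.
have [t0|t0] := eqVneq t 0; first by exists u; rewrite e t0 addr0.
have : (n <= size t)%N.
  apply: nmin; apply/asboolP; exists t; split=> //.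
  by move: rx; rewrite e hornerD hornerM qx mulr0 add0r.
by rewrite leqNgt -sq0 -(size_scale q0 (_ : (lead_coef q0)^-1 != 0)) ?invr_eq0 // st.
Qed.

End SubfieldPolynomials.

Local Notation const_of := fconst.

Lemma swapXY_mulB (R : comNzRingType) (u1 u2 v1 v2 : {poly {poly R}}) :
  swapXY (u1 * u2 - v1 * v2) = swapXY u1 * swapXY u2 - swapXY v1 * swapXY v2.
Proof. by rewrite (raddfB (@swapXY R)) /= !(rmorphM (@swapXY R)). Qed.

Section Gauss.
Variable C : closedFieldType.
Implicit Types (G H E : {poly {poly C}}) (e : {poly C}).

(* Gauss' lemma over an algebraically closed field: a polynomial in [T] with
   coefficients in [C[x]] is primitive if no [x - a] divides it. *)
Lemma gauss_primitive G H E e : (forall a : C, map_poly (horner_eval a) G != 0) ->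
  e != 0 -> e *: H = E * G -> exists E', H = E' * G.
Proof.
move=> prim; elim: (size e) {-2}e (leqnn (size e)) E => [|n IH] {}e se E e0 eH.
  by move: se; rewrite leqn0 size_poly_eq0 (negPf e0).
have [/eqP/size_poly1P [c c0 ec]|s1] := eqVneq (size e) 1%N.
  exists (c^-1%:P *: E); rewrite -scalerAl -eH scalerA ec -polyCM mulVf //.
  by rewrite scale1r.
have /closed_rootP [a /factor_theorem [e' ee']] := s1.
have e'0 : e' != 0 by apply: contraNneq e0 => h; rewrite ee' h mul0r.
have Ea : map_poly (horner_eval a) E = 0.
  have := congr1 (map_poly (horner_eval a)) eH.
  rewrite rmorphM /= map_polyZ /= /horner_eval ee' hornerM hornerXsubC subrr mulr0 scale0r.
  by move=> /esym/eqP; rewrite mulf_eq0 (negPf (prim a)) orbF => /eqP.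
pose E' := map_poly (fun p : {poly C} => p %/ ('X - a%:P)) E.
have EE' : E = ('X - a%:P) *: E'.
  apply/polyP => i; rewrite coefZ coef_map_id0 ?div0p // mulrC divpK //.
  rewrite dvdp_XsubCl rootE; have := congr1 (fun p : {poly C} => p`_i) Ea.
  by rewrite coef_map coef0 /= /horner_eval => ->.
apply: (IH e' _ E' e'0).
  by move: se; rewrite ee' size_Mmonic ?monicXsubC // size_XsubC addn2.
have xa0 : ('X - a%:P)%:P != 0 :> {poly {poly C}} by rewrite polyC_eq0 polyXsubC_eq0.
by apply: (mulfI xa0); rewrite !mul_polyC scalerA mulrC -ee' eH {1}EE' scalerAl.
Qed.

End Gauss.

Section Luroth.
Variables (C : closedFieldType) (K : funField C).
Local Notation "p %:F" := (emb K p) (format "p %:F").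
Local Notation fconst := (@fconst C K).
Local Notation X := ('X%:F : K).
Implicit Types (P Q W w : K).

Definition cst (p : {poly C}) : {poly K} := map_poly fconst p.

Lemma pevE w p : pev w p = (cst p).[w]. Proof. by []. Qed.

(* The polynomial in [T] whose roots are the solutions of [w(T) = w(x)]. *)
Definition fibre w : {poly K} := cst (fnum w) - w *: cst (fden w).

Lemma fibre_root w : (fibre w).[X] = 0.
Proof.
rewrite /fibre hornerD hornerN hornerZ -!pevE !pev_id {2}(fracE w) divfK ?subrr //.
by rewrite emb_eq0 fden_neq0.
Qed.

Lemma fibre_neq0 w : nonconst w -> fibre w != 0.
Proof.
move=> wn; apply/eqP => h.
have l0 : lead_coef (fden w) != 0 by rewrite lead_coef_eq0 fden_neq0.
have := congr1 (fun p : {poly K} => p`_((size (fden w)).-1)) h.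
rewrite coef0 coefB coefZ !coef_map -lead_coefE /= => /eqP.
rewrite subr_eq0 => /eqP e.
apply: (@wn ((fnum w)`_(size (fden w)).-1 / lead_coef (fden w))).
by rewrite fmorph_div /= e mulfK // fmorph_eq0.
Qed.

Lemma const_of_proportional w (c d : C) : (c != 0) || (d != 0) ->
  c *: fnum w = d *: fden w -> exists k, w = fconst k.
Proof.
move=> cd e; have B0 := fden_neq0 w.
have c0 : c != 0.
  case/orP: cd => // d0; apply: contra_eq_neq e => ->; rewrite scale0r eq_sym.
  by rewrite scaler_eq0 negb_or d0.
exists (c^-1 * d); rewrite (fracE w).
have -> : fnum w = (c^-1 * d) *: fden w by rewrite -scalerA -e scalerA mulVf ?scale1r.
by rewrite -mul_polyC rmorphM mulfK // emb_eq0 fden_neq0.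
Qed.

Section Generator.
Variable S : K -> Prop.
Hypotheses (S1 : S 1) (SB : forall x y, S x -> S y -> S (x - y)).
Hypotheses (SM : forall x y, S x -> S y -> S (x * y)) (SV : forall x, S x -> S x^-1).
Hypothesis SC : forall c, S (fconst c).

Lemma over_cst p : over S (cst p).
Proof. by move=> i; rewrite coef_map; exact: SC. Qed.

Lemma over_fibre w : S w -> over S (fibre w).
Proof.
move=> Sw i; rewrite coefB coefZ; apply: SB; first exact: over_cst.
by apply: SM => //; exact: over_cst.
Qed.

Variable P : K.
Hypotheses (SP : S P) (Pnc : nonconst P).

Lemma common_denominator (p : {poly K}) : exists e (G : {poly {poly C}}),
  e != 0 /\ e%:F *: p = map_poly (emb K) G.
Proof.
elim/poly_ind: p => [|p c [e [G [e0 eG]]]].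
  by exists 1, 0; rewrite oner_neq0 scaler0 rmorph0.
exists (e * fden c), (fden c *: G * 'X + (e * fnum c)%:P); split.
  by rewrite mulf_neq0 // fden_neq0.
have f0 : (fden c)%:F != 0 :> K by rewrite emb_eq0 fden_neq0.
rewrite (rmorphD (map_poly (emb K))) (rmorphM (map_poly (emb K))) /=.
rewrite map_polyZ map_polyX map_polyC /= -eG scalerDr; congr (_ + _).
  by rewrite -!scalerAl scalerA -rmorphM [fden c * e]mulrC.
rewrite -mul_polyC -polyCM; congr (_%:P); rewrite {2}(fracE c) !rmorphM /=.
by field.
Qed.

Lemma primitive_form (p : {poly K}) : p \is monic -> exists e (G : {poly {poly C}}),
  [/\ e != 0, e%:F *: p = map_poly (emb K) G &
      forall a : C, map_poly (horner_eval a) G != 0].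
Proof.
move=> pm; pose T n := `[< exists e (G : {poly {poly C}}),
  [/\ e != 0, e%:F *: p = map_poly (emb K) G & size e = n] >].
have exT : exists n, T n.
  have [e [G [e0 eG]]] := common_denominator p.
  by exists (size e); apply/asboolP; exists e, G.
case: (ex_minnP exT) => n /asboolP [e [G [e0 eG se]]] nmin.
exists e, G; split=> // a; apply/eqP => Ga.
have dv i : 'X - a%:P %| G`_i.
  rewrite dvdp_XsubCl rootE; have := congr1 (fun p : {poly C} => p`_i) Ga.
  by rewrite coef_map coef0 /= /horner_eval => ->.
have lG : G`_(size p).-1 = e.
  apply: (@emb_inj _ K); have := congr1 (fun p : {poly K} => p`_(size p).-1) eG.
  move=> _; rewrite -coef_map -eG coefZ -lead_coefE (monicP pm) mulr1 //.
have /dvdpP [e' ee'] : 'X - a%:P %| e by rewrite -lG.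
have e'0 : e' != 0 by apply: contraNneq e0 => h; rewrite ee' h mul0r.
pose G' := map_poly (fun q : {poly C} => q %/ ('X - a%:P)) G.
have : (n <= size e')%N.
  apply: nmin; apply/asboolP; exists e', G'; split=> //.
  have x0 : ('X - a%:P)%:F != 0 :> K by rewrite emb_eq0 polyXsubC_eq0.
  apply: (scalerI x0); rewrite scalerA -rmorphM mulrC -ee' eG.
  apply/polyP => i; rewrite coefZ !coef_map -rmorphM; congr (emb K _).
  by rewrite coef_map_id0 ?div0p // mulrC divpK.
by rewrite -se ee' size_Mmonic ?monicXsubC // size_XsubC addn2 /= ltnn.
Qed.


Definition fibreXY W : {poly {poly C}} :=
  map_poly polyC (fnum W) * (fden W)%:P - map_poly polyC (fden W) * (fnum W)%:P.

Lemma map_fibreXY W : map_poly (emb K) (fibreXY W) = (fden W)%:F *: fibre W.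
Proof.
have f0 : (fden W)%:F != 0 :> K by rewrite emb_eq0 fden_neq0.
have cE p : map_poly (emb K) (map_poly polyC p) = cst p by rewrite -map_poly_comp.
rewrite (rmorphB (map_poly (emb K))) !(rmorphM (map_poly (emb K))) /= !cE !map_polyC /=.
rewrite /fibre scalerBr scalerA; congr (_ - _); rewrite mulrC mul_polyC //.
by congr (_ *: _); rewrite {3}(fracE W) mulrC divfK.
Qed.

Lemma map_emb_inj : injective (map_poly (emb K)).
Proof. by apply: map_inj_poly; [exact: emb_inj|rewrite rmorph0]. Qed.

(* If a primitive multiple [G] of a polynomial divides that of [fibre W],
   where [W] is a coefficient of [G / e], then they agree up to a constant. *)
Lemma fibre_rigid W e (G E : {poly {poly C}}) i k : nonconst W -> e != 0 ->
  fibreXY W = E * G -> G`_k = e -> W = (G`_i)%:F / e%:F ->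
  exists c : C, fibreXY W = c%:P%:P * G.
Proof.
move=> Wn e0 HE Gk WE; have B0 := fden_neq0 W.
have W0 : W != 0 by apply: contra_notN (@Wn 0) => /eqP ->; rewrite rmorph0.
have A0 : fnum W != 0 by apply: contraNneq W0 => h; rewrite (fracE W) h rmorph0 mul0r.
have H0 : fibreXY W != 0.
  apply/eqP => h; have := map_fibreXY W; rewrite h rmorph0 => /esym/eqP.
  by rewrite scaler_eq0 emb_eq0 (negPf B0) (negPf (fibre_neq0 Wn)).
have G0 : G != 0 by apply: contra_neq H0 => h; rewrite HE h mulr0.
have E0 : E != 0 by apply: contra_neq H0 => h; rewrite HE h mul0r.
pose D := maxn (size (fnum W)) (size (fden W)).
have Gi0 : G`_i != 0 by apply: contraNneq W0 => h; rewrite WE h rmorph0 mul0r.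
have cross : fnum W * e = G`_i * fden W.
  by apply/(@frac_eq _ K _ _ _ _ B0 e0); rewrite -fracE.
have DG : (D <= sizeY G)%N.
  rewrite geq_max; apply/andP; split.
    apply: leq_trans (max_size_coefXY G i); apply: dvdp_leq => //.
    by rewrite -(Gauss_dvdpl _ (fcoprime W)) -cross dvdp_mulr.
  apply: leq_trans (max_size_coefXY G k); rewrite Gk; apply: dvdp_leq => //.
  have cop : coprimep (fden W) (fnum W) by rewrite coprimep_sym fcoprime.
  by rewrite -(Gauss_dvdpr _ cop) cross dvdp_mull.
have HD : (sizeY (fibreXY W) <= D)%N.
  rewrite sizeYE /fibreXY swapXY_mulB.
  rewrite (swapXY_map_polyC (fnum W)) (swapXY_map_polyC (fden W)).
  rewrite (swapXY_polyC (fden W)) (swapXY_polyC (fnum W)).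
  apply: leq_trans (size_polyD _ _) _; rewrite size_polyN geq_max /D.
  apply/andP; split; apply: leq_trans (size_polyMleq _ _) _;
   rewrite size_polyC ?A0 ?B0 /=;
   apply: leq_trans (size_poly _ _) _; rewrite ?leq_maxr ?leq_maxl //.
have sE : (size (swapXY E) <= 1)%N.
  have := HD; rewrite sizeYE HE rmorphM /= size_mul ?swapXY_eq0 // -!sizeYE => h.
  have key (x y z : nat) : ((x + y).-1 <= z -> z <= y -> x <= 1 \/ y = 0)%N by clear; lia.
  have [//|/eqP] := key _ _ _ h DG; by rewrite sizeY_eq0 (negPf G0).
have EC : E = map_poly polyC (swapXY E)`_0.
  by rewrite -[LHS]swapXYK {1}(size1_polyC sE) swapXY_polyC.
set c := (swapXY E)`_0 in EC.
have [sc|sc] := leqP (size c) 1.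
  by exists c`_0; rewrite HE EC {1}(size1_polyC sc) map_polyC.
have /closed_rootP [t ct] : size c != 1%N by rewrite gtn_eqF.
have /const_of_proportional : (fden W).[t] *: fnum W = (fnum W).[t] *: fden W.
  have := congr1 (fun p : {poly {poly C}} => p.[t%:P]) HE.
  rewrite EC /fibreXY !hornerE !horner_map /= (rootP ct) mul0r => /eqP.
  by rewrite subr_eq0 -!mul_polyC => /eqP ->.
case=> [|x Wx]; last by case: (Wn x).
apply/negPn; rewrite negb_or !negbK; apply/negP => /andP [/eqP bt /eqP at0].
have := coprimep_root (fcoprime W) (x := t); rewrite rootE at0 bt eqxx => /(_ isT).
by [].
Qed.

Theorem luroth : exists W, [/\ nonconst W, S W &
  forall R, S R -> exists f, R = fcomp f W].
Proof.
have [Phi [Pm oPhi Phix Pmin]] :=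
  over_minimal S1 SB SM SV (fibre_neq0 Pnc) (over_fibre SP) (fibre_root P).
have [e [G [e0 eG Gprim]]] := primitive_form Pm.
have Phi0 := monic_neq0 Pm.
have [i Wn] : exists i, nonconst Phi`_i.
  apply/not_existsP => h; case/eqP: Phi0.
  have /(_ _)/cid-/all_sig [c cE] : forall i, exists c, Phi`_i = fconst c.
    move=> i; apply: contra_notP (h i) => nc c; apply/eqP.
    by apply: contra_notN nc => /eqP ->; exists c.
  have PE : Phi = cst (\poly_(i < size Phi) c i).
    apply/polyP => k; rewrite coef_map coef_poly; case: ltnP => ks; first exact: cE.
    by rewrite nth_default // raddf0.
  move: Phix; rewrite PE -pevE pev_id => /eqP; rewrite emb_eq0 => /eqP ->.
  exact: raddf0.
pose W := Phi`_i; exists W; split=> //; first exact: oPhi.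
have Gj j : (G`_j)%:F = e%:F * Phi`_j.
  by have := congr1 (fun p : {poly K} => p`_j) eG; rewrite coefZ coef_map.
have eF0 : e%:F != 0 :> K by rewrite emb_eq0.
have WE : W = (G`_i)%:F / e%:F by rewrite Gj mulrAC (divff eF0) mul1r.
have Ge : G`_(size Phi).-1 = e.
  by apply: (@emb_inj _ K); rewrite Gj -lead_coefE (monicP Pm) mulr1.
have [u fu] := Pmin _ (over_fibre (oPhi i)) (fibre_root _).
have [d [U [d0 dU]]] := common_denominator u.
have [E HE] : exists E, fibreXY W = E * G.
  apply: (gauss_primitive (e := d * e) (E := fden W *: U) Gprim); first by rewrite mulf_neq0.
  apply: map_emb_inj; rewrite (rmorphM (map_poly (emb K))) /= !map_polyZ map_fibreXY fu -dU -eG /=.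
  rewrite rmorphM.
  rewrite -!scalerAl -!scalerAr !scalerA; congr (_ *: _); ring.
have [c Hc] := fibre_rigid Wn e0 HE Ge WE.
have BF0 : (fden W)%:F != 0 :> K by rewrite emb_eq0 fden_neq0.
have fibE : fibre W = (fconst c * e%:F / (fden W)%:F) *: Phi.
  apply: (scalerI BF0); rewrite -map_fibreXY Hc rmorphM /= !map_polyC /= -eG.
  rewrite mul_polyC !scalerA; congr (_ *: _); rewrite /const_of; field; exact: BF0.
pose SW x := exists f, x = compr Wn f.
have SWC x : SW (fconst x) by exists (fconst x); rewrite comprC.
have SWB x y : SW x -> SW y -> SW (x - y).
  by move=> [f ->] [g ->]; exists (f - g); rewrite (rmorphB (compr Wn)).
have SWM x y : SW x -> SW y -> SW (x * y).
  by move=> [f ->] [g ->]; exists (f * g); rewrite (rmorphM (compr Wn)).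
have SWV x : SW x -> SW x^-1.
  by move=> [f ->]; exists f^-1; rewrite fmorphV.
have SW1 : SW 1 by rewrite -(rmorph1 fconst); exact: SWC.
have SWW : SW W by exists X; rewrite compr_poly pevX.
have oW : over SW Phi.
  pose k := fconst c * e%:F / (fden W)%:F.
  have k0 : k != 0.
    apply: contraTneq (fibre_neq0 Wn) => h; by rewrite fibE -/k h scale0r eqxx.
  have kS : SW k.
    have -> : k = (fibre W)`_(size Phi).-1 by rewrite fibE coefZ -lead_coefE (monicP Pm) mulr1.
    by rewrite coefB coefZ !coef_map; apply: (SWB); [exact: SWC|apply: (SWM) => //; exact: SWC].
  move=> j; have -> : Phi`_j = k^-1 * (fibre W)`_j by rewrite fibE coefZ mulKf.
  apply: (SWM); first exact: SWV.
  by rewrite coefB coefZ !coef_map; apply: (SWB); [exact: SWC|apply: (SWM) => //; exact: SWC].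
move=> R SR; have [v fv] := Pmin _ (over_fibre SR) (fibre_root _).
have oc p : over SW (cst p) by move=> j; rewrite coef_map; exact: SWC.
have [u1 [r1 [e1 o1 s1]]] := over_divides SW1 SWB SWM Pm (oc (fnum R)) oW.
have [u2 [r2 [e2 o2 s2]]] := over_divides SW1 SWB SWM Pm (oc (fden R)) oW.
have rE : r1 - R *: r2 = (v - u1 + R *: u2) * Phi.
  have h : cst (fnum R) - R *: cst (fden R) = v * Phi by rewrite -fv.
  have -> : r1 = cst (fnum R) - u1 * Phi by rewrite e1 addrC addKr.
  have -> : r2 = cst (fden R) - u2 * Phi by rewrite e2 addrC addKr.
  by rewrite mulrDl mulrBl -h scalerBr -scalerAl; ring.
have r0 : r1 = R *: r2.
  apply/eqP; rewrite -subr_eq0; apply/negPn/negP => rn0.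
  have : (size (r1 - R *: r2)%R < size Phi)%N.
    apply: leq_ltn_trans (size_polyD _ _) _; rewrite size_polyN gtn_max s1.
    by apply: leq_ltn_trans (size_scale_leq _ _) s2.
  by apply/negP; rewrite -leqNgt dvdp_leq // rE dvdp_mull.
have [r20|/eqP] := eqVneq r2 0.
  have [[x y] /= xy] := Bezout_eq1_coprimepP _ _ (fcoprime R).
  have : cst x * cst (fnum R) + cst y * cst (fden R) = 1.
    by rewrite /cst -!rmorphM -rmorphD xy rmorph1.
  rewrite e1 e2 r0 r20 scaler0 !addr0 !mulrA -mulrDl => /(congr1 (fun p : {poly K} => p.[X])).
  by rewrite hornerM Phix mulr0 hornerC => /esym/eqP; rewrite oner_eq0.
move=> r2n; have [k r2k] : exists k, r2`_k != 0.
  apply/not_existsP => h; apply: r2n; apply/polyP => k; rewrite coef0.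
  by apply/eqP/negPn/negP; exact: h.
have [f fE] : SW R.
  have -> : R = r1`_k * (r2`_k)^-1 by rewrite r0 coefZ mulfK.
  by apply: (SWM); [exact: o1|apply: (SWV); exact: o2].
by exists f.
Qed.

End Generator.
End Luroth.

Section Decomposition.
Variables (C : numClosedFieldType) (K : funField C).
Local Notation fconst := (@fconst C K).
Implicit Types (w S : K) (h : {poly C}).
Variables (P Q : K) (a b : C).
Hypotheses (Pnc : nonconst P) (ab : a != b) (Q0 : Q != 0).
Hypotheses (Pa : reg a P) (Pb : reg b P) (Qa : reg a Q) (Qb : reg b Q).
Hypothesis moments : forall j h S,
  (1 <= j <= order a (P - fconst (feval P a)) + order b (P - fconst (feval P b)) - 1)%N ->
  fderiv S = pev P h * Q ^+ j * fderiv P -> reg a S -> reg b S -> feval S a = feval S b.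

Definition genfield x := exists G1 G2, ev2 P Q G2 != 0 /\ x = ev2 P Q G1 / ev2 P Q G2.

Lemma genfield_ev2 G : genfield (ev2 P Q G).
Proof. by exists G, 1; rewrite !rmorph1 oner_neq0 divr1. Qed.

Lemma genfieldB x y : genfield x -> genfield y -> genfield (x - y).
Proof.
move=> [G1 [G2 [G20 ->]]] [H1 [H2 [H20 ->]]].
exists (G1 * H2 - H1 * G2), (G2 * H2).
rewrite ev2B !ev2M mulf_neq0 //; split=> //.
by field; rewrite G20 H20.
Qed.

Lemma genfieldM x y : genfield x -> genfield y -> genfield (x * y).
Proof.
move=> [G1 [G2 [G20 ->]]] [H1 [H2 [H20 ->]]]; exists (G1 * H1), (G2 * H2).
by rewrite !ev2M mulf_neq0 // mulf_div.
Qed.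

Lemma genfieldV x : genfield x -> genfield x^-1.
Proof.
move=> [G1 [G2 [G20 ->]]]; have [G10|G10] := eqVneq (ev2 P Q G1) 0.
  by rewrite G10 mul0r invr0 -(rmorph0 (ev2 P Q)); exact: genfield_ev2.
by exists G2, G1; rewrite invf_div.
Qed.

Lemma ev2_const c : ev2 P Q c%:P%:P = fconst c.
Proof. by rewrite /ev2 map_polyC hornerC /= pevC. Qed.

Lemma ev2_P : ev2 P Q 'X%:P = P.
Proof. by rewrite /ev2 map_polyC hornerC /= pevX. Qed.

Lemma ev2_Q : ev2 P Q 'X = Q.
Proof. by rewrite /ev2 map_polyX hornerX. Qed.

Lemma separation w : genfield w -> reg a w -> reg b w -> feval w a = feval w b.
Proof.
have [PaPb|PaPb] := eqVneq (feval P a) (feval P b); last first.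
  by case: (separation_distinct Pnc Q0 Pa Pb Qa Qb moments PaPb).
move=> [G1 [G2 [G20 ->]]]; exact: (separation_same Pnc ab Q0 Pa Pb Qa Qb moments PaPb).
Qed.

Lemma separation_pole w : genfield w -> ~~ fpole w a -> fpole w b -> False.
Proof.
move=> gw ra pb; have [c wc] : exists c, feval w a - c != 0.
  by exists (feval w a - 1); rewrite subKr oner_neq0.
pose y := (w - fconst c)^-1.
have gy : genfield y.
  by apply: genfieldV; apply: genfieldB => //; rewrite -ev2_const; exact: genfield_ev2.
have [r1 e1] := regB ra (reg_const K a c); rewrite fevalC in e1.
have [rya eya] : reg a y /\ feval y a = (feval w a - c)^-1.
  by rewrite -e1; apply: regV => //; rewrite e1.
have d0 := fden_neq0 w.
have nb : (fnum w - c%:P * fden w).[b] != 0.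
  have := fcoprime w; rewrite coprimep_sym => /coprimep_root /(_ pb) nb.
  by rewrite !hornerE (rootP pb) mulr0 subr0.
have yE : y = emb K (fden w) / emb K (fnum w - c%:P * fden w).
  rewrite /y {1}(fracE w) rmorphB rmorphM -[RHS]invf_div; congr (_^-1).
  by rewrite mulrBl mulfK // emb_eq0.
have ryb : reg b y by rewrite yE; exact: reg_frac.
have eyb : feval y b = 0 by rewrite yE feval_frac // (rootP pb) mul0r.
have := separation gy rya ryb; rewrite eya eyb => /eqP.
by rewrite invr_eq0 (negPf wc).
Qed.

End Decomposition.

Section Main.
Variables (C : numClosedFieldType) (K : funField C).
Local Notation fconst := (@fconst C K).

Theorem decomposition (P Q : K) (a b : C) : nonconst P -> a != b -> Q != 0 ->
  reg a P -> reg b P -> reg a Q -> reg b Q ->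
  (forall j (h : {poly C}) (S : K),
    (1 <= j <= order a (P - fconst (feval P a)) + order b (P - fconst (feval P b)) - 1)%N ->
    fderiv S = pev P h * Q ^+ j * fderiv P -> reg a S -> reg b S ->
    feval S a = feval S b) ->
  exists Pt Qt W : K, [/\ P = fcomp Pt W, Q = fcomp Qt W &
    (if fpole W a then None else Some (feval W a)) =
    (if fpole W b then None else Some (feval W b))].
Proof.
move=> Pnc ab Q0 Pa Pb Qa Qb mom.
have mom' : forall j (h : {poly C}) (S : K),
    (1 <= j <= order b (P - fconst (feval P b)) + order a (P - fconst (feval P a)) - 1)%N ->
    fderiv S = pev P h * Q ^+ j * fderiv P -> reg b S -> reg a S ->
    feval S b = feval S a.
  by move=> j h S; rewrite addnC => hj dS rb ra; rewrite (mom j h S).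
have gB := @genfieldB C K P Q; have gM := @genfieldM C K P Q; have gV := @genfieldV C K P Q.
have g1 : genfield P Q 1 by rewrite -(rmorph1 (ev2 P Q)); exact: genfield_ev2.
have gC c : genfield P Q (fconst c) by rewrite -(ev2_const P Q); exact: genfield_ev2.
have gP : genfield P Q P by rewrite -{2}(ev2_P P Q); exact: genfield_ev2.
have gQ : genfield P Q Q by rewrite -{2}(ev2_Q P Q); exact: genfield_ev2.
have [W [Wn gW lW]] := luroth g1 gB gM gV gC gP Pnc.
have [[Pt PE] [Qt QE]] := (lW _ gP, lW _ gQ).
exists Pt, Qt, W; split=> //.
have ba : b != a by rewrite eq_sym.
case: ifP => [pa|/negbT pa]; case: ifP => [pb|/negbT pb] //.
- by case: (separation_pole Pnc ba Q0 Pb Pa Qb Qa mom' gW pb pa).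
- by case: (separation_pole Pnc ab Q0 Pa Pb Qa Qb mom gW pa pb).
by rewrite (separation Pnc ab Q0 Pa Pb Qa Qb mom gW).
Qed.

End Main.

Section Antiderivative.
Variables (C : numClosedFieldType) (K : funField C).
Implicit Types (a : C) (S : K).

(* A pole of order n of S is a pole of order n + 1 of S'. *)
Lemma reg_antiderivative a S : reg a (fderiv S) -> reg a S.
Proof.
have [->|S0] := eqVneq S 0.
  by move=> _; rewrite -(rmorph0 (fconst K)); exact: reg_const.
pose v := fplace K a; move=> rS.
have [j [u [Ou Ou' e]]] := unif_factor v S0.
have u0 : u != 0 by apply: contraNneq S0 => u0; rewrite e u0 mulr0.
have fS : fil v j S by apply/filE; exists u.
have [j0|j0] : 0 <= j \/ j + 1 <= 1 /\ j != 0 by lia.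
  by apply/(fil_vring v); exact: fil_le j0 fS.
have f1 : fil v 1 (theta (unif v) S).
  rewrite /fil expr1z /theta fderiv_poly derivXsubC rmorph1 divr1 mulrAC.
  by rewrite divff ?unif_neq0 // mul1r.
case: j0 => j1 j0.
have := filB (fil_le j1 f1) (fil_theta_unif fS).
rewrite subKr => /(filC (j%:~R^-1)).
rewrite mulrA -rmorphM mulVf ?intr_eq0 // rmorph1 mul1r => fS'.
case: (vunit_not_fil1 Ou' u0).
have -> : u = unif v ^ (- j) * S.
  by rewrite e mulrA -expfzDr ?unif_neq0 // addNr expr0z mul1r.
by have := filM (fil_unif v (- j)) fS'; rewrite addrA addNr add0r.
Qed.

End Antiderivative.

Section RatfunBasics.
Local Notation "p %:F" := (FracField.tofrac p) (format "p %:F").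
Variable F : fieldType.
Implicit Types (f g w : ratfun F) (p q : {poly F}) (x c : F).

Lemma ratfun_repr f :
  f = (frac (repr f)).1%:F / (frac (repr f)).2%:F.
Proof.
have d0 := denom_ratioP (repr f).
have one0 := oner_neq0 {poly F}.
have d0F : (frac (repr f)).2%:F != 0 by rewrite tofrac_eq0.
apply: (canRL (mulfK d0F)).
rewrite -{1}(reprK f).
unlock FracField.tofrac.
rewrite -[LHS]FracField.pi_mul.
apply/eqmodP; rewrite /= /FracField.equivf /FracField.mulf /=.
by rewrite !numden_Ratio ?mulf_neq0 ?mulr1 // mulrC.
Qed.

Lemma rden_gcd_neq0 f : gcdp (frac (repr f)).1 (frac (repr f)).2 != 0.
Proof. by rewrite gcdp_eq0 (negPf (denom_ratioP _)) andbF. Qed.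

Lemma rden_neq0 f : rden f != 0.
Proof.
by rewrite /rden dvdp_div_eq0 ?dvdp_gcdr // denom_ratioP.
Qed.

Lemma rfracE f : f = (rnum f)%:F / (rden f)%:F.
Proof.
rewrite {1}(ratfun_repr f) /rnum /rden.
have g0 := rden_gcd_neq0 f.
have := divpK (dvdp_gcdl (frac (repr f)).1 (frac (repr f)).2).
have := divpK (dvdp_gcdr (frac (repr f)).1 (frac (repr f)).2).
move: (frac (repr f)).1 (frac (repr f)).2 g0 => n d g0 e1 e2.
rewrite -tofrac_eq0 in g0.
by rewrite -{1}e1 -{1}e2 !tofracM -mulf_div (divff g0) mulr1.
Qed.

Lemma coprime_rnum_rden f : coprimep (rnum f) (rden f).
Proof.
rewrite coprimep_div_gcd //.
by rewrite denom_ratioP orbT.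
Qed.

End RatfunBasics.

Definition ratFF (C : fieldType) : funField C :=
  @FunField C (ratfun C) (@FracField.tofrac {poly C}) (@tofrac_eq0 _)
    (@rnum C) (@rden C) (@rden_neq0 C) (@coprime_rnum_rden C) (@rfracE C).


Lemma fcomp_ratFF (C : fieldType) (f g : ratfun C) : @fcomp C (ratFF C) f g = rcomp f g.
Proof. by []. Qed.

(** * Contour integrals *)

Section PiecewiseIntegral.
Local Open Scope classical_set_scope.
Variable R : realType.
Local Notation mu := (@lebesgue_measure R).
Implicit Types (u v w t : R) (f g F G : R -> R) (s : seq R).

Lemma integrable_oo_cc g u v :
  mu.-integrable `]u, v[ (EFin \o g) -> mu.-integrable `[u, v] (EFin \o g).
Proof.
move=> /integrableP [mg ig]; apply/integrableP; split.
  by apply/emeasurable_fun_itv_bndo_bndcP/emeasurable_fun_itv_obnd_cbndP.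
rewrite (@integral_itv_bndoo R u v _ true false) //.
by apply: measurableT_comp.
Qed.

Section Piece.
Variables (u v : R) (g G : R -> R).
Hypotheses (uv : u < v) (cG : {within `[u, v], continuous G}).
Hypothesis gG : {in `]u, v[%R, g =1 G}.

Lemma integrable_piece_ext : mu.-integrable `[u, v] (EFin \o G).
Proof. by apply: continuous_compact_integrable => //; exact: segment_compact. Qed.

Lemma integrable_piece : mu.-integrable `[u, v] (EFin \o g).
Proof.
apply: integrable_oo_cc.
have e : {in `]u, v[%classic, EFin \o G =1 EFin \o g}.
  by move=> t; rewrite inE => tuv; rewrite /= gG.
apply: (@eq_integrable _ _ _ mu `]u, v[%classic _ _ _ e) => //.
apply: (@integrableS _ _ _ mu `[u, v]%classic) integrable_piece_ext => //.
exact: subset_itv_oo_cc.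
Qed.

Lemma FTC_piece F : {within `[u, v], continuous F} ->
  {in `]u, v[%R, forall t, is_derive t 1 F (G t)} ->
  \int[mu]_(t in `[u, v]) g t = F v - F u.
Proof.
move=> cF dF; rewrite /Rintegral.
rewrite (eq_integral_itv_bounded (g := G)); first last.
- exact: gG.
- apply/measurable_EFinP; apply: measurable_funS (measurable_int mu integrable_piece_ext) => //.
  exact: subset_itv_oo_cc.
- apply/measurable_EFinP; apply: measurable_funS (measurable_int mu integrable_piece) => //.
  exact: subset_itv_oo_cc.
rewrite (continuous_FTC2 (F := F)) //; last first.
  by move=> t /dF dFt; rewrite derive1E derive_val.
split; last 2 first.
- by have /(continuous_within_itvP _ uv) [] := cF.
- by have /(continuous_within_itvP _ uv) [] := cF.
by move=> t /dF; case.
Qed.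

End Piece.

Lemma itv_cc_split u w v : u <= w -> w <= v ->
  `[u, v]%classic = `[u, w]%classic `|` `]w, v]%classic.
Proof.
by move=> uw wv; rewrite -(@itv_bndbnd_setU _ _ _ (BRight w)) // bnd_simp.
Qed.

Lemma disjoint_cc_oc u w v : [disjoint `[u, w]%classic & `]w, v]%classic].
Proof.
apply/disj_setPS => y [/=]; rewrite !in_itv /= => /andP [_ yw] /andP [].
by rewrite ltNge yw.
Qed.

Lemma integrable_glue g u w v : u <= w -> w <= v ->
  mu.-integrable `[u, w] (EFin \o g) -> mu.-integrable `[w, v] (EFin \o g) ->
  mu.-integrable `[u, v] (EFin \o g).
Proof.
move=> uw wv i1 i2; have i2' : mu.-integrable `]w, v] (EFin \o g).
  by apply: integrableS i2 => //; apply: subset_itv_oc_cc.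
move: i1 i2' => /integrableP [m1 f1] /integrableP [m2 f2].
apply/integrableP; rewrite (itv_cc_split uw wv); split.
  by apply/measurable_funU.
rewrite ge0_integral_setU //.
- exact: lte_add_pinfty.
- by apply: measurableT_comp => //; apply/measurable_funU.
- exact: disjoint_cc_oc.
Qed.

Lemma Rintegral_glue g u w v : u <= w -> w <= v ->
  mu.-integrable `[u, w] (EFin \o g) -> mu.-integrable `[w, v] (EFin \o g) ->
  \int[mu]_(t in `[u, v]) g t = \int[mu]_(t in `[u, w]) g t + \int[mu]_(t in `[w, v]) g t.
Proof.
move=> uw wv i1 i2; have i := integrable_glue uw wv i1 i2.
rewrite (itv_cc_split uw wv) Rintegral_setU //; last first.
- exact: disjoint_cc_oc.
- by rewrite -itv_cc_split.
congr (_ + _); rewrite Rintegral_itv_obnd_cbnd //.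
by apply: integrableS i2 => //; apply: subset_itv_oc_cc.
Qed.

Lemma integrable_partition s g u v : itv_partition u v s ->
  (forall k, (k < size s)%N -> nth 0 (u :: s) k < nth 0 s k ->
    mu.-integrable `[nth 0 (u :: s) k, nth 0 s k] (EFin \o g)) ->
  mu.-integrable `[u, v] (EFin \o g).
Proof.
elim: s u => [|x s IH] u ps h.
  rewrite (itv_partition_nil ps); apply: integrable_oo_cc.
  by rewrite set_itvoo0; exact: integrable_set0.
have ux : u < x by case: ps => /= /andP [].
have ps' := itv_partition_cons ps.
apply: (integrable_glue (ltW ux) (itv_partition_le ps')).
  exact: (h 0%N).
by apply: IH ps' _ => k ks; exact: (h k.+1).
Qed.

Lemma Rintegral_partition s g F u v : itv_partition u v s ->
  (forall k, (k < size s)%N -> nth 0 (u :: s) k < nth 0 s k ->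
    mu.-integrable `[nth 0 (u :: s) k, nth 0 s k] (EFin \o g) /\
    \int[mu]_(t in `[nth 0 (u :: s) k, nth 0 s k]) g t
      = F (nth 0 s k) - F (nth 0 (u :: s) k)) ->
  \int[mu]_(t in `[u, v]) g t = F v - F u.
Proof.
elim: s u => [|x s IH] u ps h.
  by rewrite (itv_partition_nil ps) set_itv1 Rintegral_set1 subrr.
have ux : u < x by case: ps => /= /andP [].
have ps' := itv_partition_cons ps; have [i0 e0] := h 0%N isT ux.
have hs : forall k, (k < size s)%N -> nth 0 (x :: s) k < nth 0 s k ->
    mu.-integrable `[nth 0 (x :: s) k, nth 0 s k] (EFin \o g) /\
    \int[mu]_(t in `[nth 0 (x :: s) k, nth 0 s k]) g t
      = F (nth 0 s k) - F (nth 0 (x :: s) k) by move=> k ks; exact: (h k.+1).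
rewrite (Rintegral_glue (ltW ux) (itv_partition_le ps') i0); last first.
  by apply: (integrable_partition ps') => k ks kk; case: (hs k ks kk).
by rewrite (IH x ps' hs) e0 /= addrC addrA subrK.
Qed.

End PiecewiseIntegral.

Section ComplexPaths.
Local Open Scope classical_set_scope.
Variable R : realType.
Local Notation mu := (@lebesgue_measure R).
Local Notation Re := complex.Re.
Local Notation Im := complex.Im.
Implicit Types (u v t : R) (z w l m : R[i]) (phi psi : R -> R[i]) (p : {poly R[i]}).

Lemma ReM z w : Re (z * w) = Re z * Re w - Im z * Im w.
Proof. by case: z w => [a b] [c d]. Qed.

Lemma ImM z w : Im (z * w) = Re z * Im w + Im z * Re w.
Proof. by case: z w => [a b] [c d]. Qed.

Lemma ReD z w : Re (z + w) = Re z + Re w.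
Proof. by case: z w => [a b] [c d]. Qed.

Lemma ImD z w : Im (z + w) = Im z + Im w.
Proof. by case: z w => [a b] [c d]. Qed.

Lemma ReN z : Re (- z) = - Re z.
Proof. by case: z. Qed.

Lemma ImN z : Im (- z) = - Im z.
Proof. by case: z. Qed.

Lemma normsq_eq0 z : (Re z ^+ 2 + Im z ^+ 2 == 0) = (z == 0).
Proof.
case: z => a b /=; rewrite paddr_eq0 ?sqr_ge0 // !sqrf_eq0.
by rewrite eq_complex.
Qed.

Lemma ReV z : Re z^-1 = Re z * (Re z ^+ 2 + Im z ^+ 2)^-1.
Proof. by case: z. Qed.

Lemma ImV z : Im z^-1 = - (Im z * (Re z ^+ 2 + Im z ^+ 2)^-1).
Proof. by case: z. Qed.

Definition ccont u v phi :=
  {within `[u, v], continuous (fun t => Re (phi t))} /\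
  {within `[u, v], continuous (fun t => Im (phi t))}.

Definition cderiv phi t l :=
  is_derive t (1 : R) (fun t => Re (phi t)) (Re l) /\
  is_derive t (1 : R) (fun t => Im (phi t)) (Im l).

Lemma ccont_cst u v z : ccont u v (fun=> z).
Proof. by split=> t; exact: cvg_cst. Qed.

Lemma within_ext (A : set R) (f g : R -> R) : f =1 g ->
  {within A, continuous f} -> {within A, continuous g}.
Proof. by move=> /funext ->. Qed.

Lemma is_derive_ext (f g : R -> R) t (d e : R) : f =1 g -> d = e ->
  is_derive t (1 : R) f d -> is_derive t (1 : R) g e.
Proof. by move=> /funext -> ->. Qed.

Lemma ccontD u v phi psi : ccont u v phi -> ccont u v psi ->
  ccont u v (fun t => phi t + psi t).
Proof.
move=> [f1 f2] [g1 g2]; split.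
  apply: within_ext (fun t => esym (ReD _ _)) _ => t.
  exact: (cvgD (f1 t) (g1 t)).
apply: within_ext (fun t => esym (ImD _ _)) _ => t.
exact: (cvgD (f2 t) (g2 t)).
Qed.

Lemma ccontM u v phi psi : ccont u v phi -> ccont u v psi ->
  ccont u v (fun t => phi t * psi t).
Proof.
move=> [f1 f2] [g1 g2]; split.
  apply: within_ext (fun t => esym (ReM _ _)) _ => t.
  exact: (cvgB (cvgM (f1 t) (g1 t)) (cvgM (f2 t) (g2 t))).
apply: within_ext (fun t => esym (ImM _ _)) _ => t.
exact: (cvgD (cvgM (f1 t) (g2 t)) (cvgM (f2 t) (g1 t))).
Qed.

Lemma ccontV u v phi : (forall t, t \in `[u, v]%R -> phi t != 0) ->
  ccont u v phi -> ccont u v (fun t => (phi t)^-1).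
Proof.
move=> nz [f1 f2].
have cN : {within `[u, v], continuous
    (fun t => (Re (phi t) ^+ 2 + Im (phi t) ^+ 2)^-1)}.
  apply: (@within_continuous_comp _ _ _ _
      (fun t => Re (phi t) ^+ 2 + Im (phi t) ^+ 2) (@GRing.inv R)) => [_ /set_mem [t tuv <-]|t].
    by apply: inv_continuous; rewrite normsq_eq0 nz.
  exact: (cvgD (cvgM (f1 t) (f1 t)) (cvgM (f2 t) (f2 t))).
split.
  apply: within_ext (fun t => esym (ReV _)) _ => t.
  exact: (cvgM (f1 t) (cN t)).
apply: within_ext (fun t => esym (ImV _)) _ => t.
exact: (cvgN (cvgM (f2 t) (cN t))).
Qed.

Lemma cderiv_cst t z : cderiv (fun=> z) t 0.
Proof. by split; exact: is_derive_cst. Qed.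

Lemma cderivD t phi psi l m : cderiv phi t l -> cderiv psi t m ->
  cderiv (fun t => phi t + psi t) t (l + m).
Proof.
move=> [f1 f2] [g1 g2]; split.
  apply: is_derive_ext (fun t => esym (ReD _ _)) (esym (ReD _ _))
    (is_deriveD f1 g1).
apply: is_derive_ext (fun t => esym (ImD _ _)) (esym (ImD _ _))
  (is_deriveD f2 g2).
Qed.

Lemma cderivM t phi psi l m : cderiv phi t l -> cderiv psi t m ->
  cderiv (fun t => phi t * psi t) t (l * psi t + phi t * m).
Proof.
move=> [f1 f2] [g1 g2]; split.
  apply: is_derive_ext (fun t => esym (ReM _ _)) _
    (is_deriveB (is_deriveM f1 g1) (is_deriveM f2 g2)).
  by rewrite ReD !ReM /GRing.scale /=; ring.
apply: is_derive_ext (fun t => esym (ImM _ _)) _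
  (is_deriveD (is_deriveM f1 g2) (is_deriveM f2 g1)).
by rewrite ImD !ImM /GRing.scale /=; ring.
Qed.

Lemma cderivV t phi l : phi t != 0 -> cderiv phi t l ->
  cderiv (fun t => (phi t)^-1) t (- (l * (phi t)^-1 * (phi t)^-1)).
Proof.
rewrite -normsq_eq0 => nz [f1 f2].
have dD := is_deriveD (is_deriveX 2 f1) (is_deriveX 2 f2).
have dN := @is_deriveV R (fun t => Re (phi t) ^+ 2 + Im (phi t) ^+ 2) t _ _ nz dD.
split.
  apply: is_derive_ext (fun t => esym (ReV _)) _ (is_deriveM f1 dN).
  rewrite /GRing.scale /= ReN !ReM !ImM ReV ImV.
  move: nz; move: (Re _) (Im _) (Re _) (Im _) => x y x' y' nz.
  by field.
apply: is_derive_ext (fun t => esym (ImV _)) _ (is_deriveN (is_deriveM f2 dN)).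
rewrite /GRing.scale /= ImN !ImM !ReM ReV ImV.
move: nz; move: (Re _) (Im _) (Re _) (Im _) => x y x' y' nz.
by field.
Qed.

End ComplexPaths.

Section ContourIntegrals.
Local Open Scope classical_set_scope.
Variable R : realType.
Local Notation mu := (@lebesgue_measure R).
Local Notation Re := complex.Re.
Local Notation Im := complex.Im.
Implicit Types (u v t : R) (z c : R[i]) (phi psi g h : R -> R[i]) (p : {poly R[i]})
  (S T : ratfun R[i]).

Definition C1path u v phi g :=
  [/\ ccont u v phi, ccont u v g & {in `]u, v[%R, forall t, cderiv phi t (g t)}].

Lemma C1path_ext u v phi psi g h : phi =1 psi -> g =1 h ->
  C1path u v phi g -> C1path u v psi h.
Proof. by move=> /funext -> /funext ->. Qed.

Lemma C1path_cst u v z : C1path u v (fun=> z) (fun=> 0).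
Proof. by split=> [||t _]; [exact: ccont_cst|exact: ccont_cst|exact: cderiv_cst]. Qed.

Lemma C1pathD u v phi psi g h : C1path u v phi g -> C1path u v psi h ->
  C1path u v (fun t => phi t + psi t) (fun t => g t + h t).
Proof.
move=> [c1 d1 e1] [c2 d2 e2]; split; [exact: ccontD|exact: ccontD|move=> t tuv].
by apply: cderivD; [exact: e1|exact: e2].
Qed.

Lemma C1pathM u v phi psi g h : C1path u v phi g -> C1path u v psi h ->
  C1path u v (fun t => phi t * psi t) (fun t => g t * psi t + phi t * h t).
Proof.
move=> [c1 d1 e1] [c2 d2 e2]; split; first exact: ccontM.
  by apply: ccontD; exact: ccontM.
by move=> t tuv; apply: cderivM; [exact: e1|exact: e2].
Qed.

Lemma C1pathV u v phi g : {in `[u, v]%R, forall t, phi t != 0} -> C1path u v phi g ->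
  C1path u v (fun t => (phi t)^-1) (fun t => (- 1) * (g t * (phi t)^-1 * (phi t)^-1)).
Proof.
move=> nz [c1 d1 e1]; have cV := ccontV nz c1; split=> //.
  by apply: ccontM; [exact: ccont_cst|apply: ccontM => //; apply: ccontM].
move=> t tuv; rewrite mulN1r; apply: cderivV; last exact: e1.
by apply: nz; exact: subset_itv_oo_cc.
Qed.

Lemma C1path_horner u v phi g p : C1path u v phi g ->
  C1path u v (fun t => p.[phi t]) (fun t => p^`().[phi t] * g t).
Proof.
move=> c; elim/poly_ind: p => [|p z IH].
  by apply: C1path_ext (C1path_cst u v 0) => t; rewrite ?deriv0 horner0 ?mul0r.
apply: C1path_ext (C1pathD (C1pathM IH c) (C1path_cst u v z)) => t /=.
  by rewrite hornerMXaddC.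
by rewrite derivMXaddC hornerD hornerMX /=; ring.
Qed.

Lemma C1path_reval u v phi g S : C1path u v phi g ->
  {in `[u, v]%R, forall t, ~~ pole S (phi t)} ->
  exists2 h, C1path u v (fun t => reval S (phi t)) h &
    {in `[u, v]%R, forall t, h t = reval (rderiv S) (phi t) * g t}.
Proof.
move=> c nS; have nz : {in `[u, v]%R, forall t, (rden S).[phi t] != 0}.
  by move=> t /nS; rewrite /pole rootE.
have cM := C1pathM (C1path_horner (rnum S) c) (C1pathV nz (C1path_horner (rden S) c)).
eexists; first exact: cM.
move=> t /nz nzt /=.
have -> : reval (rderiv S) (phi t) = ((rnum S)^`() * rden S - rnum S * (rden S)^`()).[phi t]
    / (rden S ^+ 2).[phi t].
  by apply: (@feval_frac _ (ratFF R[i])); rewrite horner_exp expf_neq0.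
rewrite hornerD hornerN !hornerM.
by field.
Qed.

Variable gamma : R -> R[i].
Hypothesis gamma_smooth : piecewise_smooth gamma.

Lemma velocity_eq u v g t : C1path u v gamma g -> t \in `]u, v[%R ->
  velocity gamma t = g t.
Proof.
move=> [_ _ d] /d [dr di]; rewrite /velocity !derive1E /ReC /ImC !derive_val.
by case: (g t).
Qed.

Lemma C1path_pieces : exists2 s, itv_partition 0 1 s & forall k, (k < size s)%N ->
  nth 0 (0 :: s) k < nth 0 s k ->
  {subset `[nth 0 (0 :: s) k, nth 0 s k]%R <= `[0, 1]%R : interval R} /\
  exists g, C1path (nth 0 (0 :: s) k) (nth 0 s k) gamma g.
Proof.
have [s [ps h]] := gamma_smooth; exists s => // k ks ltk; split.
  apply: subitvP; rewrite subitvE !bnd_simp.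
  have ge := itv_partition_nth_ge (ltnW ks : (k < (size s).+1)%N) ps.
  have le := itv_partition_nth_le (ks : (k.+1 < (size s).+1)%N) ps.
  have e1 := @set_nth_default R (0 :: s) 1 0 k (ltnW ks).
  have e2 := @set_nth_default R s 1 0 k ks.
  by rewrite e1 e2 ge.
have [[cr [gr [cgr dr]]] [ci [gi [cgi di]]]] := h k ks.
exists (fun t => (gr t +i* gi t)%C); split=> // t tuv; split; [exact: dr|exact: di].
Qed.

Definition regular_on S := {in `[0, 1]%R, forall t, ~~ pole S (gamma t)}.

Lemma integrable_reval S : regular_on S ->
  mu.-integrable `[0, 1] (EFin \o (fun t => Re (reval S (gamma t) * velocity gamma t))) /\
  mu.-integrable `[0, 1] (EFin \o (fun t => Im (reval S (gamma t) * velocity gamma t))).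
Proof.
move=> rS; have [s ps h] := C1path_pieces.
have cS k : (k < size s)%N -> nth 0 (0 :: s) k < nth 0 s k -> exists2 G,
    ccont (nth 0 (0 :: s) k) (nth 0 s k) G &
    {in `](nth 0 (0 :: s) k), (nth 0 s k)[%R,
      forall t, reval S (gamma t) * velocity gamma t = G t}.
  move=> ks ltk; have [sub [g c]] := h k ks ltk.
  have [|S' [cS _ _] _] := C1path_reval (S := S) c; first by move=> t /sub /rS.
  exists (fun t => reval S (gamma t) * g t); first by case: c => _ cg _; exact: ccontM.
  by move=> t tuv; rewrite (velocity_eq c).
split; apply: (integrable_partition ps) => k ks ltk; have [G [cr ci] e] := cS k ks ltk.
  have er : {in `](nth 0 (0 :: s) k), (nth 0 s k)[%R,
      (fun t => Re (reval S (gamma t) * velocity gamma t)) =1 (fun t => Re (G t))}.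
    by move=> t /e ->.
  exact: (integrable_piece cr er).
have er : {in `](nth 0 (0 :: s) k), (nth 0 s k)[%R,
    (fun t => Im (reval S (gamma t) * velocity gamma t)) =1 (fun t => Im (G t))}.
  by move=> t /e ->.
exact: (integrable_piece ci er).
Qed.

Lemma contour_integral_rderiv S : regular_on S ->
  contour_integral gamma (reval (rderiv S)) = reval S (gamma 1) - reval S (gamma 0).
Proof.
move=> rS; have [s ps h] := C1path_pieces.
have cS k : (k < size s)%N -> nth 0 (0 :: s) k < nth 0 s k -> exists2 G,
    C1path (nth 0 (0 :: s) k) (nth 0 s k) (fun t => reval S (gamma t)) G &
    {in `](nth 0 (0 :: s) k), (nth 0 s k)[%R,
      forall t, reval (rderiv S) (gamma t) * velocity gamma t = G t}.
  move=> ks ltk; have [sub [g c]] := h k ks ltk.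
  have [|G cG e] := C1path_reval (S := S) c; first by move=> t /sub /rS.
  exists G => // t tuv; rewrite (velocity_eq c tuv) e //.
  exact: subset_itv_oo_cc.
rewrite /contour_integral.
have -> : \int[mu]_(t in `[0, 1]) Re (reval (rderiv S) (gamma t) * velocity gamma t)
    = Re (reval S (gamma 1)) - Re (reval S (gamma 0)).
  apply: (@Rintegral_partition _ s _ (fun t => Re (reval S (gamma t))) 0 1 ps) => k ks ltk.
  have [G [[cr _] [gr _] dG] e] := cS k ks ltk.
  have er : {in `](nth 0 (0 :: s) k), (nth 0 s k)[%R,
      (fun t => Re (reval (rderiv S) (gamma t) * velocity gamma t)) =1 (fun t => Re (G t))}.
    by move=> t /e ->.
  split; first exact: (integrable_piece gr er).
  by apply: (FTC_piece ltk gr er cr) => t /dG [].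
have -> : \int[mu]_(t in `[0, 1]) Im (reval (rderiv S) (gamma t) * velocity gamma t)
    = Im (reval S (gamma 1)) - Im (reval S (gamma 0)).
  apply: (@Rintegral_partition _ s _ (fun t => Im (reval S (gamma t))) 0 1 ps) => k ks ltk.
  have [G [[_ cr] [_ gr] dG] e] := cS k ks ltk.
  have er : {in `](nth 0 (0 :: s) k), (nth 0 s k)[%R,
      (fun t => Im (reval (rderiv S) (gamma t) * velocity gamma t)) =1 (fun t => Im (G t))}.
    by move=> t /e ->.
  split; first exact: (integrable_piece gr er).
  by apply: (FTC_piece ltk gr er cr) => t /dG [].
by case: (reval S (gamma 1)) (reval S (gamma 0)) => [x y] [x' y'].
Qed.

Lemma eq_contour_integral (f f' : R[i] -> R[i]) :
  {in `[0, 1]%R, forall t, f (gamma t) = f' (gamma t)} ->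
  contour_integral gamma f = contour_integral gamma f'.
Proof.
move=> e; rewrite /contour_integral.
congr (_ +i* _)%C; apply: eq_Rintegral => t; rewrite inE => /e.
  by move=> ->.
by move=> ->.
Qed.

Lemma contour_integralD S T : regular_on S -> regular_on T ->
  contour_integral gamma (fun x => reval S x + reval T x) =
  contour_integral gamma (reval S) + contour_integral gamma (reval T).
Proof.
move=> /integrable_reval [Sr Si] /integrable_reval [Tr Ti].
rewrite /contour_integral; apply/eqP; rewrite eq_complex /=; apply/andP; split; apply/eqP.
  by rewrite -(RintegralD _ Sr Tr); [apply: eq_Rintegral => t _|exact: measurable_itv];
     rewrite mulrDl ReD.
by rewrite -(RintegralD _ Si Ti); [apply: eq_Rintegral => t _|exact: measurable_itv];
   rewrite mulrDl ImD.
Qed.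

Lemma contour_integralZ c S : regular_on S ->
  contour_integral gamma (fun x => c * reval S x) = c * contour_integral gamma (reval S).
Proof.
move=> /integrable_reval [Sr Si].
have iZ (k : R) (f : R -> R) : mu.-integrable `[0, 1] (EFin \o f) ->
    mu.-integrable `[0, 1] (EFin \o (fun t => k * f t)).
  by move=> fi; apply: (integrableZl _ k fi); exact: measurable_itv.
rewrite /contour_integral; apply/eqP; rewrite eq_complex ReM ImM /=.
apply/andP; split; apply/eqP.
  rewrite -!RintegralZl // -RintegralB //; [|exact: iZ|exact: iZ].
  by apply: eq_Rintegral => t _; rewrite -mulrA ReM.
rewrite -!RintegralZl // -RintegralD //; [|exact: iZ|exact: iZ].
by apply: eq_Rintegral => t _; rewrite -mulrA ImM.
Qed.

End ContourIntegrals.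

Section Moments.
Variables (R : realType) (gamma : R -> R[i]).
Hypothesis gamma_smooth : piecewise_smooth gamma.

Lemma contour_integral_poly_linear (A B : R -> R[i])
    (T : nat -> {poly R[i]} -> ratfun R[i]) :
  (forall i h, regular_on gamma (T i h)) ->
  (forall i h, {in `[0, 1], forall t,
     reval (T i h) (gamma t) = h.[A t] * A t ^+ i * B t}) ->
  (forall i, contour_integral gamma (reval (T i 1)) = 0) ->
  forall h, contour_integral gamma (reval (T 0%N h)) = 0.
Proof.
move=> rT eT T1 h; move: 0%N; elim/poly_ind: h => [|h c IH] i.
  rewrite -[RHS](mul0r (contour_integral gamma (reval (T i 1)))) -contour_integralZ //.
  by apply: eq_contour_integral => t t01; rewrite eT // horner0 !mul0r.
transitivity (contour_integral gamma (fun x => reval (T i.+1 h) x + reval (T i c%:P) x)).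
  apply: eq_contour_integral => t t01.
  by rewrite !eT // hornerMXaddC hornerC exprS; ring.
rewrite contour_integralD // IH add0r.
rewrite -[RHS](mulr0 c) -(T1 i) -contour_integralZ //.
by apply: eq_contour_integral => t t01; rewrite !eT // !hornerC; ring.
Qed.

Variables (P Q : ratfun R[i]) (j : nat).
Local Notation K := (ratFF R[i]).
Hypothesis gamma_nopole : forall t : R, t \in `[0, 1] ->
  ~~ pole P (gamma t) /\ ~~ pole Q (gamma t).
Hypothesis moments : forall i,
  contour_integral gamma
    (fun x => reval P x ^+ i * reval Q x ^+ j * reval (rderiv P) x) = 0.

Let T i (h : {poly R[i]}) : K :=
  (pev (P : K) h * (P : K) ^+ i) * ((Q : K) ^+ j * fderiv (P : K)).

Let regT i h t : t \in `[0, 1] -> reg (K := K) (gamma t) (T i h) /\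
  feval (T i h) (gamma t) = (h.[feval (P : K) (gamma t)] * feval (P : K) (gamma t) ^+ i) *
   (feval (Q : K) (gamma t) ^+ j * feval (fderiv (P : K)) (gamma t)).
Proof.
move=> /gamma_nopole [rP rQ].
have [r1 e1] := @reg_pev _ K _ P h rP; have [r2 e2] := @regX _ K _ P i rP.
have [r3 e3] := @regX _ K _ Q j rQ; have r4 := @reg_deriv _ K _ P rP.
have [r5 e5] := regM r1 r2; have [r6 e6] := regM r3 r4; have [r7 e7] := regM r5 r6.
split; first exact: r7.
by rewrite [LHS]e7 e5 e6 e1 e2 e3.
Qed.

Lemma polynomial_moments h :
  contour_integral gamma (reval (pev (P : K) h * (Q : K) ^+ j * fderiv (P : K) : K)) = 0.
Proof.
have -> : pev (P : K) h * (Q : K) ^+ j * fderiv (P : K) = T 0%N h.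
  by rewrite /T expr0 mulr1 mulrA.
apply: (@contour_integral_poly_linear (fun t => reval P (gamma t))
  (fun t => reval Q (gamma t) ^+ j * reval (rderiv P) (gamma t)) T).
- by move=> i h' t /(@regT i h') [].
- by move=> i h' t /(@regT i h') [_].
move=> i; rewrite -[RHS](moments i); apply: eq_contour_integral => t /(@regT i 1) [_ e].
by rewrite [LHS]e hornerC mul1r mulrA.
Qed.

End Moments.

Lemma order_ratFF (C : numClosedFieldType) (f : ratfun C) a :
  @order C (ratFF C) a ((f : ratFF C) - fconst (ratFF C) (@feval C (ratFF C) f a)) =
    multiplicity f a.
Proof. by []. Qed.

Unset Implicit Arguments.

Theorem theorem6p1 (R : realType) (P Q : ratfun R[i]) (gamma : R -> R[i])
    (a b : R[i])
    (P_nonconst : forall c : R[i], P <> rconst c)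
    (Q_neq0 : Q <> 0)
    (gamma_smooth : piecewise_smooth gamma)
    (gamma_start : gamma 0 = a)
    (gamma_end : gamma 1 = b)
    (gamma_nonclosed : a <> b)
    (gamma_nopole : forall t : R, t \in `[0, 1] ->
       ~~ pole P (gamma t) /\ ~~ pole Q (gamma t))
    (moments : forall i j : nat,
       (1 <= j <= multiplicity P a + multiplicity P b - 1)%N ->
       contour_integral gamma
         (fun x => reval P x ^+ i * reval Q x ^+ j * reval (rderiv P) x) = 0) :
  exists Pt Qt W : ratfun R[i],
    [/\ P = rcomp Pt W, Q = rcomp Qt W & proj_eval W a = proj_eval W b].
Proof.
have t0 : (0 : R) \in `[0, 1] by rewrite in_itv /= lexx ler01.
have t1 : (1 : R) \in `[0, 1] by rewrite in_itv /= lexx ler01.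
have [rPa rQa] := gamma_nopole 0 t0; have [rPb rQb] := gamma_nopole 1 t1.
rewrite gamma_start in rPa rQa; rewrite gamma_end in rPb rQb.
have ab : a != b by apply/eqP.
pose K := ratFF R[i].
have Q0 : (Q : K) != 0 by apply/eqP.
have nP : nonconst (P : K) := P_nonconst.
have main : forall j (h : {poly R[i]}) (S : K),
    (1 <= j <= order a ((P : K) - fconst K (feval (P : K) a)) +
               order b ((P : K) - fconst K (feval (P : K) b)) - 1)%N ->
    fderiv S = pev (P : K) h * (Q : K) ^+ j * fderiv (P : K) -> reg a S -> reg b S ->
    feval S a = feval S b.
  move=> j h S; rewrite !order_ratFF => jr e rSa rSb.
  have rS : regular_on gamma S.
    move=> t /gamma_nopole [rP rQ]; apply: (@reg_antiderivative R[i] K).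
    have [r1 _] := @reg_pev _ K _ P h rP; have [r2 _] := @regX _ K _ Q j rQ.
    have [r3 _] := regM r1 r2; have r4 := @reg_deriv _ K _ P rP.
    by have [] := regM r3 r4; rewrite -e.
  have pm := @polynomial_moments R gamma gamma_smooth P Q j gamma_nopole
    (fun i => moments i j jr) h.
  have := contour_integral_rderiv gamma_smooth rS; rewrite gamma_start gamma_end.
  move: pm; rewrite -e => pm; rewrite [LHS]pm.
  by move=> /esym /subr0_eq /esym.
have [Pt [Qt [W [eP eQ eW]]]] := @decomposition R[i] K P Q a b nP ab Q0 rPa rPb rQa rQb main.
by exists Pt, Qt, W; split; rewrite -?fcomp_ratFF.
Qed.
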